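(* Let $f$ be an SGF on $\mathbb{R}^d$ or $\mathbb{Z}^d$ with spectral measure $\mu$ such that $\mu_{a.c.}\neq0$, $$\alpha^+:=\limsup_{\delta\to0}\frac{\log\mu[B(\delta)]}{\log\delta}<d,$$ and there is $c>0$ such that $\mu[B(2\delta)]\le c\,\mu[B(\delta)]$ for all $\delta>0$. Then, as $T\to\infty$, $$\theta_\mu(T)\asymp\frac{\log T}{\mu[B(1/T)]}.$$
   Context: An SGF on $\mathbb{R}^d$ or $\mathbb{Z}^d$ is a continuous (in the case of $\mathbb{R}^d$), centred, non-degenerate, stationary Gaussian field $f$. Its covariance kernel is $K(x)=\mathbb{E}[f(0)f(x)]$; its spectral measure $\mu$ is the unique non-negative, finite, symmetric measure with $K=\mathcal{F}[\mu]$, where $\mathcal{F}[\mu](x)=\int e^{-2\pi i\langle\lambda,x\rangle}d\mu(\lambda)$. It lives on $\mathbb{R}^d$ for fields on $\mathbb{R}^d$, and on the torus $\mathbb{R}^d/\mathbb{Z}^d$ for fields on $\mathbb{Z}^d$. $\mu_{a.c.}$ is the absolutely continuous part of $\mu$. $B(r)$ is the closed Euclidean ball of radius $r$ about the origin; for fields on $\mathbb{Z}^d$, a spatial domain $B(T)$ is understood as $B(T)\cap\mathbb{Z}^d$. $\theta_\mu(T)=-\log\mathbb{P}[f(x)\ge0\text{ for all }x\in B(T)]$. $a\asymp b$ means that $a/b$ is bounded above and bounded away from zero (here as $T\to\infty$). *)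

(* Defs.v *)
From HB Require Import structures.
From mathcomp Require Import all_boot all_order all_algebra.
From mathcomp Require Import complex.
From mathcomp Require Import all_classical all_reals all_analysis.

Set Implicit Arguments.
Unset Strict Implicit.
Unset Printing Implicit Defensive.

Import Order.TTheory GRing.Theory Num.Theory.
Import numFieldNormedType.Exports.

Local Open Scope classical_set_scope.
Local Open Scope ring_scope.

Section EuclideanSpace.
Context {R : realType} {d : nat}.
Implicit Types x y : 'rV[R]_d.

Definition dot x y : R := \sum_i x 0 i * y 0 i.

(* The library norm on matrices is the sup norm, hence this definition. *)
Definition enorm x : R := Num.sqrt (dot x x).

Definition eball (r : R) : set 'rV[R]_d := [set x | enorm x <= r].

Definition box x y : set 'rV[R]_d :=
  [set z | forall i, x 0 i <= z 0 i <= y 0 i].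

(* Lebesgue (outer) measure on R^d: countable covers by boxes. *)
Definition lebesgue (A : set 'rV[R]_d) : \bar R :=
  ereal_inf [set v | exists a b : nat -> 'rV[R]_d,
    [/\ forall n i, a n 0 i <= b n 0 i,
        A `<=` \bigcup_n box (a n) (b n) &
        v = (\sum_(0 <= n <oo) (\prod_i (b n 0 i - a n 0 i))%:E)%E]].

End EuclideanSpace.

(* R^d with its Borel sigma-algebra. *)
Definition borel (R : realType) (d : nat) :=
  g_sigma_algebraType (@open 'rV[R]_d).

(* The field lives on R^d (Continuum) or on Z^d (Lattice). *)
Inductive domain := Continuum | Lattice.

Definition site (R : realType) (d : nat) (k : domain) : zmodType :=
  match k with
  | Continuum => 'rV[R]_d
  | Lattice => 'rV[int]_d
  end.

Definition loc {R : realType} {d : nat} {k : domain} :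
    site R d k -> 'rV[R]_d :=
  match k return site R d k -> 'rV[R]_d with
  | Continuum => id
  | Lattice => map_mx intr
  end.

Definition continuous_on_sites {R : realType} {d : nat} {k : domain} :
    (site R d k -> R) -> Prop :=
  match k return (site R d k -> R) -> Prop with
  | Continuum => fun g => continuous (g : 'rV[R]_d -> R)
  | Lattice => fun _ => True
  end.

(* Frequencies live on R^d / L, with L = {0} for fields on R^d and L = Z^d for
   fields on Z^d. A measure on R^d / L is encoded as a Borel measure on R^d
   carried by a fundamental domain of L (R^d, resp. [-1/2, 1/2)^d), and a
   subset of R^d / L by its L-periodic preimage in R^d. *)
Definition periods {R : realType} {d : nat} (k : domain) : set 'rV[R]_d :=
  match k with
  | Continuum => [set 0]
  | Lattice => range (map_mx intr : 'rV[int]_d -> 'rV[R]_d)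
  end.

Definition fundamental_domain {R : realType} {d : nat} (k : domain) :
    set 'rV[R]_d :=
  match k with
  | Continuum => setT
  | Lattice => [set l | forall i, - 2^-1 <= l 0 i < 2^-1]
  end.

(* The preimage in R^d of the image of A in R^d / L. *)
Definition periodize {R : realType} {d : nat} (k : domain)
    (A : set 'rV[R]_d) : set 'rV[R]_d :=
  [set l | exists2 p, periods k p & A (l - p)].

Section SpectralMeasure.
Context {R : realType} {d : nat} (k : domain).
Implicit Types mu : {finite_measure set (borel R d) -> \bar R}.

(* mu[B(r)], where B(r) is a ball of R^d or of the torus R^d / Z^d. *)
Definition ball_mass mu (r : R) : \bar R := mu (periodize k (eball r)).

(* The integral of exp(- 2 i pi <l, x>), by real and imaginary parts. *)
Definition fourier mu (x : 'rV[R]_d) : R[i] :=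
  Complex (\int[mu]_l cos (- (2 * pi * dot l x)))%R
          (\int[mu]_l sin (- (2 * pi * dot l x)))%R.

Record is_spectral_measure (K : site R d k -> R) mu : Prop := {
  spectral_carrier : mu (~` fundamental_domain k) = 0%E ;
  spectral_symmetric : forall A : set (borel R d), measurable A ->
    mu (periodize k [set l : 'rV[R]_d | A (- l)]) = mu (periodize k A) ;
  spectral_fourier : forall x, (K x)%:C%C = fourier mu (loc x)
}.

(* nu is the absolutely continuous part of mu in its Lebesgue decomposition.
   On the torus, Haar null sets are the Lebesgue null subsets of the
   fundamental domain. *)
Definition is_ac_part mu (nu : {measure set (borel R d) -> \bar R}) : Prop :=
  (forall A : set (borel R d), measurable A -> lebesgue A = 0%E ->
     nu A = 0%E) /\
  exists sing : {measure set (borel R d) -> \bar R},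
    (exists N : set (borel R d),
       [/\ measurable N, lebesgue N = 0%E & sing (~` N) = 0%E]) /\
    (forall A : set (borel R d), measurable A -> mu A = (nu A + sing A)%E).

(* lne and the division are extended-real valued: the quotient is +oo at
   0 < delta < 1 when the ball has mass 0. *)
Definition alpha_plus mu : \bar R :=
  limf_esup (fun delta : R => lne (ball_mass mu delta) / (ln delta)%:E)%E 0^'+.

End SpectralMeasure.

Section GaussianField.
Context {disp : measure_display} {Omega : measurableType disp} {R : realType}.
Variable P : probability Omega R.

(* Constants count as Gaussian; normal_prob m 0 is not a Dirac mass. *)
Definition is_gaussian (X : Omega -> R) : Prop :=
  exists m s : R, forall A : set R, measurable A ->
    P (X @^-1` A) = if s == 0 then dirac m A else normal_prob m s A.

Context {d : nat} {k : domain}.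
Variable f : site R d k -> {RV P >-> R}.

Definition covariance_kernel (x : site R d k) : R :=
  fine ('E_P[(fun w => f 0 w * f x w)%R])%E.

Record is_SGF : Prop := {
  sgf_continuous : forall w, continuous_on_sites (fun x => f x w) ;
  sgf_gaussian : forall (n : nat) (x : 'I_n -> site R d k) (a : 'I_n -> R),
    is_gaussian (fun w => \sum_(i < n) a i * f (x i) w) ;
  sgf_centred : forall x, ('E_P[f x] = 0)%E ;
  sgf_stationary : forall (t : site R d k) (n : nat) (x : 'I_n -> site R d k)
      (A : 'I_n -> set R), (forall i, measurable (A i)) ->
    P [set w | forall i, A i (f (x i + t) w)] =
    P [set w | forall i, A i (f (x i) w)] ;
  sgf_nondegenerate : 0 < covariance_kernel 0
}.

(* Equal to +oo when the probability is 0. *)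
Definition theta (T : R) : \bar R :=
  (- lne (P [set w | forall x, eball T (loc x) -> (0 <= f x w)%R]))%E.

End GaussianField.

Definition asymp {R : realType} (a b : R -> \bar R) : Prop :=
  exists c C : R, 0 < c /\
    \forall T \near +oo, (c%:E <= a T / b T <= C%:E)%E.

(* Main.v *)
(** Write m = mu (B (1 / T)).

    Lower bound on the probability.  Convolving with powers of a Fejer-like
    kernel at scale T gives X = sum_i p_i f(x_i) with p_i >= 0 whose spectral
    multiplier lives essentially on B (1 / T); by doubling, Var X <= C m, while
    Cov (X, f x) >= kappa m for x in B (T).  The residual
    f x - (Cov (X, f x) / Var X) X is independent of X, and by Fernique's
    estimate on the unit cells of B (T) it stays above - C sqrt (log T) with
    probability at least 1/2.  Hence f >= 0 on B (T) as soon as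
    X >= C sqrt (log T) Var X / m, whose probability is at least
    exp (- C' log T / m).

    Upper bound on the probability.  Since mu_ac != 0, there is a set E of
    positive spectral mass on which trigonometric polynomials satisfy a Bessel
    inequality; pivoted elimination of the Gram matrix of the exponentials in
    L^2 (E) then yields c T ^ d lattice points s of B (T) such that f at each
    of them has conditional variance at least delta given the next ones.  If
    f >= 0 and the mean of f over s is at most b / 2, then f <= b on half of s;
    with b = eps sqrt (log T) this has probability at most
    exp (- c' T ^ (d - eta)), which is negligible against exp (- log T / m)
    because alpha^+ < d.  If instead the means over most translates of s exceed
    b / 2, then so does, up to a constant factor, a weighted average of these
    means whose variance is at most C m, and the Gaussian tail bound concludes.

    A centred Gaussian family is handled through the Laplace transforms of its
    linear combinations, which determine all its finite-dimensional laws. *)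

Require Import Defs.
From HB Require Import structures.
From mathcomp Require Import all_boot all_order all_algebra.
From mathcomp Require Import complex.
From mathcomp Require Import all_classical all_reals all_analysis.
From mathcomp Require Import measurable_realfun ring lra zify.

Import Order.TTheory GRing.Theory Num.Theory.
Import numFieldNormedType.Exports.

Local Open Scope classical_set_scope.
Local Open Scope ring_scope.

(** * Uniqueness of a measure with finite Laplace transform *)

(** Doubling acts through one number, an exponent m with 2 c <= 4^m. A Fejer multiplier with window
    L decays only like (L |lambda|)^-2; its m-th power decays faster than the mass of balls can
    grow, so its integral is controlled by the mass of a single ball. Averages have to be finite
    sums over sites, to remain linear combinations of the field. On R^d they live on a grid of mesh
    1/q, whose q-periodic multiplier also picks up aliased frequencies; q is taken so large that
    these carry negligible mass. On Z^d the mesh 1 has none. In the upper bound, eps is fixed by a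
    competition. A Gaussian variable of variance at least delta must fall below - 3 b with
    probability of order T^-eta, which makes b^2 a multiple of eta delta log T; about T^d sites then
    give the exponent T^(d - eta), which has to exceed log T / m <= T^alpha log T. Hence eta is half
    of d - alpha. A positive fraction of the sites survives the elimination because Bessel's
    inequality bounds the Gram matrix by a constant free of T, while its trace is of order T^d. *)

Lemma expR_sub1_le {R : realType} (z : R) : expR z - 1 <= z * expR z.
Proof.
have := expR_ge1Dx (- z); rewrite expRN => h.
have e0 := expR_gt0 z.
have : (1 - z) * expR z <= 1.
  by rewrite -ler_pdivlMr// div1r.
lra.
Qed.

Lemma norm_expR_sub1 {R : realType} (z : R) : `|expR z - 1| <= `|z| * expR `|z|.
Proof.
have h1 := expR_sub1_le z; have h2 := expR_ge1Dx z.
have e1 : 1 <= expR `|z| by rewrite -[leLHS]expR0 ler_expR.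
have [z0|z0] := lerP 0 z.
  by rewrite (ger0_norm z0) in e1 *; rewrite ger0_norm; lra.
have : expR z <= 1 by rewrite -[leRHS]expR0 ler_expR ltW.
move=> ez; rewrite ler0_norm ?subr_le0//; rewrite (ltr0_norm z0) in e1 *.
by nra.
Qed.

(** N (exp (y / N) - 1) is a difference quotient at 0 of t |-> exp (t y), hence tends to y. This
    bound is uniform in N and serves for domination; the next lemma gives the rate. *)
Lemma norm_mul_expR_sub1 {R : realType} (N y : R) : 1 <= N ->
  `|N * (expR (N^-1 * y) - 1)| <= `|y| * expR `|y|.
Proof.
move=> N1; have N0 : 0 < N by lra.
rewrite normrM gtr0_norm//.
apply: (le_trans (ler_wpM2l (ltW N0) (norm_expR_sub1 _))).
rewrite normrM gtr0_norm ?invr_gt0// !mulrA divff ?gt_eqF// mul1r.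
by rewrite ler_wpM2l// ler_expR ler_piMl// invf_le1.
Qed.

Lemma dist_mul_expR_sub1 {R : realType} (N y : R) : 1 <= N ->
  `|N * (expR (N^-1 * y) - 1) - y| <= N^-1 * (`|y| * (`|y| * expR `|y|)).
Proof.
move=> N1; have N0 : 0 < N by lra.
have h1 := expR_sub1_le (N^-1 * y).
have h2 := expR_ge1Dx (N^-1 * y).
have h3 := norm_expR_sub1 (N^-1 * y).
have e1 : y <= N * (expR (N^-1 * y) - 1) by rewrite -ler_pdivrMl// lerBrDl.
have e2 : N * (expR (N^-1 * y) - 1) <= y * expR (N^-1 * y).
  by rewrite -ler_pdivlMl// mulrA.
rewrite ger0_norm ?subr_ge0//.
apply: (@le_trans _ _ (`|y| * `|expR (N^-1 * y) - 1|)).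
  by rewrite -normrM; apply: le_trans (ler_norm _); lra.
rewrite mulrCA ler_wpM2l//; apply: (le_trans h3).
have h4 : `|N^-1 * y| = N^-1 * `|y| by rewrite normrM gtr0_norm ?invr_gt0.
rewrite h4 -[leLHS]mulrA ler_wpM2l ?invr_ge0 ?(ltW N0)// ler_wpM2l// ler_expR.
by rewrite ler_piMl// invf_le1.
Qed.

Section SameIntegral.
Context {R : realType}.
Variables k1 k2 : {measure set R -> \bar R}.
Implicit Types g h : R -> R.

(** A vector space of test functions, closed under dominated limits ([same_lim]). It is enlarged
    from exponentials to monomials, cosines and sines, polynomials in sines, signs, and finally
    indicators of rays. *)
Let same h :=
  [/\ k1.-integrable setT (EFin \o h), k2.-integrable setT (EFin \o h) &
      \int[k1]_x (h x)%:E = \int[k2]_x (h x)%:E]%E.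

Let same_ext h g : h =1 g -> same h -> same g.
Proof. by move=> /funext ->. Qed.

Let sameD g h : same g -> same h -> same (fun x => g x + h x).
Proof.
move=> [g1 g2 gE] [h1 h2 hE]; split.
- by have := integrableD measurableT g1 h1; apply: eq_integrable.
- by have := integrableD measurableT g2 h2; apply: eq_integrable.
under eq_integral do rewrite EFinD.
under [RHS]eq_integral do rewrite EFinD.
by rewrite (integralD measurableT g1 h1) (integralD measurableT g2 h2) gE hE.
Qed.

Let sameZ a h : same h -> same (fun x => a * h x).
Proof.
move=> [h1 h2 hE]; split.
- by have := integrableZl measurableT a h1; apply: eq_integrable.
- by have := integrableZl measurableT a h2; apply: eq_integrable.
under eq_integral do rewrite EFinM.
under [RHS]eq_integral do rewrite EFinM.
by rewrite integralZl// [RHS]integralZl// hE.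
Qed.

Let same_sum (I : Type) (s : seq I) (F : I -> R -> R) :
  same (fun=> 0) -> (forall i, same (F i)) ->
  same (fun x => \sum_(i <- s) F i x).
Proof.
move=> s0 sF; elim: s => [|i s IH].
  by apply: same_ext s0 => x; rewrite big_nil.
by apply: same_ext (sameD _ _ (sF i) IH) => x; rewrite big_cons.
Qed.

Let same_lim (h_ : nat -> R -> R) g h : (forall n, same (h_ n)) -> same g ->
  (forall n x, `|h_ n x| <= g x) -> (forall x, h_ ^~ x @ \oo --> h x) ->
  same h.
Proof.
move=> sh [g1 g2 _] hg hh.
have mh n : measurable_fun setT (EFin \o h_ n).
  by have [/measurable_int] := sh n.
have mh' : measurable_fun setT (EFin \o h).
  apply/measurable_EFinP; apply: (@measurable_fun_cvg _ _ _ _ h_) => //.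
  by move=> n; apply/measurable_EFinP.
have hhE x : (EFin \o h_ ^~ x) @ \oo --> (h x)%:E.
  by apply: cvg_EFin; [exact: nearW|exact: hh].
have dom (k : {measure set R -> \bar R}) :
    k.-integrable setT (EFin \o g) ->
    k.-integrable setT (EFin \o h) /\
    (fun n => \int[k]_x (h_ n x)%:E)%E @ \oo --> (\int[k]_x (h x)%:E)%E.
  move=> ig.
  have [] := @dominated_convergence _ _ _ k setT measurableT
    (fun n => EFin \o h_ n) (EFin \o h) (EFin \o g) mh mh' _ ig _ => //.
  - by apply: aeW => x _; exact: hhE.
  - by apply: aeW => x n _ /=; rewrite lee_fin.
have [i1 c1] := dom k1 g1; have [i2 c2] := dom k2 g2; split => //.
apply: (cvg_unique _ c1) => //.
rewrite (_ : (fun n => _) = (fun n => \int[k2]_x (h_ n x)%:E)%E)//.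
by apply/funext => n; have [_ _ ->] := sh n.
Qed.

Hypothesis mgf_same : forall t : R,
  (\int[k1]_x (expR (t * x))%:E = \int[k2]_x (expR (t * x))%:E /\
   \int[k1]_x (expR (t * x))%:E < +oo)%E.

Let measurable_expRM (t : R) : measurable_fun setT (fun x : R => expR (t * x)).
Proof. by apply: measurableT_comp => //; exact: measurable_funM. Qed.

Let same_expR t : same (fun x => expR (t * x)).
Proof.
have [eq fin] := mgf_same t; split => //; apply/integrableP; split.
- by apply/measurable_EFinP.
- by under eq_integral do rewrite /= ger0_norm ?expR_ge0//.
- by apply/measurable_EFinP.
- by under eq_integral do rewrite /= ger0_norm ?expR_ge0//; rewrite -eq.
Qed.

Let same_cst c : same (fun=> c).
Proof.
apply: same_ext (sameZ c _ (same_expR 0)) => x.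
by rewrite mul0r expR0 mulr1.
Qed.

Let sameB g h : same g -> same h -> same (fun x => g x - h x).
Proof.
move=> sg sh; apply: same_ext (sameD _ _ sg (sameZ (-1) _ sh)) => x.
by rewrite mulN1r.
Qed.

(* Lies in the span of the exponentials and tends to y. *)
Let dexp (n : nat) (y : R) := n.+1%:R * (expR (n.+1%:R^-1 * y) - 1).

Let norm_dexp n y : `|dexp n y| <= `|y| * expR `|y|.
Proof. by apply: norm_mul_expR_sub1; rewrite ler1n. Qed.

Let cvg_dexp y : dexp ^~ y @ \oo --> y.
Proof.
apply/cvgrPdistC_le => /= _/posnumP[e]; near=> n.
have N1 : 1 <= n.+1%:R :> R by rewrite ler1n.
apply: (le_trans (dist_mul_expR_sub1 _ y N1)).
rewrite ler_pdivrMl// -ler_pdivrMr//.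
apply: (@le_trans _ _ n%:R); last by rewrite ler_nat.
by near: n; exact: nbhs_infty_ger.
Unshelve. all: by end_near. Qed.

(** [same] is not stable under products; carrying an exponential factor along makes multiplication
    by [dexp n] possible. *)
Let exp_class h := forall t, same (fun x => h x * expR (t * x)).

Let exp_classM n h : exp_class h -> exp_class (fun x => h x * dexp n x).
Proof.
move=> eh t; apply: same_ext (sameZ n.+1%:R _ (sameB _ _ (eh (n.+1%:R^-1 + t)) (eh t))) => x.
by rewrite /dexp mulrDl expRD; ring.
Qed.

Let exp_class_dexp n k : exp_class (fun x => dexp n x ^+ k).
Proof.
elim: k => [|k IH].
  by move=> t; apply: same_ext (same_expR t) => x; rewrite expr0 mul1r.
by move=> t; apply: same_ext (exp_classM n _ IH t) => x; rewrite exprSr.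
Qed.

Let same_exprn k : same (fun x => x ^+ k).
Proof.
have sd n : same (fun x => dexp n x ^+ k).
  by apply: same_ext (exp_class_dexp n k 0) => x; rewrite mul0r expR0 mulr1.
(* Domination: |dexp n x|^k <= (|x| exp |x|)^k <= exp (2 k |x|) <= exp (2 k x) + exp (- 2 k x). *)
apply: (same_lim _ _ _ sd (sameD _ _ (same_expR (2 * k%:R)) (same_expR (- (2 * k%:R))))).
- move=> n x; rewrite normrX.
  apply: (@le_trans _ _ ((expR `|x| * expR `|x|) ^+ k)).
    rewrite lerXn2r ?nnegrE ?mulr_ge0 ?expR_ge0//.
    apply: (le_trans (norm_dexp _ _)); rewrite ler_wpM2r ?expR_ge0//.
    by have := expR_ge1Dx `|x|; have := normr_ge0 x; lra.
  rewrite -expRD -expRM_natl.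
  have [x0|x0] := lerP 0 x.
    apply: (@le_trans _ _ (expR (2 * k%:R * x))); last by rewrite lerDl expR_ge0.
    by rewrite ler_expR (ger0_norm x0); rewrite le_eqVlt; apply/orP; left; apply/eqP; ring.
  apply: (@le_trans _ _ (expR (- (2 * k%:R) * x))); last by rewrite lerDr expR_ge0.
  by rewrite ler_expR (ltr0_norm x0); rewrite le_eqVlt; apply/orP; left; apply/eqP; ring.
- move=> x; elim: k {sd} => [|k IH]; first exact: cvg_cst.
  rewrite exprS (_ : (fun n => _) = (fun n => dexp n x * dexp n x ^+ k)).
    by apply: cvgM => //; exact: cvg_dexp.
  by apply/funext => n; rewrite exprS.
Qed.

Lemma series_norm_le_expR (u : R ^nat) (x : R) n :
  (forall i, `|u i| <= `|x| ^+ i / i`!%:R) -> `|series u n| <= expR `|x|.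
Proof.
move=> hu; apply: (le_trans (ler_norm_sum _ _ _)).
apply: (@le_trans _ _ (series (exp_coeff `|x|) n)).
  by rewrite /series /= ler_sum// => i _; exact: hu.
rewrite /expR; apply: nondecreasing_cvgn_le; last exact: is_cvg_series_exp_coeff.
apply: nondecreasing_series => i _ _; rewrite /exp_coeff /= divr_ge0// exprn_ge0//.
Qed.

Lemma expR_norm_le (t x : R) : expR `|t * x| <= expR (t * x) + expR (- t * x).
Proof.
rewrite mulNr; have [h|h] := lerP 0 (t * x).
  by rewrite ger0_norm// lerDl expR_ge0.
by rewrite ltr0_norm// lerDr expR_ge0.
Qed.

(** The partial sums of the Taylor series are polynomials in x, dominated by exp |t x|. *)
Let same_cos t : same (fun x => cos (t * x)).
Proof.
have sn n : same (fun x => series (cos_coeff (t * x)) n).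
  apply: (same_ext (fun x => \sum_(i <- index_iota 0 n)
     ((~~ odd i)%:R * (-1) ^ i./2 * t ^+ i / i`!%:R) * x ^+ i)).
    move=> x; rewrite /series /=; apply: eq_bigr => i _.
    by rewrite /=; rewrite /cos_coeff /sin_coeff /= exprMn; ring.
  apply: same_sum => [|i]; first exact: same_cst.
  by apply: sameZ; exact: same_exprn.
apply: (same_lim _ _ _ sn (sameD _ _ (same_expR t) (same_expR (- t)))).
- move=> n x; apply: le_trans (expR_norm_le t x).
  apply: series_norm_le_expR => i; rewrite /cos_coeff /=.
  rewrite !normrM normfV !normr_nat !normrX.
  rewrite ?normrX normrN normr1 expr1n mulr1 -[`|t| * `|x|]normrM.
  by case: odd; rewrite /= ?mul0r ?mul1r// divr_ge0// exprn_ge0.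
- move=> x; rewrite unlock; exact: is_cvg_series_cos_coeff.
Qed.

Let same_sin t : same (fun x => sin (t * x)).
Proof.
have sn n : same (fun x => series (sin_coeff (t * x)) n).
  apply: (same_ext (fun x => \sum_(i <- index_iota 0 n)
     ((odd i)%:R * (-1) ^+ i.-1./2 * t ^+ i / i`!%:R) * x ^+ i)).
    move=> x; rewrite /series /=; apply: eq_bigr => i _.
    by rewrite /=; rewrite /cos_coeff /sin_coeff /= exprMn; ring.
  apply: same_sum => [|i]; first exact: same_cst.
  by apply: sameZ; exact: same_exprn.
apply: (same_lim _ _ _ sn (sameD _ _ (same_expR t) (same_expR (- t)))).
- move=> n x; apply: le_trans (expR_norm_le t x).
  apply: series_norm_le_expR => i; rewrite /sin_coeff /=.
  rewrite !normrM normfV !normr_nat !normrX.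
  rewrite normrN normr1 expr1n mulr1 -[`|t| * `|x|]normrM.
  by case: odd; rewrite /= ?mul0r ?mul1r// divr_ge0// exprn_ge0.
- move=> x; rewrite unlock; exact: is_cvg_series_sin_coeff.
Qed.

(** As for [exp_class]: with a trigonometric factor carried along, the product-to-sum formulas give
    stability under multiplication by a sine or a cosine. *)
Let trig_class h := forall t,
  same (fun x => h x * cos (t * x)) /\ same (fun x => h x * sin (t * x)).

Let trig_class1 : trig_class (fun=> 1).
Proof.
by move=> t; split; [apply: same_ext (same_cos t)|apply: same_ext (same_sin t)]
  => x; rewrite mul1r.
Qed.

Let trig_classD h g : trig_class h -> trig_class g ->
  trig_class (fun x => h x + g x).
Proof.
by move=> th tg t; split; [apply: same_ext (sameD _ _ (th t).1 (tg t).1)|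
  apply: same_ext (sameD _ _ (th t).2 (tg t).2)] => x; rewrite mulrDl.
Qed.

Let trig_classZ a h : trig_class h -> trig_class (fun x => a * h x).
Proof.
by move=> th t; split; [apply: same_ext (sameZ a _ (th t).1)|
  apply: same_ext (sameZ a _ (th t).2)] => x; rewrite mulrA.
Qed.

Let trig_class_cosM s h : trig_class h -> trig_class (fun x => h x * cos (s * x)).
Proof.
move=> th t; have [c1 s1] := th (s + t); have [c2 s2] := th (s - t).
split.
  apply: same_ext (sameZ 2^-1 _ (sameD _ _ c1 c2)) => x.
  by rewrite [(s + t) * _]mulrDl [(s - t) * _]mulrBl cosB cosD; field.
apply: same_ext (sameZ 2^-1 _ (sameB _ _ s1 s2)) => x.
by rewrite [(s + t) * _]mulrDl [(s - t) * _]mulrBl sinB sinD; field.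
Qed.

Let trig_class_sinM s h : trig_class h -> trig_class (fun x => h x * sin (s * x)).
Proof.
move=> th t; have [c1 s1] := th (s + t); have [c2 s2] := th (s - t).
split.
  apply: same_ext (sameZ 2^-1 _ (sameD _ _ s1 s2)) => x.
  by rewrite [(s + t) * _]mulrDl [(s - t) * _]mulrBl sinB sinD; field.
apply: same_ext (sameZ 2^-1 _ (sameB _ _ c2 c1)) => x.
by rewrite [(s + t) * _]mulrDl [(s - t) * _]mulrBl cosB cosD; field.
Qed.

Let same_horner_sin (p : {poly R}) s c : same (fun x => p.[sin (s * (x - c))]).
Proof.
suff : trig_class (fun x => p.[sin (s * (x - c))]).
  move=> /(_ 0) [+ _]; apply: same_ext => x.
  by rewrite mul0r cos0 mulr1.
elim/poly_ind: p => [|p a IH].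
  have := trig_classZ 0 _ trig_class1; congr (trig_class _).
  by apply/funext => x; rewrite horner0 mul0r.
have := trig_classD _ _ (trig_classD _ _ (trig_classZ (cos (s * c)) _ (trig_class_sinM s _ IH))
  (trig_classZ (- sin (s * c)) _ (trig_class_cosM s _ IH))) (trig_classZ a _ trig_class1).
congr (trig_class _); apply/funext => x.
rewrite hornerD hornerM hornerX hornerC; move: p.[_] => q.
by rewrite mulrBr sinB; ring.
Qed.

(* The iterates of (3 p - p ^ 3) / 2 tend to the sign on [-1, 1]. *)
Let sgpoly := fix sgpoly n : {poly R} :=
  if n is n'.+1 then (3 / 2)%:P * sgpoly n' - (2^-1)%:P * sgpoly n' ^+ 3
  else 'X.

Let sgpolyS n x : (sgpoly n.+1).[x] = 3 / 2 * (sgpoly n).[x] - 2^-1 * (sgpoly n).[x] ^+ 3.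
Proof. by rewrite /= !hornerE. Qed.

Let sgpolyN n x : (sgpoly n).[- x] = - (sgpoly n).[x].
Proof.
elim: n => [|n IH]; first by rewrite /= !hornerX.
by rewrite !sgpolyS IH; ring.
Qed.

Let sgpoly_bounds n (x : R) : 0 <= x <= 1 -> x <= (sgpoly n).[x] <= 1.
Proof.
move=> /andP[x0 x1]; elim: n => [|n /andP[]]; first by rewrite /= hornerX lexx.
rewrite sgpolyS; move: (sgpoly n).[x] => u u1 u2.
have ux : 0 <= u by lra.
have h1 : 0 <= u * (1 - u ^+ 2) by rewrite mulr_ge0//; nra.
have h2 : 0 <= (1 - u) ^+ 2 * (u + 2) by rewrite mulr_ge0 ?sqr_ge0//; lra.
by apply/andP; split; nra.
Qed.

Let norm_sgpoly_le1 n (x : R) : `|x| <= 1 -> `|(sgpoly n).[x]| <= 1.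
Proof.
move=> x1; have [x0|x0] := lerP 0 x.
  have /andP[h1 h2] : x <= (sgpoly n).[x] <= 1.
    by apply: sgpoly_bounds; rewrite x0/= -(ger0_norm x0).
  by rewrite ger0_norm// (le_trans x0).
have x0' : 0 <= - x by lra.
have /andP[h1 h2] : - x <= (sgpoly n).[- x] <= 1.
  by apply: sgpoly_bounds; rewrite x0'/= -(ltr0_norm x0).
by rewrite -normrN -sgpolyN ger0_norm// (le_trans x0').
Qed.

Let cvg_sgpoly_pos (x : R) : 0 < x <= 1 -> (fun n => (sgpoly n).[x]) @ \oo --> (1 : R).
Proof.
move=> /andP[x0 x1].
have h n : 1 - (sgpoly n).[x] <= (1 - x / 2) ^+ n.
  elim: n => [|n IH]; first by rewrite expr0 /= hornerX; lra.
  have /andP[+ +] : x <= (sgpoly n).[x] <= 1 by apply: sgpoly_bounds; rewrite ltW.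
  rewrite [_ ^+ n.+1]exprS sgpolyS; move: (sgpoly n).[x] IH => u IH u1 u2.
  (* The contraction factor (1 - u) (u + 2) / 2 equals 1 - u / 2 - u^2 / 2, at most 1 - x / 2
     because u >= x. *)
  have -> : 1 - (3 / 2 * u - 2^-1 * u ^+ 3) = ((1 - u) * (u + 2) / 2) * (1 - u) by field.
  apply: ler_pM => //; [nra|lra|nra].
have c : (fun n => (1 - x / 2) ^+ n) @ \oo --> (0 : R).
  by apply: cvg_expr; rewrite ger0_norm; lra.
apply: (@squeeze_cvgr _ _ _ _ (fun n => 1 - (1 - x / 2) ^+ n) (fun=> 1)).
- near=> n; have := h n.
  have /andP[_ +] : x <= (sgpoly n).[x] <= 1 by apply: sgpoly_bounds; rewrite ltW.
  by move=> -> /=; rewrite andbT; lra.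
- by rewrite -[X in _ --> X]subr0; apply: cvgB => //; exact: cvg_cst.
- exact: cvg_cst.
Unshelve. all: by end_near. Qed.

Let cvg_sgpoly (x : R) : `|x| <= 1 -> (fun n => (sgpoly n).[x]) @ \oo --> Num.sg x.
Proof.
move=> x1; have [x0|x0|x0] := ltrgtP x 0.
- rewrite ltr0_sg//.
  have -> : (fun n => (sgpoly n).[x]) = (fun n => - (sgpoly n).[- x]).
    by apply/funext => n; rewrite sgpolyN opprK.
  apply: cvgN; apply: cvg_sgpoly_pos; rewrite oppr_gt0 x0/=.
  by rewrite -(ltr0_norm x0).
- by rewrite gtr0_sg//; apply: cvg_sgpoly_pos; rewrite x0/= -(gtr0_norm x0).
- rewrite x0 sgr0; have -> : (fun n => (sgpoly n).[0]) = (fun=> (0 : R)).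
    apply/funext => n; have := sgpolyN n 0; rewrite oppr0.
    by lra.
  exact: cvg_cst.
Qed.

Let same_sg_sin s c : same (fun x => Num.sg (sin (s * (x - c)))).
Proof.
apply: (same_lim _ _ _ (fun n => same_horner_sin (sgpoly n) s c) (same_cst 1)).
- by move=> n x; apply: norm_sgpoly_le1; rewrite ler_norml sin_geN1 sin_le1.
- by move=> x; apply: cvg_sgpoly; rewrite ler_norml sin_geN1 sin_le1.
Qed.

(** sin (y / N) has the sign of y as soon as N pi > |y|, so the sequence is eventually constant at
    each point. *)
Let same_sg c : same (fun x => Num.sg (x - c)).
Proof.
apply: (same_lim _ _ _ (fun n => same_sg_sin n.+1%:R^-1 c) (same_cst 1)).
- by move=> n x; rewrite normr_sg; case: (_ != 0).
move=> x; apply: (@cvg_near_cst _ _ _ _ _ _ _); near=> n.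
have n0 : 0 < n.+1%:R^-1 :> R by rewrite invr_gt0.
have small : `|x - c| < n.+1%:R * pi.
  apply: (@lt_le_trans _ _ (n.+1%:R * 1)).
    rewrite mulr1; apply: (@le_lt_trans _ _ n%:R); last by rewrite ltr_nat.
    by near: n; exact: nbhs_infty_ger.
  by rewrite ler_wpM2l//; have := pi_ge2 R; lra.
have [h|h|h] := ltrgtP (x - c) 0.
- rewrite (ltr0_sg h); apply: ltr0_sg; rewrite -oppr_gt0 -sinN -mulrN.
  apply: sin_gt0_pi; rewrite mulr_gt0 ?oppr_gt0//=.
  by rewrite ltr_pdivrMl// -(ltr0_norm h).
- rewrite (gtr0_sg h); apply: gtr0_sg.
  apply: sin_gt0_pi; rewrite mulr_gt0//=.
  by rewrite ltr_pdivrMl// -(gtr0_norm h).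
- by rewrite h mulr0 sin0.
Unshelve. all: by end_near. Qed.

Lemma mgf_same_measure (A : set R) : measurable A -> k1 A = k2 A.
Proof.
have same1 c : same (\1_`]c, +oo[%classic).
  (* The shift by 1 / (n + 1) matters at x = c: since sg 0 = 0, the limit there would be 1/2 without
     it. *)
  have si n : same (fun x => 2^-1 * (1 + Num.sg (x - (c + n.+1%:R^-1)))).
    by apply: sameZ; apply: sameD; [exact: same_cst|exact: same_sg].
  apply: (same_lim _ _ _ si (same_cst 1)).
    move=> n x; rewrite ger0_norm; by case: sgrP => *; lra.
  move=> x; rewrite indicE; apply: cvg_near_cst; near=> n.
  have n0 : 0 < n.+1%:R^-1 :> R by rewrite invr_gt0.
  have [h|h] := ltrP c x.
    rewrite mem_set /= ?in_itv/= ?h// gtr0_sg; first by field.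
    rewrite opprD addrA subr_gt0.
    rewrite invf_plt ?posrE ?subr_gt0//.
    apply: (@le_lt_trans _ _ n%:R); last by rewrite ltr_nat.
    by near: n; exact: nbhs_infty_ger.
  rewrite memNset /= ?in_itv/= ?andbT; last by apply/negP; rewrite -leNgt.
  by move: n.+1%:R^-1 n0 => e e0; rewrite ltr0_sg; lra.
have ray c : k1 `]c, +oo[%classic = k2 `]c, +oo[%classic.
  have [_ _] := same1 c.
  by rewrite !integral_indic// !setIT.
have fin (k : {measure set R -> \bar R}) : k.-integrable setT (EFin \o (fun=> 1%R)) ->
    forall A : set R, measurable A -> (k A < +oo)%E.
  move=> /integrableP[_ +] B mB.
  under eq_integral do rewrite /= normr1.
  by rewrite integral_cst// mul1e; apply: le_lt_trans; rewrite le_measure ?inE.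
apply: (@measure_unique _ _ _ (@RGenOInfty.G R) (fun n => `](- n%:R), +oo[%classic)).
- exact: RGenOInfty.measurableE.
- move=> B C [b ->] [c ->]; exists (Num.max b c).
  by apply/seteqP; split => x /=; rewrite !in_itv/= !andbT gt_max; [move=> [-> ->]|move/andP].
- by move=> i; exists (- i%:R).
- apply/seteqP; split => // x _; exists (Num.bound `|x|) => //=.
  rewrite in_itv/= andbT ltrNl; apply: le_lt_trans (archi_boundP (normr_ge0 x)).
  by rewrite -normrN ler_norm.
- by move=> B [c ->]; exact: ray.
- by move=> n; apply: fin; [have [] := same_cst 1|].
Unshelve. all: by end_near. Qed.

End SameIntegral.

(** * Weighted measures and joint Laplace transforms *)

Section Density.
Context {d : measure_display} {T : measurableType d} {R : realType}.
Variable mu : {measure set T -> \bar R}.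
Variable w : T -> R.

(** Measurability and positivity of w are arguments so that the measure structure can be attached to
    the term [density mw w0]. *)
Definition density of measurable_fun setT w & (forall x, 0 <= w x) :=
  fun A : set T => (\int[mu]_(x in A) (w x)%:E)%E.

Hypotheses (mw : measurable_fun setT w) (w0 : forall x, 0 <= w x).

Let density0 : density mw w0 set0 = 0%E.
Proof. by rewrite /density integral_set0. Qed.

Let density_ge0 A : (0 <= density mw w0 A)%E.
Proof. by apply: integral_ge0 => x _; rewrite lee_fin. Qed.

Let density_sigma_additive : semi_sigma_additive (density mw w0).
Proof.
move=> F mF tF mUF; rewrite /density ge0_integral_bigcup//.
- by apply: is_cvg_ereal_nneg_natsum_cond => n _ _; exact: density_ge0.
- by apply/measurable_EFinP; exact: measurable_funTS.
- by move=> x _; rewrite lee_fin.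
Qed.

HB.instance Definition _ := isMeasure.Build _ _ _ (density mw w0)
  density0 density_ge0 density_sigma_additive.

Let mwE : measurable_fun setT (EFin \o w).
Proof. exact/measurable_EFinP. Qed.

Import HBNNSimple.

Lemma ge0_integral_density (f : T -> \bar R) : measurable_fun setT f ->
  (forall x, 0 <= f x)%E ->
  (\int[density mw w0]_x f x = \int[mu]_x (f x * (w x)%:E))%E.
Proof.
move=> mf f0; pose h := nnsfun_approx measurableT mf.
have hf x : (EFin \o h ^~ x) @ \oo --> f x.
  by apply: cvg_nnsfun_approx => // y _; exact: f0.
transitivity (limn (fun n => \int[density mw w0]_x (h n x)%:E)%E).
  rewrite -monotone_convergence//.
  - by apply: eq_integral => x _; apply/esym/cvg_lim => //; exact: hf.
  - by move=> n; exact/measurable_EFinP/measurable_funP.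
  - by move=> n x _; rewrite lee_fin.
  - by move=> x _ m n mn; rewrite lee_fin; exact/lefP/nd_nnsfun_approx.
transitivity (limn (fun n => \int[mu]_x ((h n x)%:E * (w x)%:E))%E); last first.
  rewrite -monotone_convergence//.
  - apply: eq_integral => x _; apply/cvg_lim => //.
    by apply: cvgeZr => //; exact: hf.
  - move=> n; apply: emeasurable_funM => //.
    exact/measurable_EFinP/measurable_funP.
  - by move=> n x _; rewrite mule_ge0// lee_fin.
  - move=> x _ m n mn; rewrite lee_wpmul2r ?lee_fin//.
    exact/lefP/nd_nnsfun_approx.
congr (limn _); apply/funext => n.
have mh r : measurable (h n @^-1` [set r]) by [].
transitivity (\sum_(r \in range (h n)) r%:E * density mw w0 (h n @^-1` [set r]))%E.
  by rewrite integral_nnsfun// patch_setT sintegralE.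
transitivity (\int[mu]_x (\sum_(r \in range (h n))
    (r%:E * ((\1_(h n @^-1` [set r]) x)%:E * (w x)%:E))))%E; last first.
  apply: eq_integral => x _; rewrite [in RHS](fimfunE (h n) x) -fsumEFin//.
  rewrite ge0_mule_fsuml; last by move=> r; exact: nnfun_muleindic_ge0.
  by apply: eq_fsbigr => r _; rewrite EFinM muleA.
rewrite ge0_integral_fsum//; last 2 first.
  - move=> r; apply: emeasurable_funM => //; apply: emeasurable_funM => //.
    by apply/measurable_EFinP; exact: measurable_indic.
  - by move=> r x _; rewrite muleA mule_ge0 ?lee_fin ?w0//; exact: nnfun_muleindic_ge0.
apply: eq_fsbigr => r rh.
have r0 : 0 <= r by move: rh; rewrite inE => -[x _ <-].
rewrite ge0_integralZl//.
- congr (_ * _)%E; rewrite /density integral_mkcond; apply: eq_integral => x _.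
  rewrite patchE indicE; case: ifPn => _; rewrite ?mul1e ?mul0e//.
- apply: emeasurable_funM => //.
  by apply/measurable_EFinP; exact: measurable_indic.
- by move=> x _; rewrite mule_ge0 ?lee_fin.
Qed.
End Density.

Section SameMgf.
Context {d d' : measure_display} {T : measurableType d} {T' : measurableType d'}
  {R : realType}.
Variables (P : {measure set T -> \bar R}) (P' : {measure set T' -> \bar R}).
Local Open Scope ereal_scope.

(** The images under X and X' of the measures with densities w and w' have the same finite Laplace
    transform. The weights are what allows an induction on the number of variables. *)
Lemma same_mgf_integral (X : T -> R) (X' : T' -> R) (w : T -> R) (w' : T' -> R) :
    measurable_fun setT X -> measurable_fun setT X' ->
    measurable_fun setT w -> measurable_fun setT w' ->
    (forall x, 0 <= w x)%R -> (forall x, 0 <= w' x)%R ->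
    (forall t : R, \int[P]_x (w x * expR (t * X x))%:E =
       \int[P']_x (w' x * expR (t * X' x))%:E /\
       \int[P]_x (w x * expR (t * X x))%:E < +oo) ->
  forall g : R -> R, measurable_fun setT g -> (forall x, 0 <= g x)%R ->
  \int[P]_x (w x * g (X x))%:E = \int[P']_x (w' x * g (X' x))%:E.
Proof.
move=> mX mX' mw mw' w0 w'0 H g mg g0.
pose pX : {mfun T >-> R} := HB.pack X (isMeasurableFun.Build _ _ _ _ _ mX).
pose pX' : {mfun T' >-> R} := HB.pack X' (isMeasurableFun.Build _ _ _ _ _ mX').
pose k1 := pushforward (density P w mw w0) pX.
pose k2 := pushforward (density P' w' mw' w'0) pX'.
have E1 (h : R -> R) : measurable_fun setT h -> (forall x, 0 <= h x)%R ->
    \int[k1]_x (h x)%:E = \int[P]_x (w x * h (X x))%:E.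
  move=> mh h0; rewrite ge0_integral_pushforward//.
  - rewrite preimage_setT ge0_integral_density//.
    + by apply: eq_integral => x _; rewrite /= -EFinM mulrC.
    + by apply/measurable_EFinP; exact: measurableT_comp.
    + by move=> x; rewrite lee_fin.
  - exact/measurable_EFinP.
  - by move=> x _; rewrite lee_fin.
have E2 (h : R -> R) : measurable_fun setT h -> (forall x, 0 <= h x)%R ->
    \int[k2]_x (h x)%:E = \int[P']_x (w' x * h (X' x))%:E.
  move=> mh h0; rewrite ge0_integral_pushforward//.
  - rewrite preimage_setT ge0_integral_density//.
    + by apply: eq_integral => x _; rewrite /= -EFinM mulrC.
    + by apply/measurable_EFinP; exact: measurableT_comp.
    + by move=> x; rewrite lee_fin.
  - exact/measurable_EFinP.
  - by move=> x _; rewrite lee_fin.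
rewrite -E1// -E2//; apply: eq_measure_integral => A mA _.
have mexp (t : R) : measurable_fun setT (fun x : R => expR (t * x)).
  by apply: measurableT_comp => //; exact: measurable_funM.
apply: mgf_same_measure => // t.
by rewrite E1// E2//; exact: H.
Qed.

(** Uniqueness in several variables is reduced to one variable: the exponentials are traded for the
    functions g i one coordinate at a time. *)
Lemma same_mgf_prod (I : finType) (X : I -> T -> R) (X' : I -> T' -> R) :
    (forall i, measurable_fun setT (X i)) -> (forall i, measurable_fun setT (X' i)) ->
    (forall u : I -> R,
       \int[P]_x (expR (\sum_i u i * X i x))%:E =
       \int[P']_x (expR (\sum_i u i * X' i x))%:E /\
       \int[P]_x (expR (\sum_i u i * X i x))%:E < +oo) ->
  forall g : I -> R -> R, (forall i, measurable_fun setT (g i)) ->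
  (forall i x, 0 <= g i x <= 1)%R ->
  \int[P]_x (\prod_i g i (X i x))%:E = \int[P']_x (\prod_i g i (X' i x))%:E.
Proof.
move=> mX mX' H g mg g01.
have mlin (u : I -> R) : measurable_fun setT (fun x => expR (\sum_i u i * X i x)).
  apply: measurableT_comp => //; apply: measurable_sum => i.
  exact: measurable_funM.
have mlin' (u : I -> R) : measurable_fun setT (fun x => expR (\sum_i u i * X' i x)).
  apply: measurableT_comp => //; apply: measurable_sum => i.
  exact: measurable_funM.
pose W (s : seq I) x : R := (\prod_(i <- s) g i (X i x))%R.
pose W' (s : seq I) x : R := (\prod_(i <- s) g i (X' i x))%R.
have mW s : measurable_fun setT (W s).
  by apply: measurable_prod => i _; exact: measurableT_comp.
have mW' s : measurable_fun setT (W' s).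
  by apply: measurable_prod => i _; exact: measurableT_comp.
have W0 s x : (0 <= W s x)%R.
  by apply: prodr_ge0 => i _; have /andP[] := g01 i (X i x).
have W'0 s x : (0 <= W' s x)%R.
  by apply: prodr_ge0 => i _; have /andP[] := g01 i (X' i x).
have W1 s x : (W s x <= 1)%R.
  by apply: prodr_ile1 => i _; exact: g01.
(* All coordinates keep their exponential, even those already in s, so that the Laplace variable of
   the next X i can be shifted freely inside the weight. *)
suff key s (u : I -> R) :
    \int[P]_x (W s x * expR (\sum_i u i * X i x))%:E =
    \int[P']_x (W' s x * expR (\sum_i u i * X' i x))%:E.
  have := key (index_enum I) (fun=> 0%R).
  rewrite (eq_integral (fun x => (\prod_i g i (X i x))%:E)); last first.
    by move=> x _; rewrite big1 ?expR0 ?mulr1// => i _; rewrite mul0r.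
  move=> ->; apply: eq_integral => x _.
  by rewrite big1 ?expR0 ?mulr1// => i _; rewrite mul0r.
elim: s u => [|i s IH] u.
  rewrite /W /W'; under eq_integral do rewrite big_nil mul1r.
  rewrite (H u).1; apply: eq_integral => x _; by rewrite big_nil mul1r.
have := @same_mgf_integral (X i) (X' i)
  (fun x => W s x * expR (\sum_i u i * X i x))%R
  (fun x => W' s x * expR (\sum_i u i * X' i x))%R (mX i) (mX' i).
move=> /(_ (measurable_funM (mW s) (mlin u)) (measurable_funM (mW' s) (mlin' u))).
move=> /(_ (fun x => mulr_ge0 (W0 s x) (expR_ge0 _))).
move=> /(_ (fun x => mulr_ge0 (W'0 s x) (expR_ge0 _))).
have shift t (Y : I -> R) : (\sum_j u j * Y j + t * Y i =
    \sum_j (u j + (if j == i then t else 0)) * Y j)%R.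
  under [RHS]eq_bigr do rewrite mulrDl; rewrite big_split/=; congr (_ + _)%R.
  by rewrite (bigD1 i)//= eqxx big1 ?addr0// => j /negbTE ->; rewrite mul0r.
have eqW t x : (W s x * expR (\sum_i u i * X i x) * expR (t * X i x) =
    W s x * expR (\sum_j (u j + (if j == i then t else 0)) * X j x))%R.
  by rewrite -mulrA -expRD shift.
have eqW' t x : (W' s x * expR (\sum_i u i * X' i x) * expR (t * X' i x) =
    W' s x * expR (\sum_j (u j + (if j == i then t else 0)) * X' j x))%R.
  by rewrite -mulrA -expRD shift.
have fin t : \int[P]_x (W s x * expR (\sum_i u i * X i x) * expR (t * X i x))%:E =
       \int[P']_x (W' s x * expR (\sum_i u i * X' i x) * expR (t * X' i x))%:E /\
       \int[P]_x (W s x * expR (\sum_i u i * X i x) * expR (t * X i x))%:E < +oo.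
  under eq_integral do rewrite eqW.
  under [X in _ = X]eq_integral do rewrite eqW'.
  split; first exact: IH.
  apply: le_lt_trans (H (fun j => u j + (if j == i then t else 0))%R).2.
  apply: ge0_le_integral => //.
  - by move=> x _; rewrite lee_fin mulr_ge0 ?expR_ge0.
  - by apply/measurable_EFinP; exact: measurable_funM.
  - exact/measurable_EFinP.
  - by move=> x _; rewrite lee_fin ler_piMl ?expR_ge0.
move=> /(_ fin (g i) (mg i) (fun x => (andP (g01 i x)).1)) Hg.
transitivity (\int[P]_x (W s x * expR (\sum_i0 u i0 * X i0 x) * g i (X i x))%:E).
  by apply: eq_integral => x _; rewrite /W big_cons; congr (_%:E); ring.
rewrite Hg; apply: eq_integral => x _; rewrite /W' big_cons; congr (_%:E); ring.
Qed.

End SameMgf.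

(** * Gaussian fields *)

Lemma measurable_expM {R : realType} (t : R) : measurable_fun setT (fun x : R => expR (t * x)).
Proof. by apply: measurableT_comp => //; exact: measurable_funM. Qed.

Section NormalMgf.
Context {R : realType}.
Local Open Scope ereal_scope.

Lemma normal_prob_mgf (m s t : R) : s != 0%R ->
  \int[normal_prob m s]_x (expR (t * x))%:E =
  (expR (m * t + s ^+ 2 * t ^+ 2 / 2))%:E.
Proof.
move=> s0.
have pdf0 x : (0 <= normal_pdf m s x)%R by exact: normal_pdf_ge0.
pose mpdf := measurable_normal_pdf m s.
have mexp : measurable_fun setT (fun x : measurableTypeR R => (expR (t * x))%:E).
  apply/measurable_EFinP.
  exact: (measurable_expM t).
transitivity (\int[density lebesgue_measure (normal_pdf m s) mpdf pdf0]_x (expR (t * x))%:E).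
  by apply: eq_measure_integral.
rewrite ge0_integral_density//.
transitivity (\int[lebesgue_measure]_x
    ((expR (m * t + s ^+ 2 * t ^+ 2 / 2))%:E * (normal_pdf (m + s ^+ 2 * t) s x)%:E)).
  apply: eq_integral => x _; rewrite -!EFinM; congr (_%:E).
  rewrite /normal_pdf (negbTE s0) /normal_fun ![(_ * (normal_peak s * _))%R]mulrCA.
  congr (_ * _)%R; rewrite -!expRD; congr expR; rewrite -(mulr_natl (s ^+ 2)).
  by field.
rewrite ge0_integralZl//.
- by rewrite integral_normal_pdf mule1.
- by apply/measurable_EFinP; exact: measurable_normal_pdf.
- by move=> x _; rewrite lee_fin normal_pdf_ge0.
Qed.

(** On [a, a + s] the density is at least its value at a + s, and (b + 1)^2 / 2 <= b^2 + 1 for b = a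
    / s. *)
Lemma normal_prob_itv_ge (s a : R) : (0 < s)%R -> (0 <= a)%R ->
  ((Num.sqrt (2 * pi))^-1 * expR (- 1) * expR (- (a ^+ 2 / s ^+ 2)))%:E <=
  normal_prob 0 s `[a, +oo[%classic.
Proof.
move=> s0 a0.
have le1 : normal_prob 0 s `[a, (a + s)%R]%classic <= normal_prob 0 s `[a, +oo[%classic.
  apply: le_measure; rewrite ?inE//; try exact: measurable_itv.
  by move=> x /=; rewrite !in_itv/= => /andP[-> _].
apply: le_trans le1; have sN0 : s != 0%R by rewrite gt_eqF.
rewrite /normal_prob.
pose c := ((s * Num.sqrt (2 * pi))^-1 * expR (- ((a + s) ^+ 2 / (s ^+ 2 *+ 2))))%R.
apply: (@le_trans _ _ (\int[lebesgue_measure]_(x in `[a, (a + s)%R]%classic) c%:E)).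
  rewrite integral_cst//= lebesgue_measure_itv/= lte_fin ltrDl s0 -EFinB -EFinM lee_fin.
  rewrite addrAC subrr add0r /c.
  have pi2 : Num.sqrt (2 * pi) != 0%R :> R.
    by rewrite gt_eqF// sqrtr_gt0 mulr_gt0// pi_gt0.
  have [e eE] : exists e, expR (- ((a + s) ^+ 2 / (s ^+ 2 *+ 2))) = e by eexists.
  rewrite eE.
  have -> : ((s * Num.sqrt (2 * pi))^-1 * e * s = (Num.sqrt (2 * pi))^-1 * e)%R.
    by field; rewrite pi2 sN0.
  rewrite -mulrA ler_wpM2l ?invr_ge0 ?sqrtr_ge0// -eE -expRD ler_expR.
  have -> : ((a + s) ^+ 2 / (s ^+ 2 *+ 2) = (a / s + 1) ^+ 2 / 2)%R.
    by rewrite -(mulr_natl (s ^+ 2)); field.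
  rewrite -exprVn -exprMn.
  have := sqr_ge0 (a / s - 1); move: (a / s)%R => b; nra.
apply: ge0_le_integral => //=.
- by move=> x _; rewrite lee_fin /c mulr_ge0 ?expR_ge0// invr_ge0 mulr_ge0 ?sqrtr_ge0 ?(ltW s0).
- by apply/measurable_EFinP; apply: measurable_funTS; exact: measurable_normal_pdf.
- move=> x; rewrite in_itv/= => /andP[ax xa]; rewrite lee_fin.
  rewrite /normal_pdf (negbTE sN0) /normal_fun /normal_peak /c.
  have -> : Num.sqrt (s ^+ 2 * pi *+ 2) = (s * Num.sqrt (2 * pi))%R.
    rewrite -mulrnAr -mulr_natl sqrtrM ?sqr_ge0// sqrtr_sqr gtr0_norm//.
  rewrite ler_wpM2l ?invr_ge0 ?mulr_ge0 ?sqrtr_ge0 ?(ltW s0)// ler_expR subr0.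
  rewrite mulNr lerN2 ler_wpM2r// ?invr_ge0 ?mulrn_wge0 ?sqr_ge0//.
  by rewrite lerXn2r ?nnegrE//; lra.
Qed.
End NormalMgf.

Section GaussianMgf.
Context {disp : measure_display} {Omega : measurableType disp} {R : realType}.
Variable P : probability Omega R.
Implicit Types X : Omega -> R.
Local Open Scope ereal_scope.

(** The value v = 0 describes a variable vanishing almost surely, so degenerate linear combinations
    need no separate treatment. *)
Definition gaussian_mgf X (v : R) := measurable_fun setT X /\
  forall t : R, \int[P]_w (expR (t * X w))%:E = (expR (v * t ^+ 2 / 2))%:E.

Lemma integral_law X (h : R -> R) : measurable_fun setT X ->
  measurable_fun setT h -> (forall x, 0 <= h x)%R ->
  \int[P]_w (h (X w))%:E =
  \int[pushforward P (X : Omega -> measurableTypeR R)]_x (h x)%:E.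
Proof.
move=> mX mh h0; rewrite ge0_integral_pushforward//.
- exact/measurable_EFinP.
- by move=> x _; rewrite lee_fin.
Qed.

Lemma norm_le_expR (x : R) : (`|x| <= expR x + expR (- x))%R.
Proof.
have := expR_ge1Dx x; have := expR_ge1Dx (- x).
have := expR_gt0 x; have := expR_gt0 (- x).
have [x0|x0] := lerP 0 x; [rewrite ger0_norm//|rewrite ltr0_norm//]; lra.
Qed.

Lemma mgf_integrable X (c : R -> R) (a b : R) : measurable_fun setT X ->
  (forall t : R, \int[P]_w (expR (t * X w))%:E = (c t)%:E) ->
  P.-integrable setT (fun w => (expR (a * X w) + expR (b * X w))%:E).
Proof.
move=> mX H.
have i1 t : P.-integrable setT (fun w => (expR (t * X w))%:E).
  apply/integrableP; split.
    apply/measurable_EFinP.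
    by apply: (measurableT_comp (f := fun x => expR (t * x))) => //; exact: measurable_expM.
  by under eq_integral do rewrite /= ger0_norm ?expR_ge0//; rewrite H ltry.
by have := integrableD measurableT (i1 a) (i1 b); apply: eq_integrable.
Qed.

Lemma is_gaussian_centered X : measurable_fun setT X -> is_gaussian P X ->
  'E_P[X] = 0 -> exists2 v : R, (0 <= v)%R & gaussian_mgf X v.
Proof.
move=> mX [m [s law]] EX0.
have mgf t : \int[P]_w (expR (t * X w))%:E = (expR (m * t + s ^+ 2 * t ^+ 2 / 2))%:E.
  rewrite (integral_law X (fun x => expR (t * x)) mX (measurable_expM t))//.
  pose pX : {mfun Omega >-> measurableTypeR R} :=
    HB.pack (X : Omega -> measurableTypeR R) (isMeasurableFun.Build _ _ _ (measurableTypeR R) _ mX).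
  have [s0|s0] := eqVneq s 0%R.
    transitivity (\int[dirac (m : measurableTypeR R)]_x (expR (t * x))%:E).
      apply: (@eq_measure_integral _ _ _ setT (dirac (m : measurableTypeR R)) (pushforward P pX)) => A mA _.
      by have := law A mA; rewrite s0 eqxx.
    rewrite integral_dirac//; last by apply/measurable_EFinP; exact: measurable_expM.
    by rewrite diracT mul1e s0 expr0n/= !mul0r addr0 mulrC.
  rewrite -normal_prob_mgf//.
  apply: (@eq_measure_integral _ _ _ setT (normal_prob m s) (pushforward P pX)) => A mA _.
  by have := law A mA; rewrite (negbTE s0).
exists (s ^+ 2)%R; first exact: sqr_ge0.
suff m0 : m = 0%R by split => // t; rewrite mgf m0 mul0r add0r.
have iX : P.-integrable setT (EFin \o X).
  apply: le_integrable (mgf_integrable X _ 1 (- 1) mX mgf) => //.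
    exact/measurable_EFinP.
  move=> w _ /=; rewrite lee_fin mul1r mulN1r.
  by apply: (le_trans (norm_le_expR _)); rewrite ler_norm.
(* Since exp z >= 1 + z and E X = 0, the Laplace transform is at least 1; its exponent is thus
   nonnegative for every t, which forces m = 0. *)
have h t : (0 <= m * t + s ^+ 2 * t ^+ 2 / 2)%R.
  rewrite -ler_expR expR0 -lee_fin -mgf.
  apply: (@le_trans _ _ (\int[P]_w (1 + t * X w)%:E)).
    under eq_integral do rewrite EFinD EFinM.
    rewrite integralD//=; last 2 first.
      exact: finite_measure_integrable_cst.
      by have := integrableZl measurableT t iX; apply: eq_integrable.
    rewrite integralZl//; move: EX0; rewrite unlock => ->.
    by rewrite mule0 adde0 integral_cst//= mul1e probability_setT.
  apply: le_integral => //.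
  - have i1 : P.-integrable setT (EFin \o (fun=> 1%R)) by exact: finite_measure_integrable_cst.
    by have := integrableD measurableT i1 (integrableZl measurableT t iX); apply: eq_integrable.
  - have := mgf_integrable X _ t t mX mgf => /(integrableZl measurableT 2^-1).
    by apply: eq_integrable => // w _; rewrite -EFinM; congr (_%:E); field.
  - by move=> w _; rewrite lee_fin expR_ge1Dx.
(* Adding 1 to the minimiser's denominator s^2 covers the case s = 0. *)
have := h (- m / (s ^+ 2 + 1))%R.
have q0 : (0 < s ^+ 2 + 1)%R by have := sqr_ge0 s; lra.
have -> : (m * (- m / (s ^+ 2 + 1)) + s ^+ 2 * (- m / (s ^+ 2 + 1)) ^+ 2 / 2 =
   - (m ^+ 2 * (s ^+ 2 + 2) / (2 * (s ^+ 2 + 1) ^+ 2)))%R.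
  by field; rewrite gt_eqF.
rewrite oppr_ge0 => /(fun H => le_trans H (lexx _)).
rewrite pmulr_lle0 ?invr_gt0 ?mulr_gt0 ?exprn_gt0//.
rewrite pmulr_lle0; last by have := sqr_ge0 s; lra.
move=> m2; apply/eqP; rewrite -sqrf_eq0 eq_le m2 sqr_ge0//.
Qed.
End GaussianMgf.

Section GaussianMoments.
Context {disp : measure_display} {Omega : measurableType disp} {R : realType}.
Variable P : probability Omega R.
Variables (X : Omega -> R) (v : R).
Hypothesis gX : gaussian_mgf P X v.
Local Open Scope ereal_scope.

Let mX : measurable_fun setT X := gX.1.

Let measurable_expRX (t : R) : measurable_fun setT (fun w => expR (t * X w)).
Proof.
by apply: (measurableT_comp (f := fun x => expR (t * x))) => //; exact: measurable_expM.
Qed.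

Let integrable_expRX (t : R) : P.-integrable setT (EFin \o (fun w => expR (t * X w))).
Proof.
apply/integrableP; split; first exact/measurable_EFinP.
by under eq_integral do rewrite /= ger0_norm ?expR_ge0//; rewrite gX.2 ltry.
Qed.

(** X^2 is the dominated limit of (N (exp (X / N) - 1))^2, whose expectation is explicit in the
    Laplace transform. With M = N^2 it tends to 2 v - 2 (v / 2) = v. *)
Lemma gaussian_mgf_moment2 :
  P.-integrable setT (fun w => (X w ^+ 2)%:E) /\ \int[P]_w (X w ^+ 2)%:E = v%:E.
Proof.
pose u n w : R := (n.+1%:R * (expR (n.+1%:R^-1 * X w) - 1))%R.
pose f_ n w := (u n w ^+ 2)%:E.
pose M n : R := (n.+1%:R ^+ 2)%R.
have M1 n : (1 <= M n)%R by rewrite /M exprn_ege1// ler1n.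
have If n : \int[P]_w f_ n w =
    (M n * (expR ((M n)^-1 * (2 * v)) - 1) - 2 * (M n * (expR ((M n)^-1 * (v / 2)) - 1)))%:E.
  have n0 : n.+1%:R != 0%R :> R by [].
  under eq_integral => w _.
    rewrite /f_ /u.
    rewrite (_ : (n.+1%:R * (expR (n.+1%:R^-1 * X w) - 1)) ^+ 2 =
       M n * (expR (2 * n.+1%:R^-1 * X w)) + (M n + (- (2 * M n)) * expR (n.+1%:R^-1 * X w)))%R; last first.
      have -> : (2 / n.+1%:R * X w = n.+1%:R^-1 * X w + n.+1%:R^-1 * X w)%R by ring.
      by rewrite expRD /M; ring.
    rewrite !EFinD (EFinM (- _)%R) (EFinM (M n)).
    over.
  have i0 : P.-integrable setT (EFin \o (fun=> M n)) by exact: finite_measure_integrable_cst.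
  have i1 := integrableZl measurableT (M n) (integrable_expRX (2 * n.+1%:R^-1)).
  have i2 := integrableZl measurableT (- (2 * M n))%R (integrable_expRX n.+1%:R^-1).
  rewrite integralD//=; last by have := integrableD measurableT i0 i2; apply: eq_integrable.
  have Z c t : \int[P]_w (c%:E * (expR (t * X w))%:E) = (c * expR (v * t ^+ 2 / 2))%:E.
    have := integralZl measurableT (integrable_expRX t) c; rewrite /= gX.2.
    by move=> ->.
  rewrite integralD//= !Z integral_cst//= probability_setT mule1.
  rewrite -!EFinD; congr (_%:E).
  have -> : (v * (2 / n.+1%:R) ^+ 2 / 2 = (M n)^-1 * (2 * v))%R by rewrite /M; field.
  have -> : (v * n.+1%:R^-1 ^+ 2 / 2 = (M n)^-1 * (v / 2))%R by rewrite /M; field.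
  by ring.
have ig : P.-integrable setT (fun w => (expR (4 * X w) + expR (- 4 * X w))%:E).
  exact: mgf_integrable gX.1 gX.2.
have [] := @dominated_convergence _ _ _ P setT measurableT f_
  (fun w => (X w ^+ 2)%:E) _ _ _ _ ig _.
- move=> n; apply/measurable_EFinP; apply: measurable_funX.
  by apply: measurable_funM => //; apply: measurable_funB.
- by apply/measurable_EFinP; apply: measurable_funX.
- apply: aeW => w _; apply: cvg_EFin; first exact: nearW.
  suff c : (u ^~ w) @ \oo --> X w by rewrite expr2; apply: cvgM.
  apply/cvgrPdistC_le => /= _/posnumP[e]; near=> n.
  have N1 : (1 <= n.+1%:R :> R)%R by rewrite ler1n.
  apply: (le_trans (dist_mul_expR_sub1 _ (X w) N1)).
  rewrite ler_pdivrMl// -ler_pdivrMr//.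
  apply: (@le_trans _ _ n%:R); last by rewrite ler_nat.
  by near: n; exact: nbhs_infty_ger.
- apply: aeW => w n _; rewrite lee_fin ger0_norm ?sqr_ge0//.
  have N1 : (1 <= n.+1%:R :> R)%R by rewrite ler1n.
  have := norm_mul_expR_sub1 _ (X w) N1; rewrite -/(u n w) => h.
  rewrite -[(u n w ^+ 2)%R]ger0_norm ?sqr_ge0// normrX.
  apply: (@le_trans _ _ ((expR `|X w| * expR `|X w|) ^+ 2)%R).
    rewrite lerXn2r ?nnegrE ?mulr_ge0 ?expR_ge0//.
    apply: (le_trans h); rewrite ler_wpM2r ?expR_ge0//.
    by have := expR_ge1Dx `|X w|; lra.
  rewrite -expRD -expRM_natl.
  have -> : (2%:R * (`|X w| + `|X w|) = `|4 * X w|)%R.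
    by rewrite normrM ger0_norm//; ring.
  exact: expR_norm_le.
move=> iX2 _ c2; split => //.
suff c3 : (fun n => \int[P]_w f_ n w) @ \oo --> v%:E by apply: (cvg_unique _ c2 c3).
rewrite (_ : (fun n => _) = (fun n => (M n * (expR ((M n)^-1 * (2 * v)) - 1) -
    2 * (M n * (expR ((M n)^-1 * (v / 2)) - 1)))%:E)); last by apply/funext => n; rewrite If.
apply: cvg_EFin; first exact: nearW.
have cM y : (fun n => M n * (expR ((M n)^-1 * y) - 1))%R @ \oo --> y.
  apply/cvgrPdistC_le => /= _/posnumP[e]; near=> n.
  apply: (le_trans (dist_mul_expR_sub1 _ y (M1 n))).
  have M0 : (0 < M n)%R by apply: lt_le_trans (M1 n).
  rewrite ler_pdivrMl// -ler_pdivrMr//.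
  apply: (@le_trans _ _ n%:R).
    by near: n; exact: nbhs_infty_ger.
  by rewrite /M -natrX ler_nat (leq_trans (leqnSn n))// expnS expn1 leq_pmulr.
rewrite [X in _ --> X](_ : v = (2 * v - 2 * (v / 2))%R); last by field.
apply: cvgB; first exact: cM.
by apply: cvgM; [exact: cvg_cst|exact: cM].
Unshelve. all: by end_near. Qed.

(** Chernoff's bound at t = a / V. An upper bound V > 0 on the variance suffices, so X may be
    degenerate. *)
Lemma gaussian_mgf_tail (V a : R) : (v <= V)%R -> (0 < V)%R -> (0 <= a)%R ->
  P [set w | (a <= X w)%R] <= (expR (- (a ^+ 2 / (2 * V))))%:E.
Proof.
move=> vV V0 a0; pose t := (a / V)%R.
have t0 : (0 <= t)%R by rewrite divr_ge0// ltW.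
have mA : measurable [set w | (a <= X w)%R].
  have := mX measurableT `[a, +oo[%classic (measurable_itv _).
  rewrite setTI; congr measurable.
  by apply/seteqP; split => w /=; rewrite in_itv/= andbT.
apply: (@le_trans _ _ (\int[P]_w ((expR (- (t * a)))%:E * (expR (t * X w))%:E))).
  rewrite -(setIT [set w | _]) -integral_indic//.
  apply: ge0_le_integral => //=.
  - by apply/measurable_EFinP; exact: measurable_indic.
  - by apply/measurable_EFinP; apply: measurable_funM.
  - move=> w _; rewrite -EFinM lee_fin -expRD indicE.
    have [/set_mem /= aX|_] := boolP (w \in _); last by rewrite expR_ge0.
    rewrite -[leLHS]expR0 ler_expR -mulrN -mulrDr.
    by rewrite mulr_ge0//; lra.
rewrite ge0_integralZl//; last exact/measurable_EFinP.
rewrite gX.2 -EFinM -expRD lee_fin ler_expR.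
have : (v * t ^+ 2 / 2 <= V * t ^+ 2 / 2)%R.
  by rewrite ler_pM2r// ler_wpM2r ?sqr_ge0.
have -> : (- (a ^+ 2 / (2 * V)) = - (t * a) + V * t ^+ 2 / 2)%R.
  by rewrite /t; field; rewrite gt_eqF.
by move=> ?; rewrite lerD2l.
Qed.

(** By uniqueness of the Laplace transform, X has the law of a normal variable with standard
    deviation sqrt v, to which [normal_prob_itv_ge] applies. *)
Lemma gaussian_mgf_tail_ge (a : R) : (0 < v)%R -> (0 <= a)%R ->
  ((Num.sqrt (2 * pi))^-1 * expR (- 1) * expR (- (a ^+ 2 / v)))%:E <=
  P [set w | (a <= X w)%R].
Proof.
move=> v0 a0; pose s := Num.sqrt v.
have s0 : (0 < s)%R by rewrite sqrtr_gt0.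
have sv : (s ^+ 2 = v)%R by rewrite sqr_sqrtr// ltW.
rewrite -sv; apply: (le_trans (normal_prob_itv_ge _ _ s0 a0)).
have mA : measurable [set w | (a <= X w)%R].
  have := mX measurableT `[a, +oo[%classic (measurable_itv _).
  rewrite setTI; congr measurable.
  by apply/seteqP; split => w /=; rewrite in_itv/= andbT.
pose g : R -> R := \1_(`[a, +oo[%classic).
have mg : measurable_fun setT g by exact: measurable_indic.
have H t : \int[P]_w (1 * expR (t * X w))%:E =
    \int[normal_prob 0 s]_x (1 * expR (t * x))%:E /\
    \int[P]_w (1 * expR (t * X w))%:E < +oo.
  under eq_integral do rewrite mul1r.
  under [X in _ = X]eq_integral do rewrite mul1r.
  rewrite normal_prob_mgf ?gt_eqF// gX.2 mul0r add0r sv; split => //.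
  by rewrite ltry.
have := @same_mgf_integral _ _ _ _ _ P (normal_prob 0 s) X idfun (fun=> 1%R) (fun=> 1%R)
  mX (@measurable_id _ _ _) (measurable_cst _) (measurable_cst _) (fun=> ler01) (fun=> ler01) H g mg
  (fun x => ler0n _ _).
have E1 : \int[P]_w (1 * g (X w))%:E = P [set w | (a <= X w)%R].
  rewrite -(setIT [set w | (a <= X w)%R]) -integral_indic//.
  apply: eq_integral => w _; rewrite mul1r /g !indicE.
  suff -> : (X w \in `[a, +oo[%classic) = (w \in [set w0 | (a <= X w0)%R]) by [].
  by apply/idP/idP => /set_mem /= h; apply/mem_set => /=; move: h; rewrite in_itv/= andbT.
have E2 : \int[normal_prob 0 s]_x (1 * g x)%:E = normal_prob 0 s `[a, +oo[%classic.
  rewrite -[in RHS](setIT `[a, +oo[%classic) -integral_indic//.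
  by apply: eq_integral => w _; rewrite mul1r.
by rewrite E1 E2 => ->.
Qed.

Lemma gaussian_mgfN : gaussian_mgf P (fun w => - X w)%R v.
Proof.
split; first exact: measurable_funN.
move=> t; have := gX.2 (- t)%R; rewrite sqrrN => <-.
by apply: eq_integral => w _; rewrite mulrN mulNr.
Qed.

End GaussianMoments.

Section LinearForms.
Context {R : realType} {I : Type}.
Implicit Types (L : seq (R * I)) (g : I -> R).

(** A list of pairs (coefficient, index) is a formal linear combination. Repeated indices add up, so
    concatenation and convolution need no normal form. *)
Definition lin L g : R := \sum_(p <- L) p.1 * g p.2.

Lemma lin_nil g : lin [::] g = 0.
Proof. by rewrite /lin big_nil. Qed.

Lemma lin_cons p L g : lin (p :: L) g = p.1 * g p.2 + lin L g.
Proof. by rewrite /lin big_cons. Qed.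

Lemma lin_cat L L' g : lin (L ++ L') g = lin L g + lin L' g.
Proof. by rewrite /lin big_cat. Qed.

Definition scale_form (a : R) L := [seq (a * p.1, p.2) | p <- L].

Lemma lin_scale a L g : lin (scale_form a L) g = a * lin L g.
Proof.
by rewrite /lin big_map mulr_sumr; apply: eq_bigr => p _; rewrite mulrA.
Qed.

Lemma lin_addf L g h : lin L (fun i => g i + h i) = lin L g + lin L h.
Proof. by rewrite /lin -big_split /=; apply: eq_bigr => p _; rewrite mulrDr. Qed.

Lemma lin_mulf L a g : lin L (fun i => a * g i) = a * lin L g.
Proof. by rewrite /lin mulr_sumr; apply: eq_bigr => p _; rewrite mulrCA. Qed.

Lemma eq_lin L g h : g =1 h -> lin L g = lin L h.
Proof. by move=> gh; apply: eq_bigr => p _; rewrite gh. Qed.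

Variable C : I -> I -> R.
Hypothesis C_sym : forall i j, C i j = C j i.

Definition cov L L' := lin L (fun i => lin L' (C i)).

Lemma covC L L' : cov L L' = cov L' L.
Proof.
rewrite /cov /lin.
under eq_bigr do rewrite mulr_sumr.
rewrite exchange_big /=; apply: eq_bigr => q _; rewrite mulr_sumr.
by apply: eq_bigr => p _; rewrite C_sym mulrCA.
Qed.

Lemma cov_nil L : cov [::] L = 0.
Proof. exact: lin_nil. Qed.

Lemma cov_cat L L' L'' : cov (L ++ L') L'' = cov L L'' + cov L' L''.
Proof. exact: lin_cat. Qed.

Lemma cov_scale a L L' : cov (scale_form a L) L' = a * cov L L'.
Proof. exact: lin_scale. Qed.

Lemma cov_catr L L' L'' : cov L'' (L ++ L') = cov L'' L + cov L'' L'.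
Proof. by rewrite covC cov_cat !(covC L''). Qed.

Lemma cov_scaler a L L' : cov L' (scale_form a L) = a * cov L' L.
Proof. by rewrite covC cov_scale covC. Qed.

Lemma cov1 i j : cov [:: (1, i)] [:: (1, j)] = C i j.
Proof. by rewrite /cov !lin_cons !lin_nil /= !addr0 !mul1r. Qed.

End LinearForms.

Section GaussianField.
Context {disp : measure_display} {Omega : measurableType disp} {R : realType}.
Variable P : probability Omega R.
Context {I : Type}.
Variables (f : I -> Omega -> R) (C : I -> I -> R).
Implicit Types L : seq (R * I).
Local Open Scope ereal_scope.

(* f is a centred Gaussian family with covariance C, in terms of the Laplace
   transforms of its linear combinations. *)
Definition gaussian_field := (forall i j, C i j = C j i) /\
  forall L, gaussian_mgf P (fun w => lin L (f^~ w)) (cov C L L).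

Hypothesis gf : gaussian_field.
Let C_sym := gf.1.

Lemma gaussian_field_var_ge0 L : (0 <= cov C L L)%R.
Proof.
have [_ v] := gaussian_mgf_moment2 _ _ _ (gf.2 L).
by rewrite -lee_fin -v; apply: integral_ge0 => w _; rewrite lee_fin sqr_ge0.
Qed.

Let expX L : Omega -> R := fun w => expR (lin L (f^~ w)).

Let mX L : measurable_fun setT (fun w => lin L (f^~ w)) := (gf.2 L).1.

Let mexpX L : measurable_fun setT (expX L).
Proof. exact: measurableT_comp. Qed.

Let int_expX L : \int[P]_w (expX L w)%:E = (expR (cov C L L / 2))%:E.
Proof.
rewrite /expX; have := (gf.2 L).2 1%R; rewrite expr1n mulr1 => <-.
by apply: eq_integral => w _; rewrite mul1r.
Qed.

Let int2_expX L L' : \int[(P \x P)%E]_z (expX L z.1 * expX L' z.2)%:E =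
  (expR ((cov C L L + cov C L' L') / 2))%:E.
Proof.
have m1 : measurable_fun setT (fun z : Omega * Omega => expX L z.1).
  exact: measurableT_comp.
have m2 : measurable_fun setT (fun z : Omega * Omega => expX L' z.2).
  exact: measurableT_comp.
rewrite fubini_tonelli1; last 2 first.
- by apply/measurable_EFinP; exact: measurable_funM.
- by move=> z; rewrite lee_fin mulr_ge0 ?expR_ge0.
rewrite /fubini_F /=.
transitivity (\int[P]_x ((expX L x)%:E * (expR (cov C L' L' / 2))%:E)).
  apply: eq_integral => x _; under eq_integral do rewrite EFinM.
  rewrite ge0_integralZl//; first by rewrite int_expX.
  - exact/measurable_EFinP.
  - by move=> y _; rewrite lee_fin expR_ge0.
  - by rewrite lee_fin expR_ge0.
rewrite ge0_integralZr//; first by rewrite int_expX -EFinM -expRD -mulrDl.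
- exact/measurable_EFinP.
- by move=> x _; rewrite lee_fin expR_ge0.
Qed.

Definition form_sum {J : finType} (u : J -> R) (Ls : J -> seq (R * I)) :=
  flatten [seq scale_form (u j) (Ls j) | j <- index_enum J].

Lemma lin_form_sum (J : finType) u (Ls : J -> seq (R * I)) g :
  lin (form_sum u Ls) g = (\sum_j u j * lin (Ls j) g)%R.
Proof.
rewrite /form_sum; elim: (index_enum J) => [|j s IH]; first by rewrite lin_nil big_nil.
by rewrite /= lin_cat IH big_cons lin_scale.
Qed.

Lemma cov_form_sum (J : finType) u (Ls : J -> seq (R * I)) L :
  cov C L (form_sum u Ls) = (\sum_j u j * cov C L (Ls j))%R.
Proof. by rewrite covC// {1}/cov lin_form_sum; apply: eq_bigr => j _; rewrite -/(cov _ _ _) covC. Qed.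

(** Orthogonality makes the joint Laplace transform factor, so [lin L0] may be replaced by an
    independent copy on the second factor of P x P. The coefficients c let one family contain
    residuals, recombinations and [lin L0] itself. *)
Lemma gaussian_field_indep (J : finType) (L0 : seq (R * I)) (Ls : J -> seq (R * I))
    (c : J -> R) :
  (forall j, cov C L0 (Ls j) = 0%R) ->
  forall g : J -> R -> R, (forall j, measurable_fun setT (g j)) ->
  (forall j x, 0 <= g j x <= 1)%R ->
  \int[P]_w (\prod_j g j (lin (Ls j) (f^~ w) + c j * lin L0 (f^~ w)))%:E =
  \int[(P \x P)%E]_z (\prod_j g j (lin (Ls j) (f^~ z.1) + c j * lin L0 (f^~ z.2)))%:E.
Proof.
move=> orth g mg g01.
pose X j w : R := (lin (Ls j) (f^~ w) + c j * lin L0 (f^~ w))%R.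
pose X' j (z : Omega * Omega) : R := (lin (Ls j) (f^~ z.1) + c j * lin L0 (f^~ z.2))%R.
apply: (@same_mgf_prod _ _ _ _ _ P (P \x P)%E J X X') => //.
- by move=> j; apply: measurable_funD => //; apply: measurable_funM.
- move=> j; apply: measurable_funD => //.
    exact: (measurableT_comp (mX (Ls j))).
  by apply: measurable_funM => //; exact: (measurableT_comp (mX L0)).
move=> u; pose A := form_sum u Ls; pose a : R := (\sum_j u j * c j)%R.
have E1 w : (\sum_j u j * X j w = lin (A ++ scale_form a L0) (f^~ w))%R.
  rewrite lin_cat lin_scale lin_form_sum /a mulr_suml -big_split /=.
  by apply: eq_bigr => j _; rewrite mulrDr mulrA.
have E2 z : (expR (\sum_j u j * X' j z) = expX A z.1 * expX (scale_form a L0) z.2)%R.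
  rewrite /expX -expRD; congr expR.
  rewrite lin_scale lin_form_sum /a mulr_suml -big_split /=.
  by apply: eq_bigr => j _; rewrite mulrDr mulrA.
under eq_integral do rewrite E1.
under [X in _ = X /\ _]eq_integral do rewrite E2.
rewrite -/(expX _) int_expX int2_expX; split; last by rewrite ltry.
have c0 : cov C L0 A = 0%R.
  by rewrite cov_form_sum big1// => j _; rewrite orth mulr0.
rewrite cov_cat !cov_catr//.
rewrite (cov_scale C a L0 A) (cov_scaler C C_sym a L0 A) (covC C C_sym A L0) c0.
by rewrite mulr0 addr0 add0r.
Qed.

(** For two independent copies f, f' of the field, (f + f') / sqrt 2 and (f - f') / sqrt 2 are again
    two independent copies: by the parallelogram identity the Laplace exponents agree. *)
Lemma gaussian_field_rotation (J : finType) (j : J -> I)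
    (g h : J -> R -> R) :
  (forall i, measurable_fun setT (g i)) -> (forall i x, 0 <= g i x <= 1)%R ->
  (forall i, measurable_fun setT (h i)) -> (forall i x, 0 <= h i x <= 1)%R ->
  \int[(P \x P)%E]_z ((\prod_i g i ((f (j i) z.1 + f (j i) z.2) / Num.sqrt 2)) *
     (\prod_i h i ((f (j i) z.1 - f (j i) z.2) / Num.sqrt 2)))%:E =
  \int[(P \x P)%E]_z ((\prod_i g i (f (j i) z.1)) * (\prod_i h i (f (j i) z.2)))%:E.
Proof.
move=> mg g01 mh h01.
have r20 : (Num.sqrt 2 != 0 :> R)%R by rewrite gt_eqF// sqrtr_gt0.
have r2 : (Num.sqrt 2 ^+ 2 = 2 :> R)%R by rewrite sqr_sqrtr.
have mf i : measurable_fun setT (f i).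
  have := mX [:: (1%R, i)]; congr measurable_fun.
  by apply/funext => w; rewrite lin_cons lin_nil /= addr0 mul1r.
have mf1 i : measurable_fun setT (fun z : Omega * Omega => f i z.1).
  exact: measurableT_comp.
have mf2 i : measurable_fun setT (fun z : Omega * Omega => f i z.2).
  exact: measurableT_comp.
pose X (i : J + J) (z : Omega * Omega) : R := match i with
  | inl i => ((f (j i) z.1 + f (j i) z.2) / Num.sqrt 2)%R
  | inr i => ((f (j i) z.1 - f (j i) z.2) / Num.sqrt 2)%R end.
pose X' (i : J + J) (z : Omega * Omega) : R := match i with
  | inl i => f (j i) z.1 | inr i => f (j i) z.2 end.
pose gh (i : J + J) : R -> R := match i with inl i => g i | inr i => h i end.
have := @same_mgf_prod _ _ _ _ _ (P \x P)%E (P \x P)%E (J + J)%type X X' _ _ _ gh _ _.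
under eq_integral do rewrite big_sumType /=.
under [X in _ -> _ -> _ -> _ -> _ -> _ = X]eq_integral do rewrite big_sumType /=.
apply.
- case=> i; rewrite /X; apply: measurable_funM => //;
    [exact: measurable_funD|exact: measurable_funB].
- by case=> i; rewrite /X'.
- move=> u; pose one i := [:: (1%R : R, j i)].
  pose A := form_sum (fun i => u (inl i)) one; pose B := form_sum (fun i => u (inr i)) one.
  have linA w : lin A (f^~ w) = (\sum_i u (inl i) * f (j i) w)%R.
    by rewrite lin_form_sum; apply: eq_bigr => i _; rewrite lin_cons lin_nil /= addr0 mul1r.
  have linB w : lin B (f^~ w) = (\sum_i u (inr i) * f (j i) w)%R.
    by rewrite lin_form_sum; apply: eq_bigr => i _; rewrite lin_cons lin_nil /= addr0 mul1r.
  pose s : R := (Num.sqrt 2)^-1%R.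
  have E1 z : expR (\sum_i u i * X i z) =
      (expX (scale_form s (A ++ B)) z.1 * expX (scale_form s (A ++ scale_form (-1) B)) z.2)%R.
    rewrite /expX -expRD; congr expR.
    rewrite !lin_scale !lin_cat !lin_scale !linA !linB big_sumType /=.
    rewrite mulN1r !mulrDr mulrN !mulr_sumr -sumrN -!big_split /=.
    by apply: eq_bigr => i _; rewrite /s; ring.
  have E2 z : expR (\sum_i u i * X' i z) = (expX A z.1 * expX B z.2)%R.
    by rewrite /expX -expRD linA linB big_sumType.
  under eq_integral do rewrite E1.
  under [X in _ = X /\ _]eq_integral do rewrite E2.
  rewrite !int2_expX; split; last by rewrite ltry.
  congr (expR _)%:E; congr (_ / 2)%R.
  rewrite !(cov_scale, cov_scaler C C_sym, cov_cat, cov_catr C C_sym) (covC C C_sym B A).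
  have ss a : (s * (s * a) = a / 2)%R by rewrite mulrA /s -invfM -expr2 r2 mulrC.
  by rewrite !mulrDr !ss; field.
- by case.
- by case.
Qed.

End GaussianField.

Lemma prod_indic_forall {R : realType} {T : Type} (J : finType) (B : J -> set T) (x : T) :
  \prod_j (\1_(B j) x : R) = \1_[set x | forall j, B j x] x.
Proof.
rewrite [RHS]indicE; have [/set_mem /= Bx|nBx] := boolP (x \in _).
  by rewrite big1// => j _; rewrite indicE mem_set.
have [j nBj] : exists j, ~ B j x.
  by apply: contrapT => /forallNP H; case/negP: nBx; apply/mem_set => j; apply: contrapT; exact: H.
by rewrite (bigD1 j)//= indicE memNset// mul0r.
Qed.

Lemma measurable_forall {d} {T : measurableType d} {J : countType} (B : J -> set T) :
  (forall j, measurable (B j)) -> measurable [set x | forall j, B j x].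
Proof.
move=> mB; rewrite (_ : [set x | _] = ~` \bigcup_j ~` B j).
  apply: measurableC; apply: countable_bigcupT_measurable => [|j].
    exact: countableP.
  exact: measurableC.
apply/seteqP; split => x /=; first by move=> Bx [j _ /=]; apply; exact: Bx.
by move=> h j; apply: contrapT => nB; apply: h; exists j.
Qed.

Lemma measurable_norm_le {d} {T : measurableType d} {R : realType} (X : T -> R) t :
  measurable_fun setT X -> measurable [set w | `|X w| <= t].
Proof.
move=> mX; have := mX measurableT `[-t, t]%classic (measurable_itv _).
rewrite setTI; congr measurable; apply/seteqP; split => w /=;
by rewrite in_itv/= ler_norml.
Qed.

(** * Fernique's estimate *)

Section Fernique.
Context {disp : measure_display} {Omega : measurableType disp} {R : realType}.
Variable P : probability Omega R.
Context {I : Type}.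
Variables (f : I -> Omega -> R) (C : I -> I -> R).
Hypothesis gf : gaussian_field P f C.

Lemma gaussian_field_measurable i : measurable_fun setT (f i).
Proof.
have := (gf.2 [:: (1%R, i)]).1; congr measurable_fun.
by apply/funext => w; rewrite lin_cons lin_nil /= addr0 mul1r.
Qed.

Section Finite.
Context (J : finType) (j : J -> I).

Let N (t : R) : set Omega := [set w | forall i, `|f (j i) w| <= t].

Let mN t : measurable (N t).
Proof.
apply: measurable_forall => i; apply: measurable_norm_le.
exact: gaussian_field_measurable.
Qed.

Let p t : R := fine (P (N t)).

Let PN t : P (N t) = (p t)%:E.
Proof. by rewrite fineK// fin_num_measure. Qed.

Let p_le1 t : p t <= 1.
Proof. by rewrite -lee_fin -PN probability_le1. Qed.

Let PNC t : P (~` N t) = (1 - p t)%:E.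
Proof. by rewrite probability_setC// PN. Qed.

(* The rotation by 45 degrees of two independent copies of f has the same law. *)
Lemma fernique_step (s t : R) : p s * (1 - p t) <= (1 - p ((t - s) / Num.sqrt 2)) ^+ 2.
Proof.
have r20 : 0 < Num.sqrt 2 :> R by rewrite sqrtr_gt0.
pose U i (z : Omega * Omega) := (f (j i) z.1 + f (j i) z.2) / Num.sqrt 2.
pose W i (z : Omega * Omega) := (f (j i) z.1 - f (j i) z.2) / Num.sqrt 2.
have mf1 i : measurable_fun setT (fun z : Omega * Omega => f (j i) z.1).
  by apply: measurableT_comp => //; exact: gaussian_field_measurable.
have mf2 i : measurable_fun setT (fun z : Omega * Omega => f (j i) z.2).
  by apply: measurableT_comp => //; exact: gaussian_field_measurable.
have mU i : measurable_fun setT (U i).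
  by apply: measurable_funM => //; exact: measurable_funD.
have mW i : measurable_fun setT (W i).
  by apply: measurable_funM => //; exact: measurable_funB.
pose NU := [set z | forall i, `|U i z| <= t].
pose NW := [set z | forall i, `|W i z| <= s].
have mNU : measurable NU by apply: measurable_forall => i; exact: measurable_norm_le.
have mNW : measurable NW by apply: measurable_forall => i; exact: measurable_norm_le.
pose box (a : R) : R -> R := \1_[set x | `|x| <= a].
have mbox a : measurable_fun setT (box a).
  by apply: measurable_indic; apply: measurable_norm_le; exact: measurable_id.
have box01 a x : 0 <= box a x <= 1.
  by rewrite /box indicE; case: (_ \in _); rewrite ?lexx ler01.
have boxE (T : Type) (X : J -> T -> R) a z :
    \prod_i box a (X i z) = \1_[set z | forall i, `|X i z| <= a] z.
  by rewrite -prod_indic_forall; apply: eq_bigr => i _; rewrite /box !indicE.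
have boxW z : \prod_i box s ((f (j i) z.1 - f (j i) z.2) / Num.sqrt 2) = \1_NW z.
  exact: (boxE _ W).
have boxU z : \prod_i box t ((f (j i) z.1 + f (j i) z.2) / Num.sqrt 2) = \1_NU z.
  exact: (boxE _ U).
have box1 a (z : Omega * Omega) :
    \prod_i box a (f (j i) z.1) = \1_[set z : Omega * Omega | forall i, `|f (j i) z.1| <= a] z.
  exact: (boxE _ (fun i (z : Omega * Omega) => f (j i) z.1)).
have box2 a (z : Omega * Omega) :
    \prod_i box a (f (j i) z.2) = \1_[set z : Omega * Omega | forall i, `|f (j i) z.2| <= a] z.
  exact: (boxE _ (fun i (z : Omega * Omega) => f (j i) z.2)).
have E1 : (P \x P)%E NW = (p s)%:E.
  have := gaussian_field_rotation _ _ _ gf J j (fun=> cst 1) (fun=> box s)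
    (fun=> measurable_cst _) (fun _ _ => _) (fun=> mbox s) (fun=> box01 s).
  move=> /(_ _)/wrap[].
    by move=> _ _ /=; rewrite ler01 lexx.
  under eq_integral do rewrite big1// mul1r boxW.
  under [X in _ = X]eq_integral do rewrite big1// mul1r box2.
  rewrite integral_indic// setIT => ->.
  have -> : [set z : Omega * Omega | forall i, `|f (j i) z.2| <= s] = setT `*` N s.
    by apply/seteqP; split => z /=; [move=> h; split|case].
  rewrite integral_indic ?setIT//; last exact: measurableX.
  transitivity ((P \x P)%E (setT `*` N s)) => //.
  transitivity (P setT * P (N s))%E; first exact: product_measure1E.
  by rewrite probability_setT mul1e PN.
have E2 : (P \x P)%E (NW `&` NU) = (p t * p s)%:E.
  have := gaussian_field_rotation _ _ _ gf J j (fun=> box t) (fun=> box s)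
    (fun=> mbox t) (fun=> box01 t) (fun=> mbox s) (fun=> box01 s).
  under eq_integral do rewrite boxU boxW -[_ * _]/((\1_NU \* \1_NW) _) -indicI.
  under [X in _ = X]eq_integral do
    rewrite box1 box2 -[_ * _]/((\1_[set z : Omega * Omega | forall i, `|f (j i) z.1| <= t] \*
      \1_[set z : Omega * Omega | forall i, `|f (j i) z.2| <= s]) _) -indicI.
  rewrite integral_indic//; last exact: measurableI.
  rewrite setIT setIC => ->.
  have -> : [set z : Omega * Omega | forall i, `|f (j i) z.1| <= t] `&`
     [set z : Omega * Omega | forall i, `|f (j i) z.2| <= s] = N t `*` N s.
    by [].
  rewrite integral_indic ?setIT//; last exact: measurableX.
  transitivity ((P \x P)%E (N t `*` N s)) => //.
  transitivity (P (N t) * P (N s))%E; first exact: product_measure1E.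
  by rewrite !PN.
have E3 : (P \x P)%E (NW `\` NU) = (p s * (1 - p t))%:E.
  transitivity ((P \x P)%E NW - (P \x P)%E (NW `&` NU))%E.
    apply: measureD => //; apply: (@le_lt_trans _ _ (p s)%:E); rewrite ?ltry//.
    by rewrite -E1.
  by rewrite E1 E2 -EFinB; congr (_%:E); ring.
rewrite -lee_fin -E3.
pose N' := ~` N ((t - s) / Num.sqrt 2).
have -> : ((1 - p ((t - s) / Num.sqrt 2)) ^+ 2)%:E = (P \x P)%E (N' `*` N').
  have mN' : measurable N' by exact: measurableC.
  transitivity (P N' * P N')%E; last by apply/esym; exact: product_measure1E.
  by rewrite PNC.
apply: le_measure; rewrite ?inE.
- exact: measurableD.
- by apply: measurableX; apply: measurableC.
(* At an index where |U| > t, both copies exceed (t - s) / sqrt 2 in absolute value, because |W| <=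
   s there. *)
move=> z [zW zU].
have [i /negP] : exists i, ~ `|U i z| <= t.
  by apply: contrapT => /forallNP H; apply: zU => i; apply: contrapT; exact: H.
rewrite -ltNge => tU; have Wi := zW i.
have f1 : f (j i) z.1 = (U i z + W i z) / Num.sqrt 2.
  have -> : U i z + W i z = 2 * f (j i) z.1 / Num.sqrt 2 by rewrite /U /W; ring.
  by rewrite -mulrA -invfM -expr2 sqr_sqrtr// mulrC mulKf.
have f2 : f (j i) z.2 = (U i z - W i z) / Num.sqrt 2.
  have -> : U i z - W i z = 2 * f (j i) z.2 / Num.sqrt 2 by rewrite /U /W; ring.
  by rewrite -mulrA -invfM -expr2 sqr_sqrtr// mulrC mulKf.
split => /= /(_ i); apply/negP; rewrite -ltNge ?f1 ?f2 normrM [X in _ < _ * X]gtr0_norm ?invr_gt0//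
  ltr_pM2r ?invr_gt0//.
- have := lerB_normD (U i z) (W i z); lra.
- have := lerB_dist (U i z) (W i z); lra.
Qed.

(** Along thresholds with t (k + 1) >= s + sqrt 2 t k, the ratio (1 - p (t k)) / p s is squared by
    each application of [fernique_step]; it starts at most at 1/9 because p s >= 9/10. *)
Lemma fernique_finite (s : R) k : 0 <= s -> 9 / 10 <= p s ->
  1 - p (5 * s * Num.sqrt 2 ^+ k) <= (9^-1) ^+ (2 ^ k).
Proof.
move=> s0 ps.
have r20 : 0 < Num.sqrt 2 :> R by rewrite sqrtr_gt0.
have r2 : Num.sqrt 2 ^+ 2 = 2 :> R by rewrite sqr_sqrtr.
(* Here t 0 = s, and sqrt 2 t k <= t (k + 1) - s amounts to sqrt 2 >= 7/5. *)
pose t k : R := s * (7 / 2 * Num.sqrt 2 ^+ k - 5 / 2).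
have pmono (a b : R) : a <= b -> p a <= p b.
  move=> ab; rewrite -lee_fin -!PN; apply: le_measure; rewrite ?inE//.
  by move=> w h i; apply: le_trans ab; exact: h.
suff h : 1 - p (t k) <= p s * (9^-1) ^+ (2 ^ k).
  apply: (@le_trans _ _ (1 - p (t k))).
    rewrite lerD2l lerN2; apply: pmono; rewrite /t.
    have -> : 5 * s * Num.sqrt 2 ^+ k = s * (5 * Num.sqrt 2 ^+ k) by ring.
    rewrite ler_wpM2l//.
    have := exprn_ge0 k (ltW r20); lra.
  by apply: (le_trans h); rewrite ler_piMl// exprn_ge0.
elim: k => [|k IH].
  rewrite expn0 expr1 /t expr0.
  have -> : s * (7 / 2 * 1 - 5 / 2) = s by field.
  lra.
have step := fernique_step s (t k.+1).
have h1 : t k <= (t k.+1 - s) / Num.sqrt 2.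
  rewrite ler_pdivlMr// /t exprS.
  have -> : s * (7 / 2 * (Num.sqrt 2 * Num.sqrt 2 ^+ k) - 5 / 2) - s =
            s * (7 / 2 * (Num.sqrt 2 * Num.sqrt 2 ^+ k) - 7 / 2) by field.
  rewrite -[leLHS]mulrA ler_wpM2l//.
  have : 7 / 5 <= Num.sqrt 2 :> R.
    by rewrite -(@ler_pXn2r _ 2)// ?nnegrE ?ltW// r2; lra.
  move: (Num.sqrt 2) (Num.sqrt 2 ^+ k) => a b; nra.
have h2 := pmono _ _ h1.
rewrite expnS mulnC exprM.
have p0 : 0 < p s by lra.
rewrite -(ler_pM2l p0); apply: (le_trans step).
have h3 : 1 - p ((t k.+1 - s) / Num.sqrt 2) <= p s * 9^-1 ^+ (2 ^ k).
  by apply: le_trans IH; rewrite lerD2l lerN2.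
apply: (@le_trans _ _ ((p s * 9^-1 ^+ (2 ^ k)) ^+ 2)).
  rewrite lerXn2r ?nnegrE//; first by rewrite subr_ge0.
  by rewrite mulr_ge0 ?ltW// exprn_ge0.
by rewrite exprMn expr2 -mulrA.
Qed.
End Finite.

Lemma fernique_countable (j : nat -> I) (s : R) k : 0 <= s ->
  ((9 / 10)%:E <= P [set w | forall n, (`|f (j n) w| <= s)%R])%E ->
  ((1 - (9^-1) ^+ (2 ^ k))%:E <=
   P [set w | forall n, (`|f (j n) w| <= 5 * s * Num.sqrt 2 ^+ k)%R])%E.
Proof.
move=> s0 ps.
pose F m (t : R) := [set w | forall i : 'I_m, `|f (j i) w| <= t].
have mfn n (t : R) : measurable [set w | `|f (j n) w| <= t].
  by apply: measurable_norm_le; exact: gaussian_field_measurable.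
have mF m t : measurable (F m t).
  exact: (measurable_forall (fun (i : 'I_m) => [set w | `|f (j i) w| <= t])).
set t := 5 * s * _.
have FE (a : R) : [set w | forall n, `|f (j n) w| <= a] = \bigcap_m F m a.
  apply/seteqP; split => w /=; first by move=> h m _ i; exact: h.
  by move=> h n; exact: (h n.+1 Logic.I (Ordinal (ltnSn n))).
have FEle (a : R) m : [set w | forall n, `|f (j n) w| <= a] `<=` F m a.
  by move=> w h i; exact: h.
have c : P (F m t) @[m --> \oo] --> P (\bigcap_m F m t).
  apply: nonincreasing_cvg_mu => //.
  - by rewrite -ge0_fin_numE// fin_num_measure.
  - by apply: bigcap_measurable.
  - move=> m n mn; apply/subsetPset => w h i.
    exact: (h (widen_ord mn i)).
rewrite FE -(cvg_lim _ c)//; apply: lime_ge; first by apply/cvg_ex; eexists; exact: c.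
apply: nearW => m.
have := fernique_finite _ (fun i : 'I_m => j i) s k s0.
rewrite -/(F m s) -/t -/(F m t).
have ps' : 9 / 10 <= fine (P (F m s)).
  rewrite -lee_fin fineK ?fin_num_measure//; apply: (le_trans ps).
  by apply: le_measure; rewrite ?inE//; exact: (measurable_forall (fun n => [set w | `|f (j n) w| <= s])).
move=> /(_ ps') h.
rewrite -[leRHS]fineK ?fin_num_measure// lee_fin; lra.
Qed.

End Fernique.

(** * Persistence at unpredictable sites *)

Section StepFunction.
Context {R : realType}.
Implicit Types (b tau v : R).

(* The product of the weights persist_weight b tau (f x) over x in s vanishes
   unless f >= 0 on s, and then equals exp (- tau #{x | f x > b}). *)
Definition persist_weight b tau v : R :=
  \1_`[0, b]%classic v + expR (- tau) * \1_`]b, +oo[%classic v.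

Lemma measurable_persist_weight b tau : measurable_fun setT (persist_weight b tau).
Proof.
apply: measurable_funD; first by apply: measurable_indic; exact: measurable_itv.
by apply: measurable_funM => //; apply: measurable_indic; exact: measurable_itv.
Qed.

Lemma persist_weightE b tau v : persist_weight b tau v =
  if v < 0 then (if b < v then expR (- tau) else 0) else if v <= b then 1 else expR (- tau).
Proof.
rewrite /persist_weight !indicE.
have -> : (v \in `[0, b]%classic) = (0 <= v <= b).
  by apply/idP/idP => [/set_mem|h]; [|apply/mem_set]; rewrite /= in_itv.
have -> : (v \in `]b, +oo[%classic) = (b < v).
  apply/idP/idP => [/set_mem|h]; [|apply/mem_set]; rewrite /= in_itv/= ?andbT//.
have [v0|v0] := ltrP v 0; have [bv|bv] := ltrP b v => //=; rewrite ?mulr1 ?mulr0 ?add0r ?addr0//.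
Qed.

Lemma persist_weight01 b tau v : 0 <= b -> 0 <= tau -> 0 <= persist_weight b tau v <= 1.
Proof.
move=> b0 t0; rewrite persist_weightE.
have e1 : expR (- tau) <= 1 by rewrite -[leRHS]expR0 ler_expR oppr_le0.
have := expR_ge0 (- tau).
by case: ifP => _; case: ifP => _ *; rewrite ?ler01 ?lexx ?e1 //; apply/andP.
Qed.

Context {disp : measure_display} {Omega : measurableType disp}.
Variable P : probability Omega R.
Local Open Scope ereal_scope.

Lemma measurable_le_set (a : R) (X : Omega -> R) : measurable_fun setT X ->
  measurable [set w | (a <= X w)%R].
Proof.
move=> mX; have := mX measurableT `[a, +oo[%classic (measurable_itv _).
rewrite setTI; congr measurable.
by apply/seteqP; split => w /=; rewrite in_itv/= andbT.
Qed.

(** Either m <= 2 b, and m + X is negative with probability at least tau; or m > 2 b, and m + X > b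
    with probability at least 9/10, which is then discounted by exp (- tau). The bound is uniform in
    m, as needed when m is the prediction from other sites. *)
Lemma integral_persist_weight_le (X : Omega -> R) v delta K0 b tau m :
  gaussian_mgf P X v -> (0 < delta)%R -> (delta <= v <= K0)%R ->
  (0 < b)%R -> (0 <= tau <= 1 / 2)%R ->
  (tau <= (Num.sqrt (2 * pi))^-1 * expR (- 1) * expR (- ((3 * b) ^+ 2 / delta)))%R ->
  (expR (- (b ^+ 2 / (2 * K0))) <= 1 / 10)%R ->
  \int[P]_w (persist_weight b tau (m + X w))%:E <= (expR (- (4 / 5 * tau)))%:E.
Proof.
move=> gX d0 /andP[dv vK] b0 /andP[t0 t1] tk bK.
have v0 : (0 < v)%R by lra.
have K0p : (0 < K0)%R by lra.
have mX := gX.1; have gN := gaussian_mgfN _ _ _ gX.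
have mW : measurable_fun setT (fun w => (persist_weight b tau (m + X w))%:E).
  apply/measurable_EFinP; apply: (measurableT_comp (measurable_persist_weight b tau)).
  exact: measurable_funD.
have W01 x := persist_weight01 b tau x (ltW b0) t0.
have [mb|bm] := lerP m (2 * b).
  pose A := [set w | (3 * b <= - X w)%R].
  have mA : measurable A by apply: measurable_le_set; exact: measurable_funN.
  apply: (@le_trans _ _ (P (~` A))).
    rewrite -(setIT (~` A)) -integral_indic//; last exact: measurableC.
    apply: ge0_le_integral => //.
    - by move=> w _; rewrite lee_fin; have /andP[] := W01 (m + X w)%R.
    - by apply/measurable_EFinP; apply: measurable_indic; exact: measurableC.
    - move=> w _; rewrite lee_fin indicE.
      have [|/negP nA] := boolP (w \in ~` A); first by have /andP[] := W01 (m + X w)%R.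
      have Aw : A w by apply: contrapT => h; apply: nA; apply/mem_set.
      rewrite persist_weightE; move: Aw; rewrite /A /= => Aw.
      have -> : (m + X w < 0)%R by lra.
      by have -> : (b < m + X w)%R = false by lra.
  rewrite probability_setC//.
  have h := gaussian_mgf_tail_ge _ _ _ gN (3 * b) v0 _.
  have PA : (tau%:E <= P A).
    apply: le_trans (h _); last by lra.
    rewrite lee_fin; apply: (le_trans tk); rewrite ler_wpM2l ?mulr_ge0 ?invr_ge0 ?sqrtr_ge0 ?expR_ge0//.
    rewrite ler_expR lerN2 ler_wpM2l ?sqr_ge0// lef_pV2//.
  rewrite -(@fineK _ (P A)) ?fin_num_measure// in PA *.
  rewrite -EFinB !lee_fin in PA *.
  have := expR_ge1Dx (- (4 / 5 * tau)); lra.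
pose A := [set w | (b <= - X w)%R].
have mA : measurable A by apply: measurable_le_set; exact: measurable_funN.
have PA : P A <= (1 / 10)%:E.
  by apply: (le_trans (gaussian_mgf_tail _ _ _ gN K0 b vK K0p (ltW b0))); rewrite lee_fin.
apply: (@le_trans _ _ (\int[P]_w ((expR (- tau))%:E + (1 - expR (- tau))%:E * (\1_A w)%:E))).
  have m1 : measurable_fun setT (fun w => (\1_A w : R)%:E).
    by apply/measurable_EFinP; exact: measurable_indic.
  apply: ge0_le_integral => //.
  - by move=> w _; rewrite lee_fin; have /andP[] := W01 (m + X w)%R.
  - by apply: emeasurable_funD => //; exact: emeasurable_funM.
  - move=> w _; rewrite -EFinM -EFinD lee_fin indicE.
    have [_|/negP nA] := boolP (w \in A).
      have -> : (expR (- tau) + (1 - expR (- tau)) * true%:R = 1)%R by rewrite mulr1; ring.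
      by have /andP[] := W01 (m + X w)%R.
    have Aw : ~ A w by move=> h; apply: nA; apply/mem_set.
    rewrite mulr0 addr0 persist_weightE; move: Aw; rewrite /A /= => /negP; rewrite -ltNge => Aw.
    have -> : (m + X w < 0)%R = false by lra.
    by have -> : (m + X w <= b)%R = false by lra.
have e1 : (0 <= 1 - expR (- tau))%R by rewrite subr_ge0 -[leRHS]expR0 ler_expR oppr_le0.
rewrite ge0_integralD//; last 2 first.
- by move=> w _; rewrite mule_ge0 ?lee_fin.
- by apply: emeasurable_funM => //; apply/measurable_EFinP; exact: measurable_indic.
rewrite ge0_integralZl//; last by apply/measurable_EFinP; exact: measurable_indic.
rewrite integral_cst//= probability_setT mule1 integral_indic// setIT.
apply: (@le_trans _ _ ((expR (- tau))%:E + (1 - expR (- tau))%:E * (1 / 10)%:E)).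
  by rewrite leeD2l// lee_wpmul2l ?lee_fin.
rewrite -EFinM -EFinD lee_fin.
have e2 := expR_ge1Dx (- tau).
have e3 : expR (- (4 / 5 * tau)) = (expR (- tau) * expR (1 / 5 * tau))%R.
  by rewrite -expRD; congr expR; field.
have e4 := expR_ge1Dx (1 / 5 * tau).
rewrite e3; move: e1 e2 e4 (expR_gt0 (- tau)).
move: (expR (- tau)) (expR (1 / 5 * tau)) => x y *.
nra.
Qed.

End StepFunction.

Section LowAverage.
Context {disp : measure_display} {Omega : measurableType disp} {R : realType}.
Context {I : eqType} (f : I -> Omega -> R).
Hypothesis mf : forall x, measurable_fun setT (f x).

Definition low_average (s : seq I) (b : R) : set Omega :=
  [set w | (forall x, x \in s -> 0 <= f x w) /\
           \sum_(x <- s) f x w <= (size s)%:R * b].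

Lemma measurable_low_average s b : measurable (low_average s b).
Proof.
have mS : measurable_fun setT (fun w => \sum_(x <- s) - f x w).
  by apply: (@measurable_sum _ _ _ _ _ _ (fun x w => - f x w)) => x; exact: measurable_funN.
have -> : low_average s b = [set w | forall k : 'I_(size s), 0 <= f (tnth (in_tuple s) k) w] `&`
    [set w | - ((size s)%:R * b) <= \sum_(x <- s) - f x w].
  apply/seteqP; split => w /= [h1 h2]; split.
  - by move=> k; apply: h1; exact: mem_tnth.
  - by rewrite sumrN lerN2.
  - by move=> x /(tnthP (in_tuple s))[k ->].
  - by move: h2; rewrite sumrN lerN2.
apply: measurableI; last exact: measurable_le_set.
apply: (measurable_forall (fun k : 'I_(size s) => [set w | 0 <= f (tnth (in_tuple s) k) w])) => k.
exact: measurable_le_set.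
Qed.

End LowAverage.

Section Prediction.
Context {disp : measure_display} {Omega : measurableType disp} {R : realType}.
Variable P : probability Omega R.
Context {I : eqType}.
Variables (f : I -> Omega -> R) (C : I -> I -> R).
Hypothesis gf : gaussian_field P f C.
Implicit Types (L : seq (R * I)) (s : seq I).

Let C_sym := gf.1.

Definition supported s L := all (fun p => p.2 \in s) L.

Lemma cov_supported s L A : supported s L ->
  (forall y, y \in s -> cov C A [:: (1, y)] = 0) -> cov C A L = 0.
Proof.
move=> + h; elim: L => [|[a y] L IH] /=; first by rewrite covC// cov_nil.
move=> /andP[ys sL]; rewrite covC//.
have -> : cov C ((a, y) :: L) A = a * cov C [:: (1, y)] A + cov C L A.
  by rewrite /cov !lin_cons lin_nil /= addr0 mul1r.
by rewrite !(covC C _ _ A)// h// IH// mulr0 addr0.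
Qed.

(** The degenerate case of Cauchy-Schwarz: the variance of A + t L is affine in t and
    nonnegative. *)
Lemma cov_cauchy_eq0 L A : cov C L L = 0 -> cov C L A = 0.
Proof.
move=> L0; apply: contrapT => /eqP cN0.
have q0 : 0 <= cov C A A by exact: gaussian_field_var_ge0 gf A.
have h t : 0 <= cov C A A + 2 * t * cov C L A.
  have := gaussian_field_var_ge0 P f C gf (A ++ scale_form t L).
  rewrite !(cov_cat, cov_catr C C_sym, cov_scale, cov_scaler C C_sym) L0 (covC C C_sym A L).
  by rewrite !mulr0 addr0; lra.
have := h (- (cov C A A + 1) / (2 * cov C L A)).
have -> : 2 * (- (cov C A A + 1) / (2 * cov C L A)) * cov C L A = - (cov C A A + 1).
  by field.
lra.
Qed.

(** Gram-Schmidt: to the residual of x after s is added the multiple of the residual of y that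
    cancels their covariance. *)
Lemma residual_exists s (x : I) : exists2 L, supported s L &
  forall y, y \in s -> cov C ((1, x) :: L) [:: (1, y)] = 0.
Proof.
elim: s x => [|y s IH] x; first by exists [::].
have [Lx sx ox] := IH x; have [Ly sy oy] := IH y.
have sub L : supported s L -> supported (y :: s) L.
  by apply: sub_all => p ps; rewrite inE ps orbT.
set rx := (1, x) :: Lx in ox *; set ry := (1, y) :: Ly in oy *.
have covy A : (forall z, z \in s -> cov C A [:: (1, z)] = 0) ->
    cov C A [:: (1, y)] = cov C A ry.
  move=> oA; rewrite -[ry]/([:: (1, y)] ++ Ly) cov_catr//.
  by rewrite (cov_supported s Ly)// addr0.
(* If y is already determined by s, its residual has variance 0, is orthogonal to everything, and y
   imposes no new condition. *)
have [r0|r0] := eqVneq (cov C ry ry) 0.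
  exists Lx; first exact: sub.
  move=> z; rewrite inE => /predU1P[->|/ox//].
  by rewrite covy// covC//; exact: cov_cauchy_eq0.
pose c := - (cov C rx ry / cov C ry ry).
exists (Lx ++ scale_form c ry).
  rewrite /supported all_cat -!/(supported _ _) sub//= inE eqxx /=.
  by rewrite /supported /scale_form all_map; apply: sub_all (sub _ sy) => p.
have o z : z \in s -> cov C (rx ++ scale_form c ry) [:: (1, z)] = 0.
  by move=> zs; rewrite cov_cat cov_scale ox// oy// mulr0 addr0.
move=> z; rewrite inE => /predU1P[->|/o//].
rewrite -[_ :: _]/(rx ++ scale_form c ry) covy// cov_cat cov_scale /c.
by field.
Qed.

(* Lower bound delta on the conditional variance of each f x given the values
   of f at the points following x. *)
Fixpoint unpredictable (delta : R) s : Prop := if s is x :: s' then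
    (forall L, supported s' L -> delta <= cov C ((1, x) :: L) ((1, x) :: L)) /\
    unpredictable delta s'
  else True.

Local Open Scope ereal_scope.

(** The first site is peeled off: f x = - L + L0, where L depends on the values at s and the
    residual L0 is independent of them. Given those values, the integral of F (f x) is that of F (m
    + X) with X of variance in [delta, K0]. *)
Lemma integral_prod_unpredictable (F : R -> R) (rho delta K0 : R) s :
  measurable_fun setT F -> (forall x : R, 0 <= F x <= 1)%R -> (0 <= rho)%R ->
  (forall (X : Omega -> R) (v m : R), (delta <= v <= K0)%R -> gaussian_mgf P X v ->
     \int[P]_w (F (m + X w))%:E <= rho%:E) ->
  unpredictable delta s -> (forall x, C x x <= K0)%R ->
  \int[P]_w (\prod_(x <- s) F (f x w))%:E <= (rho ^+ size s)%:E.
Proof.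
move=> mF F01 rho0 hF + CK; elim: s => [|x s IH] /=.
  move=> _; rewrite expr0; under eq_integral do rewrite big_nil.
  by rewrite integral_cst//= mul1e probability_setT.
move=> [unp us].
have [L sL orth] := residual_exists s x.
pose L0 := (1%R, x) :: L.
pose J := 'I_(size s).+1.
(* The index [ord0] stands for x, written as - L plus 1 times L0; the other indices stand for the
   sites of s and do not involve L0. *)
pose Ls (i : J) : seq (R * I) := if unlift ord0 i is Some k
  then [:: (1%R, tnth (in_tuple s) k)] else scale_form (-1) L.
pose c (i : J) : R := if unlift ord0 i is Some k then 0%R else 1%R.
have oL : cov C L0 L = 0%R by exact: cov_supported sL orth.
have oLs i : cov C L0 (Ls i) = 0%R.
  rewrite /Ls; case: unliftP => [k _|_]; first by apply: orth; exact: mem_tnth.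
  by rewrite cov_scaler// oL mulr0.
have := gaussian_field_indep P f C gf J L0 Ls c oLs (fun=> F) (fun=> mF) (fun=> F01).
have mf y := gaussian_field_measurable P f C gf y.
have m0 : measurable_fun setT (fun w => lin L0 (f^~ w)) := (gf.2 L0).1.
have mL : measurable_fun setT (fun w => lin L (f^~ w)) := (gf.2 L).1.
have e1 k w : lin [:: (1%R, tnth (in_tuple s) k)] (f^~ w) = f (tnth (in_tuple s) k) w.
  by rewrite lin_cons lin_nil /= mul1r addr0.
under eq_integral => w _.
  rewrite big_ord_recl /Ls /c unlift_none mul1r lin_scale.
  under eq_bigr do rewrite liftK mul0r addr0 e1.
  rewrite mulN1r /L0 lin_cons /= mul1r addrC addrK.
  rewrite -(big_tnth _ _ s predT (fun y => F (f y w))).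
  over.
under [X in _ = X]eq_integral => z _.
  rewrite big_ord_recl /Ls /c unlift_none mul1r lin_scale mulN1r.
  under eq_bigr do rewrite liftK mul0r addr0 e1.
  rewrite -(big_tnth _ _ s predT (fun y => F (f y z.1))).
  over.
move=> E; under eq_integral do rewrite big_cons.
rewrite E; pose W w : R := (\prod_(y <- s) F (f y w))%R.
have mW : measurable_fun setT W.
  by apply: measurable_prod => y _; exact: measurableT_comp.
have W0 w : (0 <= W w)%R by apply: prodr_ge0 => y _; have /andP[] := F01 (f y w).
pose G (z : Omega * Omega) : R := F (- lin L (f^~ z.1) + lin L0 (f^~ z.2))%R.
have G0 z : (0 <= G z)%R by have /andP[] := F01 (- lin L (f^~ z.1) + lin L0 (f^~ z.2))%R.
have mG : measurable_fun setT G.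
  apply: measurableT_comp => //; apply: measurable_funD.
    by apply: measurable_funN; exact: (measurableT_comp mL).
  exact: (measurableT_comp m0).
rewrite (fubini_tonelli1 (fun z => (G z * W z.1)%:E)); last 2 first.
- apply/measurable_EFinP; apply: measurable_funM => //.
  exact: measurableT_comp.
- by move=> z; rewrite lee_fin mulr_ge0.
rewrite /fubini_F /=.
have dK : (delta <= cov C L0 L0 <= K0)%R.
  apply/andP; split; first exact: unp.
  apply: le_trans (CK x); rewrite -(cov1 C x x).
  (* Pythagoras: residual and prediction are orthogonal, so the residual variance is at most
     [C x x]. *)
  have e : cov C [:: (1%R, x)] [:: (1%R, x)] = (cov C L0 L0 + cov C L L)%R.
    have -> : cov C [:: (1%R, x)] [:: (1%R, x)] =
       cov C (L0 ++ scale_form (-1) L) (L0 ++ scale_form (-1) L).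
      rewrite -[L0]/([:: (1%R, x)] ++ L) !(cov_cat, cov_catr C C_sym, cov_scale, cov_scaler C C_sym).
      by rewrite (covC C C_sym L [:: (1%R, x)]); ring.
    rewrite !(cov_cat, cov_catr C C_sym, cov_scale, cov_scaler C C_sym) oL (covC C C_sym L L0) oL.
    by ring.
  by rewrite e lerDl (gaussian_field_var_ge0 P f C gf).
apply: (@le_trans _ _ (\int[P]_w (rho%:E * (W w)%:E))).
  apply: ge0_le_integral => //.
  - by move=> w _; apply: integral_ge0 => w' _; rewrite lee_fin mulr_ge0.
  - apply: (measurable_fun_fubini_tonelli_F (fun z => (G z * W z.1)%:E)).
    + apply/measurable_EFinP; apply: measurable_funM => //.
      exact: measurableT_comp.
    + by move=> z; rewrite lee_fin mulr_ge0.
  - by apply: emeasurable_funM => //; exact/measurable_EFinP.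
  - move=> w _; under eq_integral do rewrite EFinM.
    rewrite ge0_integralZr//; last 3 first.
    + apply/measurable_EFinP.
      exact: (measurableT_comp mG (measurable_pair1 w)).
    + by move=> w' _; rewrite lee_fin.
    + by rewrite lee_fin.
    rewrite lee_wpmul2r ?lee_fin//.
    by rewrite /G /=; apply: (hF (fun w' => lin L0 (f^~ w')) (cov C L0 L0) (- lin L (f^~ w))%R dK (gf.2 L0)).
rewrite ge0_integralZl ?lee_fin//; last 2 first.
- exact/measurable_EFinP.
- by move=> w _; rewrite lee_fin.
by rewrite exprS EFinM lee_wpmul2l ?lee_fin//; exact: IH.
Qed.

(** Markov's inequality for the product of the weights: its expectation is at most exp (- 4/5 tau
    size s), while on the event it is at least exp (- 1/2 tau size s). The difference of the rates
    is 3/10. *)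
Lemma unpredictable_persistence (delta K0 b tau : R) s :
  (0 < delta)%R -> (0 < b)%R -> (0 <= tau <= 1 / 2)%R ->
  (tau <= (Num.sqrt (2 * pi))^-1 * expR (- 1) * expR (- ((3 * b) ^+ 2 / delta)))%R ->
  (expR (- (b ^+ 2 / (2 * K0))) <= 1 / 10)%R ->
  unpredictable delta s -> (forall x, C x x <= K0)%R ->
  P (low_average f s (b / 2)) <=
  (expR (- (3 / 10 * tau * (size s)%:R)))%:E.
Proof.
move=> d0 b0 t01 tk bK us CK; have /andP[t0 _] := t01.
set A := low_average f s (b / 2).
have mf y := gaussian_field_measurable P f C gf y.
have mA : measurable A by exact: measurable_low_average.
pose W w : R := (\prod_(y <- s) persist_weight b tau (f y w))%R.
have W01 x := persist_weight01 b tau x (ltW b0) t0.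
have mW : measurable_fun setT W.
  apply: measurable_prod => y _; apply: (measurableT_comp (measurable_persist_weight b tau)).
  exact: mf.
have W0 w : (0 <= W w)%R by apply: prodr_ge0 => y _; have /andP[] := W01 (f y w).
have := integral_prod_unpredictable (persist_weight b tau) (expR (- (4 / 5 * tau))) delta K0 s
  (measurable_persist_weight b tau) W01 (expR_ge0 _) _ us CK.
have hF X v m : (delta <= v <= K0)%R -> gaussian_mgf P X v ->
   \int[P]_w (persist_weight b tau (m + X w))%:E <= (expR (- (4 / 5 * tau)))%:E.
  by move=> dvK gX; exact: integral_persist_weight_le gX d0 dvK b0 t01 tk bK.
move=> /(_ hF) hW.
have lower w : A w -> (expR (- (tau * ((size s)%:R / 2))) <= W w)%R.
  move=> [f0 fs].
  (* For v >= 0 the weight is at least exp (- tau v / b): it is 1 up to b, and beyond b the ratio v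
     / b exceeds 1. The bound then only involves the sum of the values. *)
  have h1 : (\prod_(x <- s) expR (- (tau * (f x w / b))) <= W w)%R.
    rewrite /W big_seq [leRHS]big_seq; apply: ler_prod => x xs.
    rewrite expR_ge0 /= persist_weightE ltNge f0//=.
    have fx := f0 _ xs.
    case: ifPn => [_|]; first by rewrite -[leRHS]expR0 ler_expR oppr_le0 mulr_ge0// divr_ge0// ltW.
    rewrite -ltNge => bf; rewrite ler_expR lerN2 ler_peMr//.
    by rewrite ler_pdivlMr// mul1r ltW.
  apply: le_trans h1; rewrite -expR_sum ler_expR sumrN lerN2 -mulr_sumr ler_wpM2l// -mulr_suml.
  by rewrite ler_pdivrMr// mulrAC -mulrA.
apply: (@le_trans _ _ (\int[P]_w ((expR (tau * ((size s)%:R / 2)))%:E * (W w)%:E))).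
  rewrite -(setIT A) -integral_indic//; apply: ge0_le_integral => //.
  - by apply/measurable_EFinP; exact: measurable_indic.
  - by apply: emeasurable_funM => //; exact/measurable_EFinP.
  - move=> w _; rewrite -EFinM lee_fin indicE.
    have [/set_mem /lower h|_] := boolP (w \in A); last by rewrite mulr_ge0 ?expR_ge0.
    apply: (@le_trans _ _ (expR (tau * ((size s)%:R / 2)) * expR (- (tau * ((size s)%:R / 2))))%R).
      by rewrite -expRD subrr expR0.
    by rewrite ler_wpM2l ?expR_ge0.
rewrite ge0_integralZl ?lee_fin ?expR_ge0//; last 2 first.
- exact/measurable_EFinP.
- by move=> w _; rewrite lee_fin.
apply: (le_trans (lee_wpmul2l _ hW)); first by rewrite lee_fin expR_ge0.
rewrite -EFinM lee_fin -expRM_natl -expRD ler_expR le_eqVlt; apply/orP; left; apply/eqP.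
by field.
Qed.

End Prediction.

(** * Pivoted elimination of a Gram matrix *)

Section Greedy.
Context {R : realType} {K : finType}.
Implicit Types (A : K -> K -> R) (a b : K -> R) (s : seq K).

Definition qform A a : R := \sum_i \sum_j a i * a j * A i j.

Let delta_at (x : K) (t : R) : K -> R := fun i => if i == x then t else 0.

Let sum_delta x t (g : K -> R) : \sum_i delta_at x t i * g i = t * g x.
Proof.
rewrite (bigD1 x)//= /delta_at eqxx big1 ?addr0// => i /negbTE ->.
by rewrite mul0r.
Qed.

Let qformE A a : qform A a = \sum_i a i * \sum_j A i j * a j.
Proof.
apply: eq_bigr => i _; rewrite mulr_sumr; apply: eq_bigr => j _; ring.
Qed.

Let qform_add A a x t : (forall i j, A i j = A j i) ->
  qform A (fun i => a i + delta_at x t i) =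
  qform A a + 2 * t * (\sum_i a i * A x i) + t ^+ 2 * A x x.
Proof.
move=> sA.
have rowE i : \sum_j A i j * (a j + delta_at x t j) = \sum_j A i j * a j + t * A i x.
  under eq_bigr do rewrite mulrDr; rewrite big_split /=; congr (_ + _).
  by rewrite -(sum_delta x t (A i)); apply: eq_bigr => j _; rewrite mulrC.
rewrite !qformE; under eq_bigr do rewrite rowE mulrDl mulrDr.
rewrite !big_split /= sum_delta.
have -> : \sum_i a i * (t * A i x) = t * \sum_i a i * A x i.
  by rewrite mulr_sumr; apply: eq_bigr => i _; rewrite mulrCA sA.
rewrite mulrDr.
have -> : t * (\sum_j A x j * a j) = t * \sum_i a i * A x i.
  by congr (_ * _); apply: eq_bigr => i _; rewrite mulrC.
ring.
Qed.

(** This is the diagonal entry at x of A^2 <= c A, obtained by testing positivity on the unit vector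
    at x minus its image by A / c. *)
Let column_bound A c x : (forall i j, A i j = A j i) -> 0 < c ->
  (forall a, 0 <= qform A a <= c * \sum_i a i ^+ 2) ->
  \sum_i A x i ^+ 2 <= c * A x x.
Proof.
move=> sA c0 hA; set S := \sum_i _.
have S0 : 0 <= S by apply: sumr_ge0 => i _; exact: sqr_ge0.
have /andP[h _] := hA (fun i => - c^-1 * A x i + delta_at x 1 i).
have /andP[_ h2] := hA (fun i => - c^-1 * A x i).
move: h; rewrite qform_add// expr1n mulr1 mul1r.
have e1 : \sum_i - c^-1 * A x i * A x i = - c^-1 * S.
  by rewrite mulr_sumr; apply: eq_bigr => i _; rewrite -mulrA -expr2.
have e2 : \sum_i (- c^-1 * A x i) ^+ 2 = c^-1 ^+ 2 * S.
  by rewrite mulr_sumr; apply: eq_bigr => i _; rewrite exprMn sqrrN.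
rewrite e1; rewrite e2 in h2.
have e3 : c * (c^-1 ^+ 2 * S) = c^-1 * S by field; rewrite gt_eqF.
rewrite e3 in h2 => h3.
have : 0 <= A x x - c^-1 * S by lra.
by rewrite subr_ge0 ler_pdivrMl.
Qed.

(* One step of pivoted Cholesky elimination, i.e. passing to the conditional
   covariance given the value at x; it lowers the trace by at most c. *)
Let pivot A x i j : R := A i j - A x i * A x j / A x x.

Let qform_pivot A x b : qform (pivot A x) b =
  qform A b - (\sum_i b i * A x i) ^+ 2 / A x x.
Proof.
rewrite /qform.
have -> : (\sum_i b i * A x i) ^+ 2 / A x x =
    \sum_i \sum_j b i * b j * (A x i * A x j / A x x).
  rewrite expr2 mulr_suml mulr_suml; apply: eq_bigr => i _.
  rewrite mulr_sumr mulr_suml; apply: eq_bigr => j _; ring.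
rewrite -sumrB; apply: eq_bigr => i _; rewrite -sumrB; apply: eq_bigr => j _.
by rewrite /pivot mulrBr.
Qed.

(** For x outside s', the vectors b are the unit vector at x plus any vector supported on s'; the
    infimum of [qform A b] is thus the Gram-Schmidt pivot of x after s'. *)
Fixpoint independent_pivots A (delta : R) s : Prop := if s is x :: s' then
    (forall b, (forall i, i \notin s' -> b i = (i == x)%:R) -> delta <= qform A b) /\
    independent_pivots A delta s'
  else True.

(** Count of the trace: it starts at least at #|K| kappa and loses at most c per step, so for fewer
    than m steps the mean diagonal entry is still at least delta and a further pivot exists. *)
Lemma greedy_pivots A (c kappa delta : R) (m : nat) :
  (forall i j, A i j = A j i) -> 0 < c -> 0 < delta ->
  (forall a, 0 <= qform A a <= c * \sum_i a i ^+ 2) ->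
  (forall i, kappa <= A i i) ->
  c * m%:R <= #|K|%:R * (kappa - delta) ->
  exists2 s, size s = m & uniq s /\ independent_pivots A delta s.
Proof.
move=> sA c0 d0 hA hk hm.
(* [A'] is the Schur complement of A after elimination of s: its form bounds from below that of A
   over all modifications of b on s. *)
suff H k : (k <= m)%N -> exists s (A' : K -> K -> R), [/\ size s = k,
    uniq s /\ independent_pivots A delta s,
    (forall i j, A' i j = A' j i) /\ (forall a, 0 <= qform A' a <= c * \sum_i a i ^+ 2),
    (forall b b', (forall i, i \notin s -> b' i = b i) -> qform A' b <= qform A b') &
    #|K|%:R * kappa - c * k%:R <= \sum_i A' i i].
  by have [s [A' [sm us _ _ _]]] := H m (leqnn m); exists s.
elim: k => [_|k IH km].
  exists [::], A; split => //.
    by move=> b b' bb; rewrite (_ : b' = b)//; apply/funext => i; exact: bb.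
  rewrite mulr0 subr0 -[X in X * _]sumr_const mulr_suml.
  by apply: ler_sum => i _; rewrite mul1r.
have [s [A' [sk [us ps] [sA' hA'] hq tr]]] := IH (ltnW km).
have [x xd] : exists x, delta <= A' x x.
  apply: contrapT => /forallNP H.
  have : \sum_i A' i i <= #|K|%:R * delta.
    rewrite -[X in X * _]sumr_const mulr_suml; apply: ler_sum => i _.
    by rewrite mul1r leNgt; apply/negP => h; apply: (H i); exact: ltW.
  have : c * k%:R < c * m%:R by rewrite ltr_pM2l// ltr_nat.
  by move: tr hm; rewrite mulrBr; lra.
have x0 : 0 < A' x x by apply: lt_le_trans xd.
have hx b b' : (forall i, i \notin x :: s -> b' i = b i) ->
    qform (pivot A' x) b <= qform A b'.
  move=> bb; pose t := if x \in s then 0 else b' x - b x.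
  apply: (@le_trans _ _ (qform A' (fun i => b i + delta_at x t i))).
    rewrite qform_pivot qform_add// -addrA lerD2l.
    set y := \sum_i _.
    have : 0 <= (y + t * A' x x) ^+ 2 / A' x x by rewrite divr_ge0 ?sqr_ge0// ltW.
    have -> : (y + t * A' x x) ^+ 2 / A' x x = y ^+ 2 / A' x x + (2 * t * y + t ^+ 2 * A' x x).
      by field; rewrite gt_eqF.
    lra.
  apply: hq => i ins; rewrite /delta_at.
  case: eqVneq ins => [->|ix] ins.
    rewrite /t; case: ifP => xs; last by rewrite addrC subrK.
    by rewrite xs in ins.
  by rewrite addr0 bb// inE negb_or ix.
(* For x in s, the zero vector is a modification on s of the unit vector at x, which gives
   [A' x x <= 0]. *)
have xns : x \notin s.
  apply/negP => xs.
  have := hq (delta_at x 1) (fun=> 0) _.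
  have -> : qform A (fun=> 0) = 0.
    by rewrite /qform big1// => i _; rewrite big1// => j _; rewrite !mul0r.
  have -> : delta_at x 1 = (fun i => 0 + delta_at x 1 i) by apply/funext => i; rewrite add0r.
  rewrite qform_add//.
  have -> : qform A' (fun=> 0) = 0.
    by rewrite /qform big1// => i _; rewrite big1// => j _; rewrite !mul0r.
  rewrite big1 => [|i _]; last by rewrite mul0r.
  rewrite mulr0 !add0r expr1n mul1r => h.
  have : A' x x <= 0.
    by apply: h => i ins; rewrite /delta_at add0r; case: eqP => // ix; move: ins; rewrite ix xs.
  lra.
exists (x :: s), (pivot A' x); split => //=.
- by rewrite sk.
- rewrite xns us; split => //; split => // b hb.
  apply: (le_trans xd).
  have -> : A' x x = qform A' (delta_at x 1).
    have -> : delta_at x 1 = (fun i => 0 + delta_at x 1 i) by apply/funext => i; rewrite add0r.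
    rewrite qform_add//.
    have -> : qform A' (fun=> 0) = 0.
      by rewrite /qform big1// => i _; rewrite big1// => j _; rewrite !mul0r.
    rewrite big1 => [|i _]; last by rewrite mul0r.
    by rewrite mulr0 !add0r expr1n mul1r.
  apply: hq => i ins; rewrite hb// /delta_at; case: eqP => //.
- split.
    by move=> i j; rewrite /pivot sA' [A' x i * _]mulrC.
  move=> a; apply/andP; split.
    pose t := - (\sum_i a i * A' x i) / A' x x.
    have /andP[+ _] := hA' (fun i => a i + delta_at x t i).
    rewrite qform_add// qform_pivot.
    set y := \sum_i _ in t *.
    have -> : qform A' a + 2 * t * y + t ^+ 2 * A' x x = qform A' a - y ^+ 2 / A' x x.
      by rewrite /t; field; rewrite gt_eqF.
    by [].
  have /andP[_ h] := hA' a; apply: le_trans h; rewrite qform_pivot gerBl.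
  by rewrite divr_ge0 ?sqr_ge0// ltW.
- rewrite -natr1 mulrDr mulr1 /pivot sumrB.
  have -> : \sum_i A' x i * A' x i / A' x x = (\sum_i A' x i ^+ 2) / A' x x.
    by rewrite mulr_suml; apply: eq_bigr => i _; rewrite expr2.
  have := column_bound A' c x sA' c0 hA'; rewrite -ler_pdivrMr//.
  by move: tr; lra.
Qed.

End Greedy.

(** * Bessel inequality on a set of positive spectral mass *)

Section Trigonometry.
Context {R : realType}.
Implicit Types x y : R.

Lemma dist_cos_le x y : `|cos x - cos y| <= `|x - y|.
Proof.
wlog xy : x y / x <= y.
  move=> H; case/orP: (le_total x y) => [/H//|/H].
  by rewrite distrC [leRHS]distrC.
have cc : {within `[x, y], continuous (@cos R)}.
  by apply: continuous_subspaceT => z; exact: continuous_cos.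
have [c _ E] := MVT_segment xy (fun z _ => is_derive_cos z) cc.
rewrite distrC E normrM normrN [leRHS]distrC ler_piMl//.
by rewrite ler_norml sin_geN1 sin_le1.
Qed.

Lemma abs_sin_le x : `|sin x| <= `|x|.
Proof.
have h (z : R) : sin z = cos (z - pi / 2).
  by rewrite -sinDpihalf subrK.
have -> : sin x = cos (x - pi / 2) - cos (0 - pi / 2).
  by rewrite -!h sin0 subr0.
by apply: (le_trans (dist_cos_le _ _)); rewrite opprB addrA subrK subr0.
Qed.

Lemma one_sub_cosE x : 1 - cos x = 2 * sin (x / 2) ^+ 2.
Proof.
have -> : cos x = cos ((x / 2) *+ 2) by rewrite -mulr_natl; congr cos; field.
by rewrite cos_mulr2n cos2sin2; ring.
Qed.

Lemma cos_ge x : 1 - x ^+ 2 / 2 <= cos x.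
Proof.
have : 1 - cos x <= x ^+ 2 / 2; last by lra.
rewrite one_sub_cosE.
have : sin (x / 2) ^+ 2 <= (x / 2) ^+ 2.
  by rewrite -[leLHS]real_normK ?num_real// -[leRHS]real_normK ?num_real// lerXn2r ?nnegrE// abs_sin_le.
by rewrite exprMn; lra.
Qed.

Lemma cos_ge_half x : `|x| <= 1 -> 2^-1 <= cos x.
Proof.
move=> x1; apply: le_trans (cos_ge x).
have : x ^+ 2 <= 1 by rewrite -[leLHS]real_normK ?num_real// expr_le1.
lra.
Qed.

Lemma sin_ge_quarter x : 0 <= x <= pi / 2 -> x / 4 <= sin x.
Proof.
move=> /andP[x0 x2]; have /andP[_ p2] := @pihalf_02 R.
have [x1|x1] := lerP x 1.
  have cs : {within `[0, x], continuous (@sin R)}.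
    by apply: continuous_subspaceT => z; exact: continuous_sin.
  have [c] := MVT_segment x0 (fun z _ => is_derive_sin z) cs.
  rewrite in_itv/= sin0 !subr0 => /andP[c0 cx] ->.
  have : 2^-1 <= cos c by apply: cos_ge_half; rewrite ger0_norm; lra.
  nra.
have -> : sin x = cos (pi / 2 - x) by rewrite -cosN opprB -sinDpihalf subrK.
have : 2^-1 <= cos (pi / 2 - x) by apply: cos_ge_half; rewrite ger0_norm; lra.
lra.
Qed.

Lemma one_sub_cos_ge x : `|x| <= pi -> x ^+ 2 / 32 <= 1 - cos x.
Proof.
move=> xpi; rewrite one_sub_cosE.
have -> : sin (x / 2) ^+ 2 = sin (`|x| / 2) ^+ 2.
  have [x0|x0] := lerP 0 x; first by rewrite ger0_norm.
  by rewrite ltr0_norm// mulNr sinN sqrrN.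
rewrite -[x ^+ 2]real_normK ?num_real//.
have h : `|x| / 2 / 4 <= sin (`|x| / 2) by apply: sin_ge_quarter; have := normr_ge0 x; lra.
have : (`|x| / 8) ^+ 2 <= sin (`|x| / 2) ^+ 2.
  by rewrite lerXn2r ?nnegrE; have := normr_ge0 x; lra.
rewrite exprMn; lra.
Qed.

Lemma cosD2piM x n : cos (x + 2 * pi * n%:R) = cos x.
Proof.
have -> : 2 * pi * n%:R = pi *+ 2 *+ n :> R by rewrite -(mulr_natl pi 2) -[RHS]mulr_natr.
by rewrite (periodicn (@cosD2pi R)).
Qed.

Lemma sinD2piM x n : sin (x + 2 * pi * n%:R) = sin x.
Proof.
have -> : 2 * pi * n%:R = pi *+ 2 *+ n :> R by rewrite -(mulr_natl pi 2) -[RHS]mulr_natr.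
by rewrite (periodicn (@sinD2pi R)).
Qed.

Lemma sum_cosB (K : finType) (a th : K -> R) :
  \sum_i \sum_j a i * a j * cos (th i - th j) =
  (\sum_i a i * cos (th i)) ^+ 2 + (\sum_i a i * sin (th i)) ^+ 2.
Proof.
rewrite !expr2 !mulr_suml -big_split /=; apply: eq_bigr => i _.
rewrite !mulr_sumr -big_split /=; apply: eq_bigr => j _.
by rewrite cosB; ring.
Qed.
End Trigonometry.

Section BorelSpace.
Context {R : realType} {d : nat}.

Lemma continuous_borel (g : 'rV[R]_d -> R) : continuous g ->
  measurable_fun setT (g : borel R d -> R).
Proof.
move=> cg; apply: (measurability _ (RGenOInfty.measurableE R)) => //.
move=> _ [_ [c ->] <-]; rewrite setTI.
apply: sub_sigma_algebra; move/continuousP: cg; apply.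
rewrite (_ : `]c, +oo[%classic = [set x | c < x]); first exact: open_gt.
by apply/seteqP; split => x /=; rewrite in_itv/= andbT.
Qed.

Lemma continuous_coord (l : 'I_d) : continuous (fun x : 'rV[R]_d => x 0 l).
Proof. exact: coord_continuous. Qed.

Lemma measurable_coord (l : 'I_d) : measurable_fun setT (fun x : borel R d => (x : 'rV[R]_d) 0 l).
Proof. by apply: continuous_borel; exact: continuous_coord. Qed.

Lemma measurable_dot (y : 'rV[R]_d) : measurable_fun setT (fun x : borel R d => dot (x : 'rV[R]_d) y).
Proof.
apply: (@measurable_sum _ _ _ _ _ _ (fun (l : 'I_d) (x : borel R d) => (x : 'rV[R]_d) 0 l * y 0 l)) => l.
by apply: measurable_funM => //; exact: measurable_coord.
Qed.

Lemma measurable_enorm : measurable_fun setT (fun x : borel R d => enorm (x : 'rV[R]_d)).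
Proof.
apply: (@measurableT_comp _ _ _ _ _ _ (@Num.sqrt R) _ (fun x : borel R d => dot (x : 'rV[R]_d) x)).
  by apply: continuous_measurable_fun => x; exact: sqrt_continuous.
apply: (@measurable_sum _ _ _ _ _ _ (fun (l : 'I_d) (x : borel R d) => (x : 'rV[R]_d) 0 l * (x : 'rV[R]_d) 0 l)) => l.
by apply: measurable_funM => //; exact: measurable_coord.
Qed.

Lemma measurable_eball (r : R) : measurable (eball r : set (borel R d)).
Proof.
have := measurable_enorm measurableT `]-oo, r]%classic (measurable_itv _).
by rewrite setTI; congr measurable.
Qed.

End BorelSpace.

(** * Selection of dyadic cubes of bounded density *)

Section DyadicCubes.
Context {R : realType} {d : nat}.
Hypothesis d_gt0 : (0 < d)%N.
Variable z : 'rV[R]_d.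

Definition dyadic_index (p : nat) := {ffun 'I_d -> 'I_(2 ^ p)}.

Definition dyadic_corner p (k : dyadic_index p) : 'rV[R]_d :=
  \row_l (z 0 l + (k l)%:R / 2 ^+ p).

Definition dyadic_cube p (k : dyadic_index p) : set (borel R d) :=
  [set x : 'rV[R]_d | forall l,
     z 0 l + (k l)%:R / 2 ^+ p <= x 0 l < z 0 l + (k l).+1%:R / 2 ^+ p].

Definition dyadic_volume (p : nat) : R := (2 ^+ p)^-1 ^+ d.

Lemma dyadic_volume_gt0 p : 0 < dyadic_volume p.
Proof. by rewrite exprn_gt0// invr_gt0 exprn_gt0. Qed.

Let pow_gt0 p : 0 < 2 ^+ p :> R. Proof. exact: exprn_gt0. Qed.

Lemma dyadic_cubeP p (k : dyadic_index p) (x : 'rV[R]_d) : dyadic_cube p k x <->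
  forall l, (k l)%:R <= (x 0 l - z 0 l) * 2 ^+ p < (k l).+1%:R.
Proof.
by split => h l; have := h l; rewrite -lerBrDl ler_pdivrMr// -ltrBlDl ltr_pdivlMr.
Qed.

Lemma measurable_dyadic_cube p (k : dyadic_index p) : measurable (dyadic_cube p k).
Proof.
apply: (measurable_forall (fun (l : 'I_d) => [set x : borel R d |
  z 0 l + (k l)%:R / 2 ^+ p <= (x : 'rV[R]_d) 0 l < z 0 l + (k l).+1%:R / 2 ^+ p])) => l.
have := measurable_coord l measurableT
  `[z 0 l + (k l)%:R / 2 ^+ p, z 0 l + (k l).+1%:R / 2 ^+ p[%classic (measurable_itv _).
by rewrite setTI; congr measurable.
Qed.

Lemma dyadic_cube_inj p (k k' : dyadic_index p) (x : 'rV[R]_d) :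
  dyadic_cube p k x -> dyadic_cube p k' x -> k = k'.
Proof.
move=> /dyadic_cubeP h /dyadic_cubeP h'; apply/ffunP => l; apply/val_inj => /=.
have /andP[a b] := h l; have /andP[a' b'] := h' l.
have := le_lt_trans a b'; have := le_lt_trans a' b.
by rewrite !ltr_nat !ltnS => ? ?; apply/eqP; rewrite eqn_leq; apply/andP.
Qed.

Lemma dyadic_cube_nested p q (k : dyadic_index p) (k' : dyadic_index q) (x y : 'rV[R]_d) :
  (q <= p)%N -> dyadic_cube p k x -> dyadic_cube p k y -> dyadic_cube q k' x ->
  dyadic_cube q k' y.
Proof.
move=> qp /dyadic_cubeP hx /dyadic_cubeP hy /dyadic_cubeP hx'; apply/dyadic_cubeP => l.
have /andP[a b] := hx l; have /andP[a1 b1] := hy l; have /andP[a2 b2] := hx' l.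
have E (u : R) : u * 2 ^+ p = u * 2 ^+ q * 2 ^+ (p - q).
  by rewrite -mulrA -exprD subnKC.
have e0 := pow_gt0 (p - q).
have c1 : (k' l * 2 ^ (p - q) <= k l)%N.
  rewrite -ltnS -(@ltr_nat R) natrM natrX; apply: le_lt_trans b.
  by rewrite E ler_pM2r.
have c2 : ((k l).+1 <= (k' l).+1 * 2 ^ (p - q))%N.
  rewrite -(@ltr_nat R) natrM natrX; apply: (le_lt_trans a).
  by rewrite E ltr_pM2r.
have e1 : 2 ^+ (p - q) = (2 ^ (p - q))%:R :> R by rewrite natrX.
apply/andP; split.
  by rewrite -(ler_pM2r e0) -E e1 -natrM; apply: le_trans a1; rewrite ler_nat.
by rewrite -(ltr_pM2r e0) -E e1 -natrM; apply: (lt_le_trans b1); rewrite ler_nat.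
Qed.

Definition unit_cube : set (borel R d) :=
  [set x : 'rV[R]_d | forall l, z 0 l <= x 0 l < z 0 l + 1].

Lemma measurable_unit_cube : measurable unit_cube.
Proof.
apply: (measurable_forall (fun (l : 'I_d) => [set x : borel R d |
  z 0 l <= (x : 'rV[R]_d) 0 l < z 0 l + 1])) => l.
have := measurable_coord l measurableT `[z 0 l, z 0 l + 1[%classic (measurable_itv _).
by rewrite setTI; congr measurable.
Qed.

Lemma unit_cube_dyadic p (x : 'rV[R]_d) : unit_cube x -> exists k, dyadic_cube p k x.
Proof.
move=> ux.
have h l : exists k : 'I_(2 ^ p), k%:R <= (x 0 l - z 0 l) * 2 ^+ p < k.+1%:R.
  have /andP[x0 x1] := ux l.
  pose t := (x 0 l - z 0 l) * 2 ^+ p.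
  have t0 : 0 <= t by rewrite mulr_ge0 ?subr_ge0// ltW.
  have tr := truncn_itv t0.
  have tp : (Num.truncn t < 2 ^ p)%N.
    rewrite -(@ltr_nat R) natrX; have /andP[+ _] := tr => /le_lt_trans; apply.
    by rewrite -[ltRHS]mul1r ltr_pM2r//; lra.
  by exists (Ordinal tp).
exists [ffun l => projT1 (cid (h l))]; apply/dyadic_cubeP => l.
by rewrite ffunE; case: cid.
Qed.

Variable nu : {measure set (borel R d) -> \bar R}.

Section Bad.
Variable c : R.
Hypothesis c_gt0 : 0 < c.

Definition bad_cube p (k : dyadic_index p) : Prop :=
  ((c * dyadic_volume p)%:E < nu (dyadic_cube p k))%E.

Definition cube_code := {p : nat & dyadic_index p}.

(* Empty unless the cube t is bad and inside no larger bad cube. *)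
Definition maximal_bad (t : cube_code) : set (borel R d) :=
  [set x : 'rV[R]_d | [/\ dyadic_cube (tag t) (tagged t) x, bad_cube _ (tagged t) &
     forall q (k' : dyadic_index q), (q < tag t)%N -> dyadic_cube q k' x -> ~ bad_cube q k']].

Lemma maximal_badE (t : cube_code) : maximal_bad t !=set0 ->
  maximal_bad t = dyadic_cube (tag t) (tagged t).
Proof.
case: t => p k /= [x [/= kx bk mk]]; apply/seteqP; split => y /=; first by case.
move=> ky; split => //= q k' qp k'y; apply: mk => //.
exact: dyadic_cube_nested (ltnW qp) ky kx k'y.
Qed.

Lemma measurable_maximal_bad t : measurable (maximal_bad t).
Proof.
have [/maximal_badE ->|/nonemptyPn ->] := pselect (maximal_bad t !=set0).
  exact: measurable_dyadic_cube.
exact: measurable0.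
Qed.

Lemma maximal_bad_inj t t' x : maximal_bad t x -> maximal_bad t' x -> t = t'.
Proof.
case: t t' => p k [p' k'] [/= kx bk mk] [/= k'x bk' mk'].
have pp : p = p'.
  have [h|h|//] := ltngtP p p'; first by case: (mk' _ _ h kx bk).
  by case: (mk _ _ h k'x bk').
move: k' k'x bk' mk'; rewrite -pp => k' k'x _ _.
by rewrite (dyadic_cube_inj _ _ _ _ kx k'x).
Qed.

Lemma bad_cube_maximal p (k : dyadic_index p) x : bad_cube p k -> dyadic_cube p k x ->
  exists t, maximal_bad t x.
Proof.
move=> bk kx; pose Q q := `[< exists2 k' : dyadic_index q, bad_cube q k' & dyadic_cube q k' x >].
have exQ : exists q, Q q by exists p; apply/asboolP; exists k.
case: (ex_minnP exQ) => q /asboolP[k' bk' k'x] qmin.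
exists (Tagged _ k'); split => //= q' k'' lt k''x bk''.
have : (q <= q')%N by apply: qmin; apply/asboolP; exists k''.
by rewrite leqNgt lt.
Qed.

Definition maximal_bad_nat (m : nat) : set (borel R d) :=
  if pickle_inv m is Some t then maximal_bad t else set0.

Lemma measurable_maximal_bad_nat m : measurable (maximal_bad_nat m).
Proof.
rewrite /maximal_bad_nat; case: pickle_inv => [t|]; [exact: measurable_maximal_bad|exact: measurable0].
Qed.

Definition bad_set : set (borel R d) := \bigcup_m maximal_bad_nat m.

Lemma measurable_bad_set : measurable bad_set.
Proof. by apply: bigcupT_measurable => m; exact: measurable_maximal_bad_nat. Qed.

Lemma bad_setP p (k : dyadic_index p) x : bad_cube p k -> dyadic_cube p k x -> bad_set x.
Proof.
move=> bk kx; have [t tx] := bad_cube_maximal p k x bk kx.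
by exists (pickle t) => //; rewrite /maximal_bad_nat pickleK_inv.
Qed.

Lemma trivIset_maximal_bad : trivIset setT maximal_bad_nat.
Proof.
apply/trivIsetP => m m' _ _ mm'; apply/seteqP; split => // x [].
rewrite /maximal_bad_nat.
case E : (pickle_inv m) => [t|//]; case E' : (pickle_inv m') => [t'|//] tx t'x.
have tt' := maximal_bad_inj _ _ _ tx t'x; case/eqP: mm'.
have := @pickle_invK cube_code m; rewrite E /=.
have := @pickle_invK cube_code m'; rewrite E' /= tt' => -> .
by move=> ->.
Qed.

(** The maximal bad cubes are disjoint, cover the bad set, and each has volume less than its nu-mass
    divided by c. *)
Lemma lebesgue_bad_set (A : set 'rV[R]_d) : A `<=` bad_set ->
  (lebesgue A <= c^-1%:E * nu setT)%E.
Proof.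
move=> Asub.
(* Codes without a maximal bad cube get the degenerate box at 0, of volume 0 because d > 0. *)
pose box_of m : 'rV[R]_d * 'rV[R]_d := if pickle_inv m is Some t then
    if `[< maximal_bad t !=set0 >] then (dyadic_corner _ (tagged t),
      \row_l (z 0 l + (tagged t l).+1%:R / 2 ^+ (tag t))) else (0, 0)
  else (0, 0).
have vol m : ((\prod_i ((box_of m).2 0 i - (box_of m).1 0 i))%:E <=
    c^-1%:E * nu (maximal_bad_nat m))%E.
  have z0 : (\prod_(i < d) ((0 : 'rV[R]_d) 0 i - (0 : 'rV[R]_d) 0 i)) = 0.
    by rewrite (bigD1 (Ordinal d_gt0))//= mxE subrr mul0r.
  have r0 B : (0 <= c^-1%:E * nu B)%E by rewrite mule_ge0// lee_fin invr_ge0 ltW.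
  rewrite /box_of /maximal_bad_nat; case: pickle_inv => [t|]; last by rewrite z0.
  case: asboolP => [ne|_]; last by rewrite z0.
  rewrite maximal_badE// (eq_bigr (fun=> (2 ^+ tag t)^-1)) => [|l _]; last first.
    by rewrite !mxE -natr1 mulrDl mul1r; ring.
  rewrite prodr_const card_ord -/(dyadic_volume _).
  have [x [_ + _]] := ne; rewrite /bad_cube => /ltW h.
  rewrite -(@lee_pmul2l _ c%:E)// ?lte_fin// muleA -!EFinM divff ?gt_eqF// mul1e.
  exact: h.
apply: (@le_trans _ _ (\sum_(0 <= m <oo) (\prod_i ((box_of m).2 0 i - (box_of m).1 0 i))%:E)%E).
  apply: ereal_inf_lbound; exists (fun m => (box_of m).1), (fun m => (box_of m).2).
  split => //.
    move=> m i; rewrite /box_of; case: pickle_inv => [t|//]; case: asboolP => //= _.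
    by rewrite !mxE lerD2l ler_pM2r ?invr_gt0// ler_nat.
  move=> x /Asub[m _ mx]; exists m => // i; move: mx.
  rewrite /maximal_bad_nat /box_of; case: pickle_inv => [t|//] tx.
  rewrite asboolT; last by exists x.
  by case: tx => + _ _ => /(_ i) /andP[h1 h2]; rewrite /= !mxE h1 ltW.
apply: (@le_trans _ _ (\sum_(0 <= m <oo) (c^-1%:E * nu (maximal_bad_nat m)))%E).
  apply: lee_nneseries => // m _; rewrite lee_fin prodr_ge0// => i _.
  rewrite /box_of; case: pickle_inv => [t|/=]; last by rewrite subrr.
  case: asboolP => /= _; last by rewrite subrr.
  by rewrite !mxE subr_ge0 lerD2l ler_pM2r ?invr_gt0// ler_nat.
rewrite nneseriesZl//.
rewrite lee_wpmul2l ?lee_fin ?invr_ge0 ?(ltW c_gt0)//.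
have <- : nu bad_set = (\sum_(0 <= m <oo) nu (maximal_bad_nat m))%E.
  apply: measure_semi_bigcup => [m||]; first exact: measurable_maximal_bad_nat.
    exact: trivIset_maximal_bad.
  exact: measurable_bad_set.
by apply: le_measure; rewrite ?inE//; exact: measurable_bad_set.
Qed.

End Bad.

Hypothesis nu_fin : fin_num_fun nu.
Hypothesis nu_ac : forall A : set (borel R d), measurable A -> lebesgue A = 0%E -> nu A = 0%E.
Hypothesis nu_unit_cube : (0 < nu unit_cube)%E.

Lemma lebesgue_ge0 (A : set 'rV[R]_d) : (0 <= lebesgue A)%E.
Proof.
apply: le_ereal_inf_tmp => _ [a [b [ab _ ->]]].
apply: nneseries_ge0 => n _ _; rewrite lee_fin prodr_ge0// => i _.
by rewrite subr_ge0.
Qed.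

(** E plays the part of a sublevel set of the density of nu. The bad sets decrease to a Lebesgue
    null set, hence nu-null, so some bad set leaves mass in the unit cube; off it, a dyadic cube is
    either not bad or disjoint from E. *)
Lemma exists_small_cubes : exists (c : R) (E : set (borel R d)), [/\ 0 < c, measurable E,
  E `<=` unit_cube, (0 < nu E)%E &
  forall p (k : dyadic_index p), (nu (E `&` dyadic_cube p k) <= (c * dyadic_volume p)%:E)%E].
Proof.
pose B (n : nat) := bad_set n.+1%:R.
have mB n : measurable (B n) by exact: measurable_bad_set.
have Bdec n m : (n <= m)%N -> B m `<=` B n.
  move=> nm x [i _]; rewrite /maximal_bad_nat; case: pickle_inv => [t|//] [kx bk _].
  apply: bad_setP kx; apply: le_lt_trans bk.
  by rewrite lee_fin ler_pM2r ?dyadic_volume_gt0// ler_nat.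
have leb0 : lebesgue (\bigcap_n B n) = 0%E.
  apply/eqP; rewrite eq_le lebesgue_ge0 andbT.
  apply/lee_addgt0Pr => e e0; rewrite add0e.
  have fin : nu setT \is a fin_num by exact: nu_fin.
  pose n := Num.truncn (fine (nu setT) / e).
  have := lebesgue_bad_set n.+1%:R (ltr0Sn _ _) (\bigcap_n B n) (bigcap_inf (i := n) Logic.I).
  move=> /le_trans; apply; rewrite -(fineK fin) -EFinM lee_fin ler_pdivrMl//.
  rewrite -ler_pdivrMr// ltW//; exact: truncnS_gt.
have nu0 : nu (\bigcap_n B n) = 0%E by apply: nu_ac => //; exact: bigcapT_measurable.
have cv : (nu (B n) @[n --> \oo] --> 0)%E.
  rewrite -nu0; apply: nonincreasing_cvg_mu => //.
  - by rewrite ltey_eq nu_fin.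
  - exact: bigcapT_measurable.
  - by move=> n m nm; apply/subsetPset; exact: Bdec.
have finU : nu unit_cube \is a fin_num by apply: nu_fin; exact: measurable_unit_cube.
have [n hn] : exists n, (nu (B n) < nu unit_cube)%E.
  apply: contrapT => /forallNP H; move: nu_unit_cube; rewrite ltNge; apply/negP/negPn.
  rewrite -(cvg_lim _ cv)//; apply: lime_ge; first by apply/cvg_ex; eexists; exact: cv.
  by apply: nearW => n; rewrite leNgt; apply/negP; exact: H.
exists n.+1%:R, (unit_cube `\` B n); split => //.
- by apply: measurableD => //; exact: measurable_unit_cube.
- rewrite measureD//; last 2 first.
  - exact: measurable_unit_cube.
  - by rewrite ltey_eq finU.
  rewrite sube_gt0; apply: le_lt_trans hn.
  by apply: le_measure; rewrite ?inE//; apply: measurableI => //; exact: measurable_unit_cube.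
move=> p k.
have [bk|nbk] := pselect (bad_cube n.+1%:R p k).
  have -> : (unit_cube `\` B n) `&` dyadic_cube p k = set0.
    by apply/seteqP; split => // x [[_ nB] kx]; apply: nB; exact: bad_setP bk kx.
  by rewrite measure0 lee_fin mulr_ge0// ltW// dyadic_volume_gt0.
have : (nu (dyadic_cube p k) <= (n.+1%:R * dyadic_volume p)%:E)%E.
  by rewrite leNgt; apply/negP.
apply: le_trans; apply: le_measure; rewrite ?inE//.
- apply: measurableI; last exact: measurable_dyadic_cube.
  by apply: measurableD => //; exact: measurable_unit_cube.
- exact: measurable_dyadic_cube.
Qed.

End DyadicCubes.

(** * Trigonometric polynomials indexed by an integer box *)

Section BoxExponentials.
Context {R : realType} {d : nat}.
Implicit Types x y : 'rV[R]_d.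

Lemma dotC x y : dot x y = dot y x.
Proof. by apply: eq_bigr => i _; rewrite mulrC. Qed.

Lemma dotDl x x' y : dot (x + x') y = dot x y + dot x' y.
Proof. by rewrite /dot -big_split; apply: eq_bigr => i _; rewrite /= mxE mulrDl. Qed.

Lemma dotDr x y y' : dot x (y + y') = dot x y + dot x y'.
Proof. by rewrite dotC dotDl !(dotC x). Qed.

Lemma dotNl x y : dot (- x) y = - dot x y.
Proof. by rewrite /dot -sumrN; apply: eq_bigr => i _; rewrite mxE mulNr. Qed.

Lemma dotNr x y : dot x (- y) = - dot x y.
Proof. by rewrite dotC dotNl dotC. Qed.

Lemma dotBr x y y' : dot x (y - y') = dot x y - dot x y'.
Proof. by rewrite dotDr dotNr. Qed.

Lemma dotBl x x' y : dot (x - x') y = dot x y - dot x' y.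
Proof. by rewrite dotDl dotNl. Qed.

Variable n : nat.

Definition box_point (i : {ffun 'I_d -> 'I_n}) : 'rV[R]_d := \row_l (i l)%:R.

Implicit Types (a : {ffun 'I_d -> 'I_n} -> R).

(** The square modulus of the trigonometric polynomial with coefficients a, as [box_polyE] makes
    explicit. *)
Definition box_poly a x : R :=
  qform (fun i j => cos (2 * pi * dot x (box_point i - box_point j))) a.

Lemma box_polyE a x : box_poly a x =
  (\sum_i a i * cos (2 * pi * dot x (box_point i))) ^+ 2 +
  (\sum_i a i * sin (2 * pi * dot x (box_point i))) ^+ 2.
Proof.
rewrite -sum_cosB; apply: eq_bigr => i _; apply: eq_bigr => j _.
by rewrite dotBr mulrBr.
Qed.

Lemma box_poly_ge0 a x : 0 <= box_poly a x.
Proof. by rewrite box_polyE addr_ge0 ?sqr_ge0. Qed.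

Lemma measurable_box_poly a : measurable_fun setT (box_poly a : borel R d -> R).
Proof.
apply: (@measurable_sum _ _ _ _ _ _ (fun i (x : borel R d) =>
  \sum_j a i * a j * cos (2 * pi * dot (x : 'rV[R]_d) (box_point i - box_point j)))) => i.
apply: (@measurable_sum _ _ _ _ _ _ (fun j (x : borel R d) =>
  a i * a j * cos (2 * pi * dot (x : 'rV[R]_d) (box_point i - box_point j)))) => j.
apply: measurable_funM => //; apply: (@measurableT_comp _ _ _ _ _ _ (@cos R)).
  by apply: continuous_measurable_fun; exact: continuous_cos.
by apply: measurable_funM => //; exact: measurable_dot.
Qed.

Lemma box_poly_lipschitz a : exists2 lip : R, 0 <= lip & forall x y (e : R),
  (forall l, `|x 0 l - y 0 l| <= e) -> box_poly a x <= box_poly a y + lip * e.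
Proof.
pose lip := \sum_i \sum_j `|a i * a j| * (2 * pi * \sum_l `|(box_point i - box_point j) 0 l|).
have pi2 : 0 <= 2 * pi :> R by rewrite mulr_ge0// pi_ge0.
exists lip.
  apply: sumr_ge0 => i _; apply: sumr_ge0 => j _.
  by apply: mulr_ge0 => //; apply: mulr_ge0 => //; exact: sumr_ge0.
move=> x y e xye; rewrite -lerBlDl /box_poly /qform -sumrB /lip mulr_suml.
apply: ler_sum => i _; rewrite -sumrB mulr_suml; apply: ler_sum => j _.
rewrite -mulrBr; apply: (le_trans (ler_norm _)); rewrite normrM -[leRHS]mulrA ler_wpM2l//.
apply: (le_trans (dist_cos_le _ _)).
rewrite -mulrBr -dotBl normrM (ger0_norm pi2) -[leRHS]mulrA ler_wpM2l//.
apply: (le_trans (ler_norm_sum _ _ _)); rewrite mulr_suml; apply: ler_sum => l _.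
by rewrite normrM mulrC ler_wpM2l// !mxE.
Qed.

Section Grid.
Variables (z : 'rV[int]_d) (p : nat).
Hypothesis np : (n <= 2 ^ p)%N.
Let zR : 'rV[R]_d := map_mx intr z.

Let grid (k : dyadic_index p) : 'rV[R]_d := @dyadic_corner R d zR p k.

(** In a direction l where i and j differ, the cyclic shift of the grid rotates the vector (cosine
    sum, sine sum) by the angle alpha. As n <= 2^p, alpha is not a multiple of 2 pi, and a vector
    fixed by a nontrivial rotation is 0. *)
Lemma grid_orthogonality (i j : {ffun 'I_d -> 'I_n}) :
  \sum_k cos (2 * pi * dot (grid k) (box_point i - box_point j)) =
  (i == j)%:R * (2 ^+ p) ^+ d.
Proof.
have [->|ij] := eqVneq i j.
  rewrite mul1r (eq_bigr (fun=> 1)) => [|k _]; last first.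
    rewrite subrr /dot big1 => [|l _]; last by rewrite !mxE mulr0.
    by rewrite mulr0 cos0.
  by rewrite sumr_const card_ffun !card_ord !natrX.
rewrite mul0r.
have [l ijl] : exists l, i l != j l.
  apply: contrapT => /forallNP H; case/eqP: ij; apply/ffunP => l.
  by apply/eqP; apply: contrapT => /negP; exact: H.
pose v := box_point i - box_point j.
pose M := (2 ^ p)%N; have M0 : (0 < M)%N by rewrite expn_gt0.
pose alpha : R := 2 * pi * ((i l)%:R - (j l)%:R) / M%:R.
pose shift (k : dyadic_index p) : dyadic_index p := [ffun l' => if l' == l then ordS (k l') else k l'].
have shift_inj : injective shift.
  move=> k k' /ffunP kk; apply/ffunP => l'; have := kk l'; rewrite !ffunE.
  by case: ifP => // _; apply: (can_inj (@ordSK _)).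
have dot_shift k : dot (grid (shift k)) v = dot (grid k) v +
    (((shift k l)%:R - (k l)%:R) / M%:R) * ((i l)%:R - (j l)%:R).
  rewrite /dot (bigD1 l)//= [X in _ = X + _](bigD1 l)//=.
  rewrite (eq_bigr (fun l' => grid k 0 l' * v 0 l')) => [|l' /negbTE ll'].
    by rewrite !mxE natrX; ring.
  by rewrite !mxE ffunE ll'.
have trig_shift k : cos (2 * pi * dot (grid (shift k)) v) = cos (2 * pi * dot (grid k) v + alpha) /\
    sin (2 * pi * dot (grid (shift k)) v) = sin (2 * pi * dot (grid k) v + alpha).
  have MR : M%:R != 0 :> R by rewrite pnatr_eq0 -lt0n.
  rewrite dot_shift /shift ffunE eqxx /=.
  have [kM|kM] := ltnP (k l).+1 M.
    rewrite modn_small// -(natr1 (k l)) /alpha.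
    have -> : 2 * pi * (dot (grid k) v + ((k l)%:R + 1 - (k l)%:R) / M%:R * ((i l)%:R - (j l)%:R)) =
      2 * pi * dot (grid k) v + 2 * pi * ((i l)%:R - (j l)%:R) / M%:R by ring.
    by [].
  (* Wrapping around moves the coordinate by a full unit, which changes the phase by 2 pi times the
     integer i l - j l. *)
  have kE : ((k l).+1 = M)%N by apply/eqP; rewrite eqn_leq kM andbT; exact: ltn_ord.
  rewrite kE modnn.
  have kR : (k l)%:R = M%:R - 1 :> R by rewrite -kE -natr1 addrK.
  have -> : 2 * pi * dot (grid k) v + alpha = 2 * pi * (dot (grid k) v +
      (0%:R - (k l)%:R) / M%:R * ((i l)%:R - (j l)%:R)) + 2 * pi * (i l)%:R - 2 * pi * (j l)%:R.
    by rewrite kR /alpha; field.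
  set th := 2 * pi * (_ + _).
  have := cosD2piM (th + 2 * pi * (i l)%:R - 2 * pi * (j l)%:R) (j l).
  have := sinD2piM (th + 2 * pi * (i l)%:R - 2 * pi * (j l)%:R) (j l).
  by rewrite !subrK cosD2piM sinD2piM.
pose S := \sum_k cos (2 * pi * dot (grid k) v).
pose S' := \sum_k sin (2 * pi * dot (grid k) v).
have ES : S = cos alpha * S - sin alpha * S'.
  rewrite {1}/S (reindex_inj shift_inj) /= !mulr_sumr -sumrB; apply: eq_bigr => k _.
  by rewrite (trig_shift k).1 cosD; ring.
have ES' : S' = sin alpha * S + cos alpha * S'.
  rewrite {1}/S' (reindex_inj shift_inj) /= !mulr_sumr -big_split; apply: eq_bigr => k _.
  by rewrite (trig_shift k).2 sinD /=; ring.
have cosN1 : cos alpha != 1.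
  apply/eqP => c1.
  have pi0 := pi_gt0 R.
  have M0R : 0 < M%:R :> R by rewrite ltr0n.
  have a2 : `|alpha / 2| < pi.
    have -> : alpha / 2 = pi * (((i l)%:R - (j l)%:R) / M%:R) by rewrite /alpha; field; rewrite gt_eqF.
    rewrite normrM gtr0_norm// -[ltRHS]mulr1 ltr_pM2l// normrM [X in _ * X]gtr0_norm ?invr_gt0//.
    rewrite ltr_pdivrMr// mul1r ltr_norml.
    have iM : (i l < M)%N by apply: leq_trans np.
    have jM : (j l < M)%N by apply: leq_trans np.
    rewrite -(@ltr_nat R) in iM; rewrite -(@ltr_nat R) in jM.
    by have := ler0n R (i l); have := ler0n R (j l); lra.
  have aN0 : alpha / 2 != 0.
    have ij0 : (i l)%:R - (j l)%:R != 0 :> R by rewrite subr_eq0 eqr_nat.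
    by rewrite /alpha !mulf_neq0 ?ij0// ?invr_eq0 ?gt_eqF.
  have := one_sub_cosE alpha; rewrite c1 subrr => /esym/eqP.
  rewrite mulf_eq0 pnatr_eq0 /= sqrf_eq0 => /eqP s0.
  have [h|h|h] := ltrgtP (alpha / 2) 0.
  - have := @sin_gt0_pi R (- (alpha / 2)); rewrite sinN s0 oppr0 ltxx => /(_ _)/wrap[]//.
    by rewrite oppr_gt0 h /= -(ltr0_norm h).
  - have := @sin_gt0_pi R (alpha / 2); rewrite s0 ltxx => /(_ _)/wrap[]//.
    by rewrite h /= -(gtr0_norm h).
  - by rewrite h eqxx in aN0.
rewrite -/v -/S.
(* The first factor is the determinant of the identity minus the rotation. *)
have : ((1 - cos alpha) ^+ 2 + sin alpha ^+ 2) * S = 0.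
  have e1 : (1 - cos alpha) * S = - sin alpha * S' by lra.
  have e2 : sin alpha * S = (1 - cos alpha) * S' by lra.
  have -> : ((1 - cos alpha) ^+ 2 + sin alpha ^+ 2) * S =
    (1 - cos alpha) * ((1 - cos alpha) * S) + sin alpha * (sin alpha * S) by ring.
  by rewrite e1 e2; ring.
move/eqP; rewrite mulf_eq0 => /orP[|/eqP//].
rewrite paddr_eq0 ?sqr_ge0// !sqrf_eq0 subr_eq0 eq_sym => /andP[c1 _].
by rewrite c1 in cosN1.
Qed.

Lemma sum_grid_box_poly a :
  \sum_k box_poly a (grid k) * @dyadic_volume R d p = \sum_i a i ^+ 2.
Proof.
rewrite -mulr_suml /box_poly /qform exchange_big /=.
under eq_bigr do rewrite exchange_big /=.
have E i j : \sum_k a i * a j * cos (2 * pi * dot (grid k) (box_point i - box_point j)) =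
    a i * a j * ((i == j)%:R * (2 ^+ p) ^+ d).
  by rewrite -mulr_sumr grid_orthogonality.
under eq_bigr do under eq_bigr do rewrite E.
rewrite mulr_suml; apply: eq_bigr => i _.
rewrite (bigD1 i)//= eqxx big1 ?addr0 => [|j /negbTE ji]; last first.
  by rewrite eq_sym ji mul0r mulr0.
by rewrite /dyadic_volume mul1r -mulrA exprVn mulfV ?mulr1 ?expr2// !expf_neq0.
Qed.

End Grid.

(** A Riemann sum: on each small cube the polynomial is its corner value up to a Lipschitz error,
    and the cube carries nu-mass at most c times its volume on E. The corner sum is given exactly by
    the discrete Parseval identity [sum_grid_box_poly]; the error vanishes with the mesh. *)
Lemma bessel_box (z : 'rV[int]_d) (nu : {finite_measure set (borel R d) -> \bar R})
    (E : set (borel R d)) (c : R) :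
  0 < c -> measurable E -> E `<=` unit_cube (map_mx intr z) ->
  (forall p (k : dyadic_index p),
     (nu (E `&` dyadic_cube (map_mx intr z) p k) <= (c * @dyadic_volume R d p)%:E)%E) ->
  forall a, (\int[nu]_(x in E) (box_poly a x)%:E <= (c * \sum_i a i ^+ 2)%:E)%E.
Proof.
move=> c0 mE EU Ec a; have [lip lip0 hlip] := box_poly_lipschitz a.
apply/lee_addgt0Pr => e e0.
have [p [np pe]] : exists p, (n <= 2 ^ p)%N /\ c * (lip * (2 ^+ p)^-1) <= e.
  pose N := (n + Num.truncn (lip * c / e)).+1.
  exists N; split.
    by apply: (leq_trans _ (ltnW (ltn_expl N (ltnSn 1)))); rewrite /N -addnS leq_addr.
  have h : lip * c / e <= 2 ^+ N.
    apply: (@le_trans _ _ N%:R); last by rewrite -natrX ler_nat ltnW// ltn_expl.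
    by apply: ltW; apply: (lt_le_trans (truncnS_gt _)); rewrite ler_nat /N ltnS leq_addl.
  rewrite mulrA ler_pdivrMr ?exprn_gt0// [c * _]mulrC.
  by move: h; rewrite ler_pdivrMr// [e * _]mulrC.
pose zR : 'rV[R]_d := map_mx intr z.
pose g (k : dyadic_index p) := box_poly a (@dyadic_corner R d zR p k) + lip * (2 ^+ p)^-1.
have g0 k : 0 <= g k by rewrite addr_ge0 ?box_poly_ge0// mulr_ge0// invr_ge0 exprn_ge0.
have mcube k : measurable (dyadic_cube zR p k) by exact: measurable_dyadic_cube.
apply: (@le_trans _ _ (\int[nu]_(x in E) (\sum_k (g k)%:E * (\1_(dyadic_cube zR p k) x)%:E))%E).
  apply: ge0_le_integral => //.
  - by move=> x _; rewrite lee_fin box_poly_ge0.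
  - by apply/measurable_EFinP; apply: measurable_funTS; exact: measurable_box_poly.
  - apply: emeasurable_sum => k; apply: emeasurable_funM => //.
    by apply/measurable_EFinP; exact: measurable_indic.
  - move=> x Ex; have [k kx] := unit_cube_dyadic zR p x (EU x Ex).
    rewrite (bigD1 k)//= indicE mem_set// mule1 -[leLHS]adde0 leeD//.
      rewrite lee_fin; apply: hlip => l; have /andP[h1 h2] := kx l.
      rewrite !mxE in h1 h2 *; rewrite ger0_norm; last by rewrite subr_ge0.
      by move: h2; rewrite -(natr1 (k l)) mulrDl mul1r; lra.
    by apply: sume_ge0 => k' _; rewrite mule_ge0 ?lee_fin.
rewrite ge0_integral_sum//; last 2 first.
- move=> k; apply: emeasurable_funM => //.
  by apply/measurable_EFinP; exact: measurable_indic.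
- by move=> k x _; rewrite mule_ge0 ?lee_fin.
apply: (@le_trans _ _ (\sum_k ((g k)%:E * (c * @dyadic_volume R d p)%:E))%E).
  apply: lee_sum => k _; rewrite ge0_integralZl ?lee_fin//; last first.
    by apply/measurable_EFinP; exact: measurable_indic.
  by rewrite integral_indic// lee_wpmul2l ?lee_fin// setIC; exact: Ec.
rewrite sumEFin -EFinD lee_fin /g.
have -> : \sum_k (box_poly a (dyadic_corner zR p k) + lip / 2 ^+ p) * (c * @dyadic_volume R d p) =
    c * \sum_k box_poly a (dyadic_corner zR p k) * @dyadic_volume R d p +
    c * (lip / 2 ^+ p) * \sum_(k : @dyadic_index d p) @dyadic_volume R d p.
  rewrite !mulr_sumr -big_split; apply: eq_bigr => k _ /=; ring.
rewrite sum_grid_box_poly// sumr_const card_ffun !card_ord lerD2l.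
have -> : @dyadic_volume R d p *+ (2 ^ p) ^ d = 1.
  by rewrite -mulr_natl !natrX /dyadic_volume exprVn mulfV// !expf_neq0.
by rewrite mulr1.
Qed.

End BoxExponentials.

(* For the absolutely continuous part of mu, take E outside the maximal dyadic
   cubes of large density and outside the support of the singular part. *)
Lemma exists_bessel_set {R : realType} {d : nat} (d_gt0 : (0 < d)%N)
    (mu : {finite_measure set (borel R d) -> \bar R})
    (nu : {measure set (borel R d) -> \bar R}) :
  is_ac_part mu nu -> nu setT <> 0%E ->
  exists (c : R) (E : set (borel R d)), [/\ 0 < c, measurable E, (0 < mu E)%E &
    forall n (a : {ffun 'I_d -> 'I_n} -> R),
      (\int[mu]_(x in E) (box_poly n a x)%:E <= (c * \sum_i a i ^+ 2)%:E)%E].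
Proof.
move=> [nu_ac [sing [[N [mN N0 singN]] muE]]] nuT.
have nu_le A : measurable A -> (nu A <= mu A)%E.
  by move=> mA; rewrite muE// leeDl.
have nu_fin : fin_num_fun nu.
  move=> A mA; rewrite ge0_fin_numE//; apply: le_lt_trans (nu_le _ mA) _.
  by rewrite ltey_eq fin_num_measure.
have [z hz] : exists z : 'rV[int]_d, (0 < nu (@unit_cube R d (map_mx intr z)))%E.
  apply: contrapT => /forallNP H; apply: nuT.
  pose F (m : nat) := if @pickle_inv 'rV[int]_d m is Some z
    then @unit_cube R d (map_mx intr z) else set0.
  have mF m : measurable (F m).
    by rewrite /F; case: pickle_inv => [z|]; [exact: measurable_unit_cube|exact: measurable0].
  have FT : \bigcup_m F m = setT.
    apply/seteqP; split => // x _; pose z : 'rV[int]_d := \row_l Num.floor ((x : 'rV[R]_d) 0 l).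
    exists (pickle z) => //; rewrite /F pickleK_inv => l; rewrite !mxE.
    by have := floor_itv ((x : 'rV[R]_d) 0 l); rewrite intrD.
  apply/eqP; rewrite eq_le measure_ge0 andbT -FT.
  apply: (le_trans (measure_sigma_subadditive _ mF _ _)) => //.
    by apply: bigcupT_measurable.
  rewrite eseries0// => m _ _; rewrite /F; case: pickle_inv => [z|]; last exact: measure0.
  by apply/eqP; rewrite eq_le measure_ge0 andbT leNgt; apply/negP; exact: H.
have [c [E [c0 mE EU nuE Ec]]] := exists_small_cubes d_gt0 (map_mx intr z) nu nu_fin nu_ac hz.
have nuN : nu N = 0%E by exact: nu_ac.
have mu_nu A : measurable A -> A `<=` ~` N -> mu A = nu A.
  move=> mA AN; rewrite muE//.
  suff -> : sing A = 0%E by rewrite adde0.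
  apply/eqP; rewrite eq_le measure_ge0 andbT -singN.
  by apply: le_measure; rewrite ?inE//; exact: measurableC.
have mEN : measurable (E `\` N) by exact: measurableD.
exists c, (E `\` N); split => //.
  rewrite (mu_nu _ mEN); last by move=> x [].
  apply: (lt_le_trans nuE); rewrite -[leRHS]adde0 -nuN.
  apply: le_trans (measureU2 _ mEN mN); apply: le_measure; rewrite ?inE//.
    exact: measurableU.
  by move=> x Ex; have [Nx|Nx] := pselect (N x); [right|left].
move=> n a; apply: (bessel_box n z) => //.
  by move=> x [/EU].
move=> p k; have mk := @measurable_dyadic_cube R d (map_mx intr z) p k.
rewrite mu_nu; first last.
- by move=> x [[]].
- exact: measurableI.
apply: le_trans (Ec p k); apply: le_measure; rewrite ?inE; try exact: measurableI.
by apply: setSI => x [].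
Qed.

(** * Averaging forms and their spectral energy *)

Section BoundedMeasurable.
Context {disp : measure_display} {T : measurableType disp} {R : realType}.
Implicit Types g h : T -> R.

(** A class stable under the operations used below and integrable for every finite measure, which
    settles integrability of trigonometric expressions from their shape. *)
Definition bounded_measurable g :=
  measurable_fun setT g /\ exists b : R, forall x, `|g x| <= b.

Lemma bounded_measurable_cst (c : R) : bounded_measurable (fun=> c).
Proof. by split; [exact: measurable_cst|exists `|c|]. Qed.

Lemma bounded_measurableD g h : bounded_measurable g -> bounded_measurable h ->
  bounded_measurable (fun x => g x + h x).
Proof.
move=> [mg [b gb]] [mh [b' hb]]; split; first exact: measurable_funD.
by exists (b + b') => x; apply: (le_trans (ler_normD _ _)); exact: lerD.
Qed.

Lemma bounded_measurableM g h : bounded_measurable g -> bounded_measurable h ->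
  bounded_measurable (fun x => g x * h x).
Proof.
move=> [mg [b gb]] [mh [b' hb]]; split; first exact: measurable_funM.
by exists (b * b') => x; rewrite normrM; apply: ler_pM.
Qed.

Lemma bounded_measurableZ (c : R) g : bounded_measurable g ->
  bounded_measurable (fun x => c * g x).
Proof. exact/bounded_measurableM/bounded_measurable_cst. Qed.

Lemma bounded_measurableX g n : bounded_measurable g ->
  bounded_measurable (fun x => g x ^+ n).
Proof.
move=> hg; elim: n => [|n IH]; first exact: (bounded_measurable_cst 1).
rewrite (_ : (fun x => _) = fun x => g x * g x ^+ n); first exact: bounded_measurableM.
by apply/funext => x; rewrite exprS.
Qed.

Lemma bounded_measurable_sum (J : Type) (s : seq J) (g : J -> T -> R) :
  (forall i, bounded_measurable (g i)) -> bounded_measurable (fun x => \sum_(i <- s) g i x).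
Proof.
move=> hg; elim: s => [|i s IH].
  by under eq_fun do rewrite big_nil; exact: bounded_measurable_cst.
by under eq_fun do rewrite big_cons; exact: bounded_measurableD.
Qed.

Lemma bounded_measurable_prod (J : Type) (s : seq J) (g : J -> T -> R) :
  (forall i, bounded_measurable (g i)) -> bounded_measurable (fun x => \prod_(i <- s) g i x).
Proof.
move=> hg; elim: s => [|i s IH].
  by under eq_fun do rewrite big_nil; exact: bounded_measurable_cst.
by under eq_fun do rewrite big_cons; exact: bounded_measurableM.
Qed.

Lemma bounded_measurable_indic (A : set T) : measurable A ->
  bounded_measurable (\1_A : T -> R).
Proof.
move=> mA; split; first exact: measurable_indic.
by exists 1 => x; rewrite indicE; case: (_ \in _); rewrite ?normr1 ?normr0.
Qed.

Variable mu : {finite_measure set T -> \bar R}.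

Lemma bounded_measurable_integrable g : bounded_measurable g ->
  mu.-integrable setT (EFin \o g).
Proof.
move=> [mg [b gb]]; apply: measurable_bounded_integrable => //.
  by rewrite ltey_eq fin_num_measure.
by exists b; split; [exact: num_real|move=> M bM x _; exact: le_trans (gb x) (ltW bM)].
Qed.

Lemma Rintegral_indicT (A : set T) : measurable A ->
  (\int[mu]_x (\1_A x))%R = fine (mu A).
Proof. by move=> mA; rewrite /Rintegral integral_indic// setIT. Qed.

Lemma le_bounded_Rintegral g h : bounded_measurable g -> bounded_measurable h ->
  (forall x, g x <= h x) -> (\int[mu]_x g x)%R <= (\int[mu]_x h x)%R.
Proof. by move=> hg hh gh; apply: le_Rintegral => //; exact: bounded_measurable_integrable. Qed.

Lemma bounded_RintegralD g h : bounded_measurable g -> bounded_measurable h ->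
  (\int[mu]_x (g x + h x))%R = (\int[mu]_x g x)%R + (\int[mu]_x h x)%R.
Proof. by move=> hg hh; rewrite RintegralD//; exact: bounded_measurable_integrable. Qed.

Lemma bounded_RintegralZ (c : R) g : bounded_measurable g ->
  (\int[mu]_x (c * g x))%R = c * (\int[mu]_x g x)%R.
Proof. by move=> hg; rewrite RintegralZl//; exact: bounded_measurable_integrable. Qed.

Lemma bounded_Rintegral_sum (J : Type) (s : seq J) (g : J -> T -> R) :
  (forall i, bounded_measurable (g i)) ->
  (\int[mu]_x (\sum_(i <- s) g i x))%R = \sum_(i <- s) (\int[mu]_x g i x)%R.
Proof.
move=> hg; elim: s => [|i s IH].
  rewrite big_nil (_ : (fun x => _) = fun=> 0); last by apply/funext => x; rewrite big_nil.
  by rewrite Rintegral_cst// mul0r.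
rewrite big_cons -IH -bounded_RintegralD//; last exact: bounded_measurable_sum.
by apply: eq_Rintegral => x _; rewrite big_cons.
Qed.

End BoundedMeasurable.

(** * Fejer kernels and their products *)

Section Fejer.
Context {R : realType}.
Implicit Types (x : R) (n : nat).

Let C n x : R := \sum_(k < n) cos (k%:R * x).
Let S n x : R := \sum_(k < n) sin (k%:R * x).

(* The square modulus of the average of exp (i k x) over k < n. *)
Definition fejer n x : R :=
  n%:R ^- 2 * ((\sum_(k < n) cos (k%:R * x)) ^+ 2 + (\sum_(k < n) sin (k%:R * x)) ^+ 2).

Lemma fejerE n x : fejer n x =
  \sum_(i < n) \sum_(j < n) n%:R ^- 2 * cos ((i%:R - j%:R) * x).
Proof.
rewrite /fejer; have := @sum_cosB R _ (fun=> 1) (fun k : 'I_n => k%:R * x).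
under eq_bigr do under eq_bigr do rewrite !mul1r -mulrBl.
under [X in _ = X ^+ 2 + _]eq_bigr do rewrite mul1r.
under [X in _ = _ + X ^+ 2]eq_bigr do rewrite mul1r.
by move=> <-; rewrite mulr_sumr; apply: eq_bigr => i _; rewrite mulr_sumr.
Qed.

Lemma fejer_ge0 n x : 0 <= fejer n x.
Proof. by rewrite mulr_ge0 ?invr_ge0 ?exprn_ge0// addr_ge0 ?sqr_ge0. Qed.

Lemma fejer_le1 n x : (0 < n)%N -> fejer n x <= 1.
Proof.
move=> n0; rewrite fejerE.
apply: (@le_trans _ _ (\sum_(i < n) \sum_(j < n) n%:R ^- 2 * 1)).
  apply: ler_sum => i _; apply: ler_sum => j _.
  by rewrite ler_wpM2l ?invr_ge0 ?exprn_ge0// cos_le1.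
rewrite !sumr_const !card_ord mulr1 -mulrnA -[_ *+ (n * n)]mulr_natr natrM -expr2 mulVf//.
by rewrite expf_neq0// pnatr_eq0 -lt0n.
Qed.

Lemma fejer_ge n x : (0 < n)%N -> n%:R * `|x| <= 1 -> 4^-1 <= fejer n x.
Proof.
move=> n0 nx; have n0R : 0 < n%:R :> R by rewrite ltr0n.
have hC : n%:R / 2 <= C n x.
  rewrite (_ : n%:R / 2 = \sum_(k < n) 2^-1); last first.
    by rewrite sumr_const card_ord -[RHS]mulr_natl.
  apply: ler_sum => k _; apply: cos_ge_half; apply: le_trans nx.
  by rewrite normrM ger0_norm// ler_wpM2r// ler_nat ltnW.
rewrite /fejer mulrC ler_pdivlMr ?exprn_gt0//.
have : (n%:R / 2) ^+ 2 <= C n x ^+ 2.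
  by rewrite lerXn2r ?nnegrE// ?(le_trans _ hC)// divr_ge0.
have := sqr_ge0 (S n x); rewrite /C /S exprMn; set u := (2^-1 ^+ 2 : R).
have -> : u = 4^-1 by rewrite /u; field.
lra.
Qed.

(** Multiplying the sum of exp (i k x) by exp (i x) - 1 telescopes to exp (i n x) - 1; square moduli
    are then compared. The constant is 64 = 2 * 32, with 32 from [one_sub_cos_ge]. *)
Lemma fejer_decay n x : (0 < n)%N -> `|x| <= pi -> fejer n x * (n%:R * x) ^+ 2 <= 64.
Proof.
move=> n0 xpi; have n0R : n%:R != 0 :> R by rewrite pnatr_eq0 -lt0n.
have tel m : C m x * cos x - S m x * sin x - C m x = cos (m%:R * x) - 1 /\
    S m x * cos x + C m x * sin x - S m x = sin (m%:R * x).
  elim: m => [|m [IC IS]].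
    by rewrite /C /S !big_ord0 mulr0n !mul0r cos0 sin0; split; ring.
  rewrite {1 2 3}/C {1 2 3}/S /C /S !big_ord_recr/= -/(C m x) -/(S m x).
  have -> : m.+1%:R * x = m%:R * x + x by rewrite -(natr1 m) mulrDl mul1r.
  rewrite cosD sinD; split.
    have -> : cos (m%:R * x) * cos x - sin (m%:R * x) * sin x - 1 =
      cos (m%:R * x) * cos x - sin (m%:R * x) * sin x - cos (m%:R * x) + (cos (m%:R * x) - 1) by ring.
    by rewrite -IC; ring.
  have -> : sin (m%:R * x) * cos x + cos (m%:R * x) * sin x =
      sin (m%:R * x) * cos x + cos (m%:R * x) * sin x - sin (m%:R * x) + sin (m%:R * x) by ring.
  by rewrite -{5}IS; ring.
have [tC tS] := tel n.
have key : 2 * (1 - cos x) * (C n x ^+ 2 + S n x ^+ 2) = 2 * (1 - cos (n%:R * x)).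
  have c2 := cos2Dsin2 x; have c2n := cos2Dsin2 (n%:R * x).
  transitivity ((cos (n%:R * x) - 1) ^+ 2 + sin (n%:R * x) ^+ 2).
    rewrite -tC -tS.
    have -> : (C n x * cos x - S n x * sin x - C n x) ^+ 2 +
        (S n x * cos x + C n x * sin x - S n x) ^+ 2 =
        (C n x ^+ 2 + S n x ^+ 2) * (cos x ^+ 2 + sin x ^+ 2 + 1 - 2 * cos x) by ring.
    by rewrite c2; ring.
  have -> : (cos (n%:R * x) - 1) ^+ 2 + sin (n%:R * x) ^+ 2 =
    cos (n%:R * x) ^+ 2 + sin (n%:R * x) ^+ 2 + 1 - 2 * cos (n%:R * x) by ring.
  by rewrite c2n; ring.
have h1 := one_sub_cos_ge x xpi; have h2 := cos_geN1 (n%:R * x).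
have S0 : 0 <= C n x ^+ 2 + S n x ^+ 2 by rewrite addr_ge0 ?sqr_ge0.
have -> : fejer n x * (n%:R * x) ^+ 2 = (C n x ^+ 2 + S n x ^+ 2) * x ^+ 2.
  by rewrite /fejer -/(C n x) -/(S n x); field.
have := ler_wpM2l S0 h1; nra.
Qed.

Lemma measurable_fejer n : measurable_fun setT (fejer n).
Proof.
have mg (g : R -> R) : measurable_fun setT g ->
    measurable_fun setT (fun x : R => (\sum_(k < n) g (k%:R * x)) ^+ 2).
  move=> hg; apply: (@measurable_funX _ _ _ _ (fun x : R => \sum_(k < n) g (k%:R * x))).
  apply: (@measurable_sum _ _ _ _ _ _ (fun (k : 'I_n) (x : R) => g (k%:R * x))) => k.
  by apply: (measurableT_comp hg); exact: measurable_funM.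
apply: measurable_funM => //; apply: measurable_funD; apply: mg;
  apply: continuous_measurable_fun; [exact: continuous_cos|exact: continuous_sin].
Qed.

End Fejer.

Section Multiplier.
Context {R : realType} {d : nat}.
Implicit Types (lambda x : 'rV[R]_d).

(** The Fourier transform of a product of triangular weights on the grid of mesh 1/q, of extent n/q
    in each direction. Near the origin it concentrates on |lambda| of order q/n, but it is
    q-periodic in each coordinate. *)
Definition multiplier (n q : nat) lambda : R :=
  \prod_l fejer n (2 * pi * (q%:R^-1 * lambda 0 l)).

Lemma dot_self lambda : dot lambda lambda = enorm lambda ^+ 2.
Proof.
by rewrite sqr_sqrtr// sumr_ge0// => i _; rewrite -expr2 sqr_ge0.
Qed.

Lemma coord_le_enorm lambda l : `|lambda 0 l| <= enorm lambda.
Proof.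
rewrite -ler_sqr ?nnegrE ?sqrtr_ge0// -dot_self real_normK ?num_real// /dot (bigD1 l)//=.
by rewrite -expr2 lerDl sumr_ge0// => i _; rewrite -expr2 sqr_ge0.
Qed.

Lemma enorm_ge0 lambda : 0 <= enorm lambda.
Proof. exact: sqrtr_ge0. Qed.

Variables n q : nat.
Hypotheses (n0 : (0 < n)%N) (q0 : (0 < q)%N).
Let L : R := n%:R / q%:R.
Let W := multiplier n q.

Let L0 : 0 < L.
Proof. by rewrite divr_gt0 ?ltr0n. Qed.

Lemma multiplier_ge0 lambda : 0 <= W lambda.
Proof. by apply: prodr_ge0 => l _; exact: fejer_ge0. Qed.

Lemma multiplier_le1 lambda : W lambda <= 1.
Proof. by apply: prodr_ile1 => l _; rewrite fejer_ge0 fejer_le1. Qed.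

Lemma multiplier_ge lambda : 8 * L * enorm lambda <= 1 -> 4^-1 ^+ d <= W lambda.
Proof.
move=> Ll; rewrite -[X in _ ^+ X](card_ord d) -prodr_const; apply: ler_prod => l _.
rewrite invr_ge0 ler0n /= fejer_ge//.
have -> : n%:R * `|2 * pi * (q%:R^-1 * lambda 0 l)| = 2 * pi * (L * `|lambda 0 l|).
  rewrite !normrM ger0_norm// (ger0_norm (pi_ge0 R)) (ger0_norm (_ : 0 <= q%:R^-1)) ?invr_ge0//.
  by rewrite /L; ring.
have h := ler_wpM2l (ltW L0) (coord_le_enorm lambda l).
have h0 : 0 <= L * `|lambda 0 l| by rewrite mulr_ge0// ltW.
have /andP[_ p2] := @pihalf_02 R; have p0 := pi_gt0 R.
nra.
Qed.

(** Frequencies outside the period cell of the multiplier centred at 0: those that the grid of mesh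
    1/q cannot tell from lower ones. *)
Definition aliased : set 'rV[R]_d := [set lambda | exists l, q%:R / 2 < `|lambda 0 l|].

(** [fejer_decay] summed over the coordinates, the other factors being at most 1; the constant 4
    comes from 64 / (2 pi)^2 <= 4. *)
Lemma multiplier_decay lambda : ~ aliased lambda ->
  W lambda * (L * enorm lambda) ^+ 2 <= 4 * d%:R.
Proof.
move=> nal; rewrite exprMn -dot_self /dot 2!mulr_sumr.
rewrite -[X in _ <= _ * X%:R](card_ord d) mulr_natr -sumr_const; apply: ler_sum => l _.
have h : `|2 * pi * (q%:R^-1 * lambda 0 l)| <= pi.
  rewrite !normrM ger0_norm// (ger0_norm (pi_ge0 R)) (ger0_norm (_ : 0 <= q%:R^-1)) ?invr_ge0//.
  have hl : `|lambda 0 l| <= q%:R / 2 by rewrite leNgt; apply/negP => h; apply: nal; exists l.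
  have : q%:R^-1 * `|lambda 0 l| <= 2^-1.
    by rewrite mulrC ler_pdivrMr ?ltr0n// mulrC.
  by have := pi_gt0 R; nra.
have hW : W lambda <= fejer n (2 * pi * (q%:R^-1 * lambda 0 l)).
  rewrite /W /multiplier (bigD1 l)//= -[leRHS]mulr1 ler_wpM2l ?fejer_ge0//.
  by apply: prodr_ile1 => i _; rewrite fejer_ge0 fejer_le1.
have := fejer_decay n _ n0 h.
have -> : n%:R * (2 * pi * (q%:R^-1 * lambda 0 l)) = 2 * pi * (L * lambda 0 l) by rewrite /L; ring.
have /andP[p1 _] := @pihalf_02 R.
have p2 : 2 <= pi :> R by exact: pi_ge2.
set v := L * lambda 0 l => H.
have -> : W lambda * (L ^+ 2 * (lambda 0 l * lambda 0 l)) = W lambda * v ^+ 2 by rewrite /v; ring.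
have v0 : 0 <= v ^+ 2 by rewrite sqr_ge0.
have W0 := multiplier_ge0 lambda.
apply: (le_trans (ler_wpM2r v0 hW)).
move: H; set F := fejer _ _; have F0 : 0 <= F * v ^+ 2 by rewrite mulr_ge0 ?fejer_ge0.
have -> : F * (2 * pi * v) ^+ 2 = (4 * pi ^+ 2) * (F * v ^+ 2) by ring.
have : 16 <= 4 * pi ^+ 2 :> R by nra.
nra.
Qed.

Lemma bounded_measurable_multiplier : bounded_measurable (W : borel R d -> R).
Proof.
apply: (@bounded_measurable_prod _ _ _ _ _ (fun l (x : borel R d) => fejer n (2 * pi * (q%:R^-1 * (x : 'rV[R]_d) 0 l)))) => l.
split; last by exists 1 => x; rewrite ger0_norm ?fejer_ge0// fejer_le1.
apply: (measurableT_comp (measurable_fejer n)).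
by apply: measurable_funM => //; apply: measurable_funM => //; exact: measurable_coord.
Qed.

Lemma measurable_aliased : measurable (aliased : set (borel R d)).
Proof.
rewrite (_ : aliased = \bigcup_(l in [set: 'I_d]) [set x : borel R d | q%:R / 2 < `|(x : 'rV[R]_d) 0 l|]).
  apply: fin_bigcup_measurable => // l _.
  have h : measurable_fun setT (fun x : borel R d => `|(x : 'rV[R]_d) 0 l|).
    by apply: measurableT_comp => //; exact: measurable_coord.
  have := h measurableT `]q%:R / 2, +oo[%classic (measurable_itv _).
  by rewrite setTI; congr measurable; apply/seteqP; split => x /=; rewrite in_itv/= andbT.
by apply/seteqP; split => [x [l h]|x [l _ h]]; exists l.
Qed.

End Multiplier.

(** * Integrals of multipliers against a doubling measure *)

Section DoublingMeasure.
Context {R : realType} {d : nat}.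
Variable mu : {finite_measure set (borel R d) -> \bar R}.
Variable c : R.
Implicit Types (lambda x : 'rV[R]_d) (r s : R).

Definition mass r : R := fine (mu (eball r)).

Hypothesis c1 : 1 <= c.
Hypothesis doubling : forall r, 0 < r -> mass (2 * r) <= c * mass r.

Lemma mass_ge0 r : 0 <= mass r.
Proof. exact: fine_ge0. Qed.

Lemma mass_le r s : r <= s -> mass r <= mass s.
Proof.
move=> rs; apply: fine_le; rewrite ?fin_num_measure//; try exact: measurable_eball.
apply: le_measure; rewrite ?inE; try exact: measurable_eball.
by move=> x /= h; exact: le_trans h rs.
Qed.

Lemma mass_le_total r : mass r <= fine (mu setT).
Proof.
apply: fine_le; rewrite ?fin_num_measure//; try exact: measurable_eball.
by apply: le_measure; rewrite ?inE//; exact: measurable_eball.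
Qed.

Lemma mass_doubling r p : 0 < r -> mass (2 ^+ p * r) <= c ^+ p * mass r.
Proof.
move=> r0; elim: p => [|p IH]; first by rewrite !expr0 !mul1r.
rewrite !exprS -!mulrA; apply: le_trans (doubling _ _) _; first by rewrite mulr_gt0// exprn_gt0.
by rewrite ler_wpM2l// (le_trans _ c1).
Qed.

(** The shape of the bound for the j-th power of a multiplier outside the ball of radius r,
    normalised to be at most 1. *)
Definition tail_profile j r lambda : R :=
  \1_(~` eball r) lambda * (r / enorm lambda) ^+ (2 * j).

Lemma tail_profile_ge0 j r lambda : 0 <= r -> 0 <= tail_profile j r lambda.
Proof. by move=> r0; rewrite mulr_ge0// exprn_ge0// divr_ge0// enorm_ge0. Qed.

Lemma tail_profile_le1 j r lambda : 0 <= r -> tail_profile j r lambda <= 1.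
Proof.
move=> r0; rewrite /tail_profile indicE; case: (boolP (_ \in _)) => [|_]; last by rewrite mul0r.
rewrite inE /eball /= => /negP; rewrite -ltNge => h.
rewrite mul1r exprn_ile1// ?divr_ge0 ?enorm_ge0// ler_pdivrMr ?mul1r ?ltW//.
exact: le_lt_trans h.
Qed.

Lemma bounded_measurable_tail_profile j r : 0 <= r ->
  bounded_measurable (tail_profile j r : borel R d -> R).
Proof.
move=> r0; split; last first.
  by exists 1 => x; rewrite ger0_norm ?tail_profile_ge0// tail_profile_le1.
apply: (@measurable_funM _ (borel R d) R setT (\1_(~` eball r) : borel R d -> R)
    (fun x : borel R d => (r / enorm (x : 'rV[R]_d)) ^+ (2 * j))).
  by apply: measurable_indic; apply: measurableC; exact: measurable_eball.
apply: (@measurable_funX _ _ _ _ (fun x : borel R d => r / enorm (x : 'rV[R]_d))).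
apply: measurable_funM => //.
rewrite (_ : (fun x => _) = fun x : borel R d => enorm (x : 'rV[R]_d) `^ (-1)).
  by apply: (measurableT_comp (measurable_powR (-1))); exact: measurable_enorm.
by apply/funext => x; rewrite powR_inv1// enorm_ge0.
Qed.

Let tail_rec j r lambda : 0 < r -> tail_profile j r lambda <=
  \1_(eball (2 * r)) lambda + 4^-1 ^+ j * tail_profile j (2 * r) lambda.
Proof.
move=> r0; have [h|h] := boolP (lambda \in eball (2 * r)).
  rewrite [\1_(eball _) _]indicE h; apply: (le_trans (tail_profile_le1 _ _ _ (ltW r0))).
  by rewrite lerDl mulr_ge0 ?exprn_ge0 ?invr_ge0// tail_profile_ge0// mulr_ge0// ltW.
have h' : lambda \notin eball r.
  apply: contra h; rewrite !inE /eball /= => h; apply: (le_trans h).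
  by rewrite ler_peMl ?ltW// ltr1n.
rewrite /tail_profile !indicE (negbTE h) !in_setC h h' /= add0r !mul1r.
rewrite -[2 * r / _]mulrA [(2 * _) ^+ _]exprMn mulrA [2 ^+ (2 * j)]exprM -exprMn.
by rewrite (_ : 4^-1 * 2 ^+ 2 = 1 :> R) ?expr1n ?mul1r// expr2; field.
Qed.

(** Passing from r to 2 r costs a factor c in mass and gains 4^-j in the profile; with 2 c <= 4^j
    the sum over dyadic shells is geometric of ratio at most 1/2. *)
Lemma tail_profile_integral j r : 0 < r -> 2 * c <= 4 ^+ j ->
  (\int[mu]_x tail_profile j r x)%R <= 2 * c * mass r.
Proof.
move=> r0 cj; pose V s := (\int[mu]_x tail_profile j s x)%R.
have bt s : 0 < s -> bounded_measurable (tail_profile j s : borel R d -> R).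
  by move=> s0; apply: bounded_measurable_tail_profile; exact: ltW.
have Vtop s : 0 < s -> V s <= fine (mu setT).
  move=> s0; rewrite -[leRHS]mul1r -Rintegral_cst//; apply: le_bounded_Rintegral => //.
  - exact: bt.
  - exact: bounded_measurable_cst.
  - by move=> x; rewrite tail_profile_le1 ?ltW.
have Vrec s : 0 < s -> V s <= c * mass s + 4^-1 ^+ j * V (2 * s).
  move=> s0; have s20 : 0 < 2 * s by rewrite mulr_gt0.
  have bi : bounded_measurable (\1_(eball (2 * s)) : borel R d -> R).
    by apply: bounded_measurable_indic; exact: measurable_eball.
  apply: (@le_trans _ _ (mass (2 * s) + 4^-1 ^+ j * V (2 * s))); last by rewrite lerD2r doubling.
  rewrite /mass -Rintegral_indicT; last exact: measurable_eball.
  rewrite /V -bounded_RintegralZ; last exact: bt.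
  rewrite -bounded_RintegralD//; last by apply: bounded_measurableZ; exact: bt.
  apply: le_bounded_Rintegral.
  - exact: bt.
  - by apply: bounded_measurableD => //; apply: bounded_measurableZ; exact: bt.
  - by move=> x; exact: tail_rec.
(* After N doublings the remainder is at most 2^-N times the total mass. *)
have VN N s : 0 < s -> V s <= 2 * c * mass s + 2^-1 ^+ N * fine (mu setT).
  elim: N s => [|N IH] s s0.
    by rewrite expr0 mul1r (le_trans (Vtop s s0))// lerDr !mulr_ge0// ?mass_ge0// (le_trans _ c1).
  apply: (le_trans (Vrec s s0)).
  have h := IH (2 * s) _; have s20 : 0 < 2 * s by rewrite mulr_gt0.
  have q0 : 0 <= 4^-1 ^+ j :> R by rewrite exprn_ge0.
  have c0 : 0 < c by exact: lt_le_trans c1.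
  have q1 : 4^-1 ^+ j * (2 * c) <= 1 :> R by rewrite exprVn mulrC ler_pdivrMr ?exprn_gt0// mul1r.
  have q2 : 4^-1 ^+ j <= 2^-1 :> R.
    by have := ler_wpM2l q0 c1; rewrite mulr1; lra.
  have m0 := mass_ge0 s; have dm := doubling s s0.
  have T0 : 0 <= 2^-1 ^+ N * fine (mu setT) by rewrite mulr_ge0 ?exprn_ge0 ?fine_ge0.
  have := ler_wpM2l q0 (h s20).
  rewrite exprS -[in X in _ -> X]mulrA.
  set M2 := mass (2 * s) in dm *; set M := mass s in m0 dm *.
  set A := 2^-1 ^+ N * _ in T0 *; set Q := 4^-1 ^+ j in q0 q1 q2 *; set W := V (2 * s).
  move=> hW.
  have M20 : 0 <= M2 by exact: mass_ge0.
  have e1 : Q * (2 * c) * M2 <= M2 by rewrite ler_piMl.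
  have e2 : Q * A <= 2^-1 * A by rewrite ler_wpM2r.
  have e3 : Q * W <= M2 + 2^-1 * A.
    apply: (le_trans hW); have -> : Q * (2 * c * M2 + A) = Q * (2 * c) * M2 + Q * A by ring.
    exact: lerD.
  have -> : 2 * (c * M) = c * M + c * M by ring.
  by rewrite -/A -[2^-1 * _ * _]mulrA -/A; lra.
apply/ler_addgt0Pr => e e0.
have [N hN] : exists N : nat, 2^-1 ^+ N * fine (mu setT) <= e.
  exists (Num.truncn (fine (mu setT) / e)).+1.
  rewrite exprVn mulrC ler_pdivrMr ?exprn_gt0// mulrC -ler_pdivrMr//.
  apply: ltW; apply: (lt_le_trans (truncnS_gt _)).
  by rewrite -natrX ler_nat ltnW// ltn_expl.
by apply: (le_trans (VN N r r0)); rewrite lerD2l.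
Qed.

Section MultiplierIntegral.
Variables (n q k : nat).
Hypotheses (n0 : (0 < n)%N) (q0 : (0 < q)%N) (ck : 2 * c <= 4 ^+ k).
Let L : R := n%:R / q%:R.
Let W := @multiplier R d n q.

Let L0 : 0 < L.
Proof. by rewrite divr_gt0 ?ltr0n. Qed.

Let W0 := @multiplier_ge0 R d n q.
Let W1 := @multiplier_le1 R d n q n0.

Let tail_ge0 r : 0 <= (4 * d%:R / (L * r) ^+ 2) ^+ k.
Proof. by rewrite exprn_ge0// divr_ge0 ?sqr_ge0// mulr_ge0. Qed.

Lemma multiplier_pow_tail r lambda : 0 < r -> lambda \notin eball r ->
  W lambda ^+ k <= \1_(aliased q) lambda +
    (4 * d%:R / (L * r) ^+ 2) ^+ k * tail_profile k r lambda.
Proof.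
move=> r0 lr; have [al|nal] := boolP (lambda \in aliased q).
  rewrite indicE al; apply: (@le_trans _ _ 1); first by rewrite exprn_ile1.
  by rewrite lerDl mulr_ge0// tail_profile_ge0// ltW.
rewrite indicE (negbTE nal) add0r /tail_profile indicE in_setC lr /= mul1r exprM -exprMn.
have el : 0 < enorm lambda.
  apply: lt_trans r0 _; rewrite ltNge; apply: contra lr => h; by rewrite inE.
rewrite lerXn2r ?nnegrE// ?mulr_ge0 ?invr_ge0 ?sqr_ge0// ?(ltW r0) ?(ltW el)//.
have := multiplier_decay n q n0 q0 lambda _; rewrite -/L -/W => /(_ _)/wrap[|H].
  by move/mem_set; rewrite (negbTE nal).
have -> : 4 * d%:R / (L * r) ^+ 2 * (r / enorm lambda) ^+ 2 = 4 * d%:R / (L * enorm lambda) ^+ 2.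
  by field; rewrite !gt_eqF.
by rewrite ler_pdivlMr// exprn_gt0// mulr_gt0.
Qed.

Let bW : bounded_measurable (W : borel R d -> R).
Proof. exact: bounded_measurable_multiplier. Qed.

Let bball r : bounded_measurable (\1_(eball r) : borel R d -> R).
Proof. by apply: bounded_measurable_indic; exact: measurable_eball. Qed.

Let bal : bounded_measurable (\1_(aliased q) : borel R d -> R).
Proof. by apply: bounded_measurable_indic; exact: measurable_aliased. Qed.

Lemma multiplier_energy r : 0 < r -> 4 * d%:R <= (L * r) ^+ 2 ->
  (\int[mu]_x (W x ^+ k))%R <= (1 + 2 * c) * mass r + fine (mu (aliased q)).
Proof.
move=> r0 Lr; pose A := (4 * d%:R / (L * r) ^+ 2) ^+ k.
have bt : bounded_measurable (tail_profile k r : borel R d -> R).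
  by apply: bounded_measurable_tail_profile; exact: ltW.
apply: (@le_trans _ _ (mass r + (fine (mu (aliased q)) + A * (\int[mu]_x tail_profile k r x)%R))).
  rewrite -bounded_RintegralZ// -Rintegral_indicT; last exact: measurable_aliased.
  rewrite -bounded_RintegralD//; last exact: bounded_measurableZ.
  rewrite /mass -Rintegral_indicT; last exact: measurable_eball.
  rewrite -bounded_RintegralD//; last by apply: bounded_measurableD => //; exact: bounded_measurableZ.
  apply: le_bounded_Rintegral.
  - exact: bounded_measurableX.
  - by apply: bounded_measurableD => //; apply: bounded_measurableD => //; exact: bounded_measurableZ.
  - move=> x; have [xr|xr] := boolP (x \in eball r).
      rewrite [X in X + _]indicE xr -[leLHS]addr0 lerD//; first by rewrite exprn_ile1.
      by rewrite addr_ge0 ?indicE// mulr_ge0 ?tail_ge0// tail_profile_ge0// ltW.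
    by rewrite [X in X + _]indicE (negbTE xr) add0r multiplier_pow_tail.
rewrite mulrDl mul1r -!addrA lerD2l [_ * mass r + _]addrC lerD2l.
apply: le_trans (tail_profile_integral k r r0 ck); rewrite ler_piMl//.
  by apply: Rintegral_ge0 => x _; rewrite tail_profile_ge0// ltW.
by rewrite exprn_ile1 ?divr_ge0 ?sqr_ge0// ?mulr_ge0// ler_pdivrMr ?mul1r// exprn_gt0// mulr_gt0.
Qed.

(** Three zones: on the ball of radius 1 / (8 L) both the multiplier and the cosine are bounded
    below; from there to r the integrand is nonnegative; beyond r only the tail bound and the
    aliased mass are subtracted. *)
Lemma multiplier_pairing r x : 0 < r -> 1 <= 8 * L * r ->
  (forall lambda, enorm lambda <= r -> `|2 * pi * dot lambda x| <= 1) ->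
  2^-1 * (4^-1 ^+ d) ^+ k * mass (8 * L)^-1 - fine (mu (aliased q)) -
    (4 * d%:R / (L * r) ^+ 2) ^+ k * (2 * c * mass r) <=
  (\int[mu]_l (W l ^+ k * cos (2 * pi * dot l x)))%R.
Proof.
move=> r0 Lr xr; pose A := (4 * d%:R / (L * r) ^+ 2) ^+ k.
pose B : R := 2^-1 * (4^-1 ^+ d) ^+ k.
have B0 : 0 <= B by rewrite mulr_ge0 ?exprn_ge0.
have bt : bounded_measurable (tail_profile k r : borel R d -> R).
  by apply: bounded_measurable_tail_profile; exact: ltW.
apply: (@le_trans _ _ (B * mass (8 * L)^-1 +
    (- 1 * fine (mu (aliased q)) + (- A) * (\int[mu]_x tail_profile k r x)%R))).
  rewrite -addrA lerD2l mulN1r lerD2l mulNr lerN2 ler_wpM2l ?tail_ge0//.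
  exact: tail_profile_integral.
rewrite -bounded_RintegralZ// -Rintegral_indicT; last exact: measurable_aliased.
rewrite -bounded_RintegralZ// -bounded_RintegralD//; try exact: bounded_measurableZ.
rewrite /mass -Rintegral_indicT; last exact: measurable_eball.
rewrite -bounded_RintegralZ// -bounded_RintegralD//; last 2 first.
- exact: bounded_measurableZ.
- by apply: bounded_measurableD; exact: bounded_measurableZ.
have bc : bounded_measurable (fun l : borel R d => cos (2 * pi * dot (l : 'rV[R]_d) x)).
  split; last by exists 1 => l; rewrite ler_norml cos_geN1 cos_le1.
  apply: (@measurableT_comp _ _ _ _ _ _ (@cos R)).
    by apply: continuous_measurable_fun; exact: continuous_cos.
  by apply: measurable_funM => //; exact: measurable_dot.
apply: le_bounded_Rintegral.
- by apply: bounded_measurableD; [exact: bounded_measurableZ|apply: bounded_measurableD; exact: bounded_measurableZ].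
- by apply: bounded_measurableM => //; exact: bounded_measurableX.
move=> l; have Wk0 : 0 <= W l ^+ k by rewrite exprn_ge0.
have [lr|lr] := boolP (l \in eball r).
  have c2 : 2^-1 <= cos (2 * pi * dot l x).
    by apply: cos_ge_half; apply: xr; rewrite inE in lr.
  apply: (@le_trans _ _ (B * \1_(eball (8 * L)^-1) l)).
    rewrite -[leRHS]addr0 lerD2l mulN1r mulNr -opprD oppr_le0.
    by rewrite addr_ge0 ?indicE// mulr_ge0 ?tail_ge0// tail_profile_ge0// ltW.
  rewrite indicE; have [ln|_] := boolP (l \in _); last first.
    by rewrite mulr0 mulr_ge0// (le_trans _ c2).
  rewrite mulr1 /B mulrC ler_pM ?exprn_ge0//.
  rewrite lerXn2r ?nnegrE ?exprn_ge0// multiplier_ge// -/L.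
  have L8 : 0 < 8 * L by rewrite mulr_gt0.
  by move: ln; rewrite inE /eball /= -(ler_pM2l L8) mulfV// gt_eqF.
have ln : l \notin eball (8 * L)^-1.
  apply: contra lr; rewrite !inE /eball /= => /le_trans; apply.
  have L8 : 0 < 8 * L by rewrite mulr_gt0.
  by rewrite -(ler_pM2l L8) mulfV// gt_eqF.
rewrite [X in B * X]indicE (negbTE ln) mulr0 add0r mulN1r mulNr -opprD lerNl.
apply: le_trans (multiplier_pow_tail r l r0 lr); rewrite -mulrN ler_piMr//.
Qed.

End MultiplierIntegral.

End DoublingMeasure.

(** * Linear forms on sites and their Fourier symbols *)

Section SpectralForms.
Context {R : realType} {d : nat} {I : zmodType}.
Variable pos : I -> 'rV[R]_d.
Hypothesis posD : forall x y, pos (x + y) = pos x + pos y.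
Implicit Types (L : seq (R * I)) (lambda : 'rV[R]_d).

(** With [sin_symbol], the real and imaginary parts of the Fourier transform of the form L, seen as
    a signed measure on the sites. *)
Definition cos_symbol L lambda : R := lin L (fun x => cos (2 * pi * dot lambda (pos x))).
Definition sin_symbol L lambda : R := lin L (fun x => sin (2 * pi * dot lambda (pos x))).

Let pos0 : pos 0 = 0.
Proof. by apply: (addrI (pos 0)); rewrite -posD !addr0. Qed.

Let posN x : pos (- x) = - pos x.
Proof. by apply/eqP; rewrite -addr_eq0 -posD addNr pos0. Qed.

Let posMn x n : pos (x *+ n) = pos x *+ n.
Proof. by elim: n => [|n IH]; rewrite ?mulr0n ?pos0// !mulrS posD IH. Qed.

Definition conv_form L L' : seq (R * I) :=
  [seq (p.1 * p'.1, p.2 + p'.2) | p <- L, p' <- L'].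

Lemma lin_conv L L' g :
  lin (conv_form L L') g = lin L (fun x => lin L' (fun y => g (x + y))).
Proof.
rewrite /lin /conv_form big_allpairs_dep; apply: eq_bigr => p _.
by rewrite mulr_sumr; apply: eq_bigr => p' _; rewrite mulrA.
Qed.

Let linM L L' g h : lin L g * lin L' h = lin L (fun x => lin L' (fun y => g x * h y)).
Proof.
rewrite mulrC -lin_mulf; apply: eq_lin => x; rewrite mulrC -lin_mulf.
by apply: eq_lin.
Qed.

Lemma cos_symbol_conv L L' lambda : cos_symbol (conv_form L L') lambda =
  cos_symbol L lambda * cos_symbol L' lambda - sin_symbol L lambda * sin_symbol L' lambda.
Proof.
rewrite /cos_symbol /sin_symbol lin_conv !linM -mulN1r -!lin_mulf -lin_addf.
apply: eq_lin => x; rewrite -lin_mulf -lin_addf; apply: eq_lin => y.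
by rewrite posD dotDr mulrDr cosD; ring.
Qed.

Lemma sin_symbol_conv L L' lambda : sin_symbol (conv_form L L') lambda =
  sin_symbol L lambda * cos_symbol L' lambda + cos_symbol L lambda * sin_symbol L' lambda.
Proof.
rewrite /cos_symbol /sin_symbol lin_conv !linM -lin_addf.
apply: eq_lin => x; rewrite -lin_addf; apply: eq_lin => y.
by rewrite posD dotDr mulrDr sinD; ring.
Qed.

(* L is a probability weight with (real) Fourier transform W. *)
Definition averaging_form (r : R) (W : 'rV[R]_d -> R) L :=
  [/\ forall p, p \in L -> 0 <= p.1,
      \sum_(p <- L) p.1 = 1,
      forall p, p \in L -> forall l, `|pos p.2 0 l| <= r &
      forall lambda, cos_symbol L lambda = W lambda /\ sin_symbol L lambda = 0].

Lemma averaging_form1 : averaging_form 0 (fun=> 1) [:: (1, 0)].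
Proof.
split.
- by move=> p; rewrite inE => /eqP ->.
- by rewrite big_seq1.
- by move=> p; rewrite inE => /eqP -> l; rewrite pos0 mxE normr0.
- move=> lambda; rewrite /cos_symbol /sin_symbol !lin_cons !lin_nil /= pos0.
  have -> : dot lambda 0 = 0 by rewrite /dot big1// => l _; rewrite mxE mulr0.
  by rewrite mulr0 cos0 sin0; split; ring.
Qed.

Lemma averaging_form_conv r r' W W' L L' : averaging_form r W L -> averaging_form r' W' L' ->
  averaging_form (r + r') (fun x => W x * W' x) (conv_form L L').
Proof.
move=> [L0 L1 Lr LW] [L0' L1' Lr' LW']; split.
- by move=> _ /allpairsP[[p p'] [/= pL pL' ->]] /=; exact: mulr_ge0 (L0 _ pL) (L0' _ pL').
- have := lin_conv L L' (fun=> 1).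
  rewrite /lin; under eq_bigr do rewrite mulr1.
  move=> ->; rewrite -[RHS]L1; apply: eq_bigr => p _.
  by under eq_bigr do rewrite mulr1; rewrite L1' mulr1.
- move=> _ /allpairsP[[p p'] [/= pL pL' ->]] l /=.
  by rewrite posD mxE (le_trans (ler_normD _ _))// lerD// ?Lr ?Lr'.
- move=> lambda; rewrite cos_symbol_conv sin_symbol_conv.
  by rewrite !(LW lambda).1 !(LW lambda).2 !(LW' lambda).1 !(LW' lambda).2; split; ring.
Qed.

Lemma averaging_form_prod (J : eqType) (s : seq J) (r : R) (W : J -> 'rV[R]_d -> R) :
  (forall j, exists L, averaging_form r (W j) L) ->
  exists L, averaging_form ((size s)%:R * r) (fun x => \prod_(j <- s) W j x) L.
Proof.
move=> H; elim: s => [|j s [L IH]].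
  exists [:: (1, 0)]; rewrite mul0r.
  rewrite (_ : (fun x => _) = fun=> 1); first exact: averaging_form1.
  by apply/funext => x; rewrite big_nil.
have [L' HL'] := H j; exists (conv_form L' L).
rewrite (_ : (fun x => _) = fun x => W j x * \prod_(j <- s) W j x); last first.
  by apply/funext => x; rewrite big_cons.
by rewrite /= -natr1 mulrDl mul1r addrC; exact: averaging_form_conv.
Qed.

(** The autocorrelation of the uniform weight on n multiples of e: taking differences makes the
    symbol real and nonnegative while the weights stay nonnegative. *)
Definition fejer_form (n : nat) (e : I) : seq (R * I) :=
  [seq (n%:R ^- 2, e *+ i - e *+ j) | i : 'I_n <- enum 'I_n, j : 'I_n <- enum 'I_n].

Lemma fejer_form_averaging n (q : nat) e (l0 : 'I_d) : (0 < n)%N -> (0 < q)%N ->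
  (forall l, pos e 0 l = q%:R^-1 * (l == l0)%:R) ->
  averaging_form (n%:R / q%:R) (fun x => fejer n (2 * pi * (q%:R^-1 * x 0 l0))) (fejer_form n e).
Proof.
move=> n0 q0 he.
have linE g : lin (fejer_form n e) g = \sum_(i < n) \sum_(j < n) n%:R ^- 2 * g (e *+ i - e *+ j).
  rewrite /lin /fejer_form big_allpairs_dep big_enum /=; apply: eq_bigr => i _.
  by rewrite big_enum.
have dotE (lambda : 'rV[R]_d) (i j : nat) : 2 * pi * dot lambda (pos (e *+ i - e *+ j)) =
    (i%:R - j%:R) * (2 * pi * (q%:R^-1 * lambda 0 l0)).
  have -> : dot lambda (pos (e *+ i - e *+ j)) = (i%:R - j%:R) * dot lambda (pos e).
    rewrite posD posN !posMn dotBr mulrBl.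
    by rewrite /dot !mulr_sumr; congr (_ - _); apply: eq_bigr => l _; rewrite mulmxnE -mulr_natl; ring.
  rewrite /dot (bigD1 l0)//= he eqxx mulr1 big1 ?addr0; first by rewrite mulrCA [lambda 0 l0 * _]mulrC.
  by move=> l /negbTE ll; rewrite he ll !mulr0.
split.
- by move=> _ /allpairsP[[i j] [/= _ _ ->]] /=; rewrite invr_ge0 exprn_ge0.
- have := linE (fun=> 1); rewrite /lin; under eq_bigr do rewrite mulr1.
  move=> ->; rewrite !sumr_const !card_ord mulr1 -mulrnA -[_ *+ (n * n)]mulr_natr natrM -expr2.
  by rewrite mulVf// expf_neq0// pnatr_eq0 -lt0n.
- move=> _ /allpairsP[[i j] [/= _ _ ->]] l /=.
  have -> : pos (e *+ i - e *+ j) 0 l = (i%:R - j%:R) * q%:R^-1 * (l == l0)%:R.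
    by rewrite posD posN !posMn !mxE !mulmxnE he -[RHS]mulrA; set t := q%:R^-1 * _;
      rewrite -(mulr_natl t i) -(mulr_natl t j) -mulrBl.
  rewrite normrM.
  apply: (@le_trans _ _ (`|(i%:R - j%:R) * q%:R^-1| * 1)).
    by rewrite ler_wpM2l// normr_nat lern1 leq_b1.
  rewrite mulr1 normrM.
  rewrite [X in _ * X]ger0_norm ?invr_ge0// ler_wpM2r ?invr_ge0//.
  have : (i%:R : R) <= n%:R by rewrite ler_nat ltnW.
  have : (j%:R : R) <= n%:R by rewrite ler_nat ltnW.
  by rewrite ler_norml; have := ler0n R i; have := ler0n R j; lra.
- move=> lambda; rewrite /cos_symbol /sin_symbol !linE; split.
    by rewrite fejerE; apply: eq_bigr => i _; apply: eq_bigr => j _; rewrite dotE.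
  (* The sine sum is antisymmetric under the exchange of i and j. *)
  set S := LHS; have SN : S = - S.
    rewrite {1}/S exchange_big /= /S -sumrN; apply: eq_bigr => i _.
    rewrite -sumrN; apply: eq_bigr => j _.
    by rewrite !dotE -mulrN -sinN -mulNr opprB.
  lra.
Qed.

Lemma exists_multiplier_form (n q m : nat) (e : 'I_d -> I) : (0 < n)%N -> (0 < q)%N ->
  (forall l0 l, pos (e l0) 0 l = q%:R^-1 * (l == l0)%:R) ->
  exists L, averaging_form (m%:R * (d%:R * (n%:R / q%:R))) (fun x => multiplier n q x ^+ m) L.
Proof.
move=> n0 q0 he.
have [L HL] : exists L, averaging_form (d%:R * (n%:R / q%:R)) (@multiplier R d n q) L.
  have H (l : 'I_d) : exists L, averaging_form (n%:R / q%:R)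
      (fun x => fejer n (2 * pi * (q%:R^-1 * x 0 l))) L.
    by exists (fejer_form n (e l)); exact: fejer_form_averaging.
  have [L] := averaging_form_prod _ (enum 'I_d) _ _ H.
  rewrite size_enum_ord => HL; exists L; move: HL; congr averaging_form.
  by apply/funext => x; rewrite big_enum.
have := @averaging_form_prod _ (enum 'I_m) (d%:R * (n%:R / q%:R))
    (fun _ => @multiplier R d n q) (fun=> ex_intro _ L HL).
rewrite size_enum_ord => -[L' HL']; exists L'; move: HL'; congr averaging_form.
by apply/funext => x; rewrite big_enum prodr_const card_ord.
Qed.

Variable mu : {finite_measure set (borel R d) -> \bar R}.

Definition spectral_cov (x y : I) : R :=
  (\int[mu]_l cos (2 * pi * dot l (pos x - pos y)))%R.

Lemma spectral_covC x y : spectral_cov x y = spectral_cov y x.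
Proof.
by apply: eq_Rintegral => l _; rewrite -cosN -mulrN -dotNr opprB.
Qed.

Lemma spectral_cov_diag x : spectral_cov x x = fine (mu setT).
Proof.
rewrite /spectral_cov subrr -[RHS]mul1r -Rintegral_cst//; apply: eq_Rintegral => l _.
by rewrite /dot big1 ?mulr0 ?cos0// => i _; rewrite mxE mulr0.
Qed.

Lemma bounded_measurable_cos (v : 'rV[R]_d) :
  bounded_measurable (fun l : borel R d => cos (2 * pi * dot (l : 'rV[R]_d) v)).
Proof.
split; last by exists 1 => l; rewrite ler_norml cos_geN1 cos_le1.
apply: (@measurableT_comp _ _ _ _ _ _ (@cos R)).
  by apply: continuous_measurable_fun; exact: continuous_cos.
by apply: measurable_funM => //; exact: measurable_dot.
Qed.

Lemma bounded_measurable_sin (v : 'rV[R]_d) :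
  bounded_measurable (fun l : borel R d => sin (2 * pi * dot (l : 'rV[R]_d) v)).
Proof.
split; last by exists 1 => l; rewrite ler_norml sin_geN1 sin_le1.
apply: (@measurableT_comp _ _ _ _ _ _ (@sin R)).
  by apply: continuous_measurable_fun; exact: continuous_sin.
by apply: measurable_funM => //; exact: measurable_dot.
Qed.

Lemma bounded_measurable_cos_symbol L : bounded_measurable (cos_symbol L : borel R d -> R).
Proof.
apply: (@bounded_measurable_sum _ _ _ _ _ (fun p (l : borel R d) =>
  p.1 * cos (2 * pi * dot (l : 'rV[R]_d) (pos p.2)))) => p.
by apply: bounded_measurableZ; exact: bounded_measurable_cos.
Qed.

Lemma bounded_measurable_sin_symbol L : bounded_measurable (sin_symbol L : borel R d -> R).
Proof.
apply: (@bounded_measurable_sum _ _ _ _ _ (fun p (l : borel R d) =>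
  p.1 * sin (2 * pi * dot (l : 'rV[R]_d) (pos p.2)))) => p.
by apply: bounded_measurableZ; exact: bounded_measurable_sin.
Qed.

(** The spectral isometry: a covariance is the real part of the L^2 (mu) inner product of the two
    symbols. *)
Lemma spectral_covE L L' : cov spectral_cov L L' =
  (\int[mu]_l (cos_symbol L l * cos_symbol L' l + sin_symbol L l * sin_symbol L' l))%R.
Proof.
rewrite /cov /lin.
transitivity (\sum_(p <- L) \sum_(p' <- L')
    (\int[mu]_l (p.1 * p'.1 * cos (2 * pi * dot l (pos p.2 - pos p'.2))))%R).
  apply: eq_bigr => p _; rewrite mulr_sumr; apply: eq_bigr => p' _.
  by rewrite mulrA -bounded_RintegralZ//; exact: bounded_measurable_cos.
transitivity (\sum_(p <- L) (\int[mu]_l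
    (\sum_(p' <- L') p.1 * p'.1 * cos (2 * pi * dot l (pos p.2 - pos p'.2))))%R).
  apply: eq_bigr => p _; rewrite bounded_Rintegral_sum// => p'.
  by apply: bounded_measurableZ; exact: bounded_measurable_cos.
rewrite -bounded_Rintegral_sum; last first.
  move=> p; apply: bounded_measurable_sum => p'.
  by apply: bounded_measurableZ; exact: bounded_measurable_cos.
apply: eq_Rintegral => l _.
rewrite /cos_symbol /sin_symbol !linM -lin_addf; apply: eq_bigr => p _.
rewrite -lin_addf /= /lin mulr_sumr; apply: eq_bigr => p' _.
by rewrite dotBr mulrBr cosB; ring.
Qed.

End SpectralForms.

(** * Weights of small energy and barriers at scale T *)

Section Kernels.
Context {R : realType} {d : nat} {I : zmodType}.
Variable pos : I -> 'rV[R]_d.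
Hypothesis posD : forall x y, pos (x + y) = pos x + pos y.
Variable mu : {finite_measure set (borel R d) -> \bar R}.
Variable c : R.
Hypothesis d_gt0 : (0 < d)%N.
Hypothesis c1 : 1 <= c.
Hypothesis doubling : forall r, 0 < r -> mass mu (2 * r) <= c * mass mu r.
Hypothesis mass_gt0 : forall r, 0 < r -> 0 < mass mu r.
(* Sites form a grid of mesh 1 / q which sees almost all of mu without aliasing. *)
Hypothesis fine_grid : forall eps : R, 0 < eps -> exists (q : nat) (e : 'I_d -> I),
  [/\ (0 < q)%N, forall l0 l, pos (e l0) 0 l = q%:R^-1 * (l == l0)%:R &
      fine (mu (aliased q)) <= eps].
Let K := spectral_cov pos mu.

Let c0 : 0 < c. Proof. exact: lt_le_trans c1. Qed.
Let dR : 1 <= d%:R :> R. Proof. by rewrite ler1n. Qed.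

Lemma mass_scale r s p : 0 < r -> s <= 2 ^+ p * r -> mass mu s <= c ^+ p * mass mu r.
Proof.
move=> r0 sr; apply: le_trans (mass_doubling mu c c1 doubling _ p r0).
exact: mass_le.
Qed.

Lemma exists_exponent : exists m : nat, 2 * c <= 4 ^+ m.
Proof.
exists (Num.truncn (2 * c)).+1; apply: ltW; apply: (lt_le_trans (truncnS_gt _)).
by rewrite -natrX ler_nat ltnW// ltn_expl.
Qed.

Let le_nat_exp2 (n : nat) : n%:R <= 2 ^+ n :> R.
Proof. by rewrite -natrX ler_nat ltnW// ltn_expl. Qed.

(** The mesh 1/q is chosen after eps, to absorb the aliased mass; taking n = N q keeps the window
    n/q equal to N whatever the mesh. The energy involves squares, hence [multiplier_energy] at the
    power 2 m. *)
Lemma exists_averaging (m N : nat) (eps : R) : 2 * c <= 4 ^+ m -> (0 < N)%N -> 0 < eps ->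
  exists (n q : nat) (L : seq (R * I)), [/\ (0 < n)%N /\ (0 < q)%N, n%:R / q%:R = N%:R :> R,
    averaging_form pos (m%:R * (d%:R * N%:R)) (fun x => multiplier n q x ^+ m) L,
    fine (mu (aliased q)) <= eps &
    (\int[mu]_x (multiplier n q x ^+ m) ^+ 2)%R <=
      (1 + 2 * c) * mass mu (2 * d%:R / N%:R) + eps].
Proof.
move=> cm N0 eps0; have [q [e [q0 he aq]]] := fine_grid _ eps0.
have qR : q%:R != 0 :> R by rewrite pnatr_eq0 -lt0n.
have n0 : (0 < N * q)%N by rewrite muln_gt0 N0.
have nq : (N * q)%:R / q%:R = N%:R :> R by rewrite natrM mulfK.
have [L HL] := exists_multiplier_form pos posD (N * q) q m e n0 q0 he.
rewrite nq in HL; exists (N * q)%N, q, L; split => //.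
have NR : 0 < N%:R :> R by rewrite ltr0n.
have cm2 : 2 * c <= 4 ^+ (m * 2).
  rewrite exprM; apply: (le_trans cm); rewrite expr2 ler_peMr ?exprn_ge0//.
  by rewrite exprn_ege1// ler1n.
have := multiplier_energy mu c c1 doubling (N * q) q (m * 2) n0 q0 cm2 (2 * d%:R / N%:R) _ _.
rewrite nq => /(_ _ _)/wrap[||H].
- by rewrite divr_gt0// mulr_gt0// (lt_le_trans _ dR).
- have -> : N%:R * (2 * d%:R / N%:R) = 2 * d%:R :> R by rewrite mulrC divfK ?gt_eqF.
  have -> : (2 * d%:R) ^+ 2 = 4 * d%:R * d%:R :> R by ring.
  by rewrite ler_peMr// mulr_ge0.
apply: (@le_trans _ _ ((1 + 2 * c) * mass mu (2 * d%:R / N%:R) + fine (mu (aliased q)))); last by rewrite lerD2l.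
apply: le_trans H; rewrite le_eqVlt; apply/orP; left; apply/eqP.
by apply: eq_Rintegral => x _; rewrite exprM.
Qed.

Lemma cov_conv_le (r : R) W L S : averaging_form pos r W L -> bounded_measurable (W : borel R d -> R) ->
  (forall x, cos_symbol pos S x ^+ 2 + sin_symbol pos S x ^+ 2 <= 1) ->
  cov K (conv_form L S) (conv_form L S) <= (\int[mu]_x (W x ^+ 2))%R.
Proof.
move=> [_ _ _ LW] bW S1; rewrite spectral_covE; apply: le_bounded_Rintegral.
- by apply: bounded_measurableD; apply: bounded_measurableM;
    (exact: bounded_measurable_cos_symbol || exact: bounded_measurable_sin_symbol).
- exact: bounded_measurableX.
move=> x; rewrite cos_symbol_conv// sin_symbol_conv// (LW x).1 (LW x).2 !mul0r subr0 add0r.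
rewrite -!expr2 !exprMn -mulrDr -[leRHS]mulr1 ler_wpM2l ?sqr_ge0//.
Qed.

Definition average_form (s : seq I) : seq (R * I) := [seq ((size s)%:R^-1, x) | x <- s].

Lemma average_form_symbol s x : s != [::] ->
  cos_symbol pos (average_form s) x ^+ 2 + sin_symbol pos (average_form s) x ^+ 2 <= 1.
Proof.
move=> s0; set C := cos_symbol _ _ _; set S := sin_symbol _ _ _.
pose th y := 2 * pi * dot x (pos y); pose w : R := (size s)%:R^-1.
have w1 : \sum_(y <- s) w = 1.
  rewrite big_const_seq count_predT iter_addr addr0 -mulr_natr mulVf// pnatr_eq0.
  by rewrite size_eq0.
have CE : C = \sum_(y <- s) w * cos (th y) by rewrite /C /cos_symbol /lin big_map.
have SE : S = \sum_(y <- s) w * sin (th y) by rewrite /S /sin_symbol /lin big_map.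
(* Writing C^2 + S^2 as a mean of C cos + S sin and applying 2 a b <= a^2 + b^2 bounds it by (C^2 +
   S^2 + 1) / 2. *)
have : C ^+ 2 + S ^+ 2 <= (C ^+ 2 + S ^+ 2 + 1) / 2; last by lra.
have E : C ^+ 2 + S ^+ 2 = \sum_(y <- s) w * (C * cos (th y) + S * sin (th y)).
  rewrite {1}expr2 {2}CE {1}expr2 {2}SE !mulr_sumr -big_split /=.
  by apply: eq_bigr => y _; ring.
rewrite [leLHS]E.
apply: (@le_trans _ _ (\sum_(y <- s) w * ((C ^+ 2 + S ^+ 2 + 1) / 2))); last first.
  by rewrite -mulr_suml w1 mul1r.
apply: ler_sum => y _.
rewrite ler_wpM2l ?invr_ge0//.
have := sqr_ge0 (C - cos (th y)); have := sqr_ge0 (S - sin (th y)).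
have := cos2Dsin2 (th y); nra.
Qed.

(** The weight is supported in the box of size T with energy of the order of the mass of the ball of
    radius 1/T. Convolving it with the average over any list of sites keeps this bound, as the
    symbol of an average has modulus at most 1; the sites can thus be chosen for their
    unpredictability alone. *)
Lemma exists_small_average : exists2 C : R, 0 < C & exists T0 : R, forall T, T0 <= T ->
  exists W, [/\ averaging_form pos T W.1 W.2 & forall s, s != [::] ->
    cov K (conv_form W.2 (average_form s)) (conv_form W.2 (average_form s)) <=
      C * mass mu T^-1].
Proof.
have [m cm] := exists_exponent.
have m0 : (0 < m)%N.
  by rewrite lt0n; apply/eqP => m0; move: cm; rewrite m0 expr0; have := c1; lra.
have mdR : 1 <= m%:R * d%:R :> R by rewrite -natrM ler1n muln_gt0 m0.
(* From N >= T / (2 m d) follows 2 d / N <= 4 m d^2 / T <= 2^p / T, so p doublings compare the two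
   balls. *)
pose p := (4 * (m * (d * d)))%N.
exists ((1 + 2 * c) * c ^+ p + 1).
  by rewrite ltr_wpDl// mulr_ge0// ?exprn_ge0 ?ltW// addr_gt0// mulr_gt0.
exists (2 * (m%:R * d%:R)) => T HT.
have T0 : 0 < T by apply: lt_le_trans HT; rewrite mulr_gt0// (lt_le_trans _ mdR).
pose N := Num.truncn (T / (m%:R * d%:R)).
have md0 : 0 < m%:R * d%:R :> R by exact: lt_le_trans mdR.
have NT : m%:R * (d%:R * N%:R) <= T.
  rewrite mulrA mulrC -ler_pdivlMr//.
  by have /truncn_itv/andP[] : 0 <= T / (m%:R * d%:R) by rewrite divr_ge0// ltW.
have TN : T <= 2 * (m%:R * d%:R) * N%:R.
  have h : T / (m%:R * d%:R) < N%:R + 1 by rewrite natr1 truncnS_gt.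
  have h2 : 2 <= T / (m%:R * d%:R) by rewrite ler_pdivlMr.
  have : T / (m%:R * d%:R) <= 2 * N%:R by lra.
  by rewrite ler_pdivrMr// => /le_trans; apply; lra.
have N0 : (0 < N)%N.
  rewrite lt0n; apply/eqP => N0; move: TN; rewrite N0 mulr0; lra.
have NR : 0 < N%:R :> R by rewrite ltr0n.
have Tinv : 0 < T^-1 by rewrite invr_gt0.
have [n [q [L [[n0 q0] nq HL aq HE]]]] := exists_averaging m N (mass mu T^-1) cm N0 (mass_gt0 _ Tinv).
exists (fun x => multiplier n q x ^+ m, L); split => /=.
  by move: HL => [h1 h2 h3 h4]; split => // x xL l; exact: le_trans (h3 x xL l) NT.
move=> s s0; apply: le_trans (cov_conv_le _ _ _ _ HL _ _) _.
- by apply: bounded_measurableX; exact: bounded_measurable_multiplier.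
- by move=> x; exact: average_form_symbol.
apply: (le_trans HE); rewrite [leRHS]mulrDl mul1r lerD2r -[leRHS]mulrA ler_wpM2l//.
  by rewrite addr_ge0// mulr_ge0// ltW.
apply: mass_scale => //; rewrite ler_pdivrMr// mulrAC ler_pdivlMr//.
apply: (le_trans (ler_wpM2l _ TN)); first by rewrite mulr_ge0.
apply: le_trans (_ : p%:R * N%:R <= _); last by rewrite ler_wpM2r.
by rewrite /p !natrM le_eqVlt; apply/orP; left; apply/eqP; ring.
Qed.

(** The form may use sites far outside the box of size T. Its window N is a large constant multiple
    of T, so that the part of the pairing where the cosine has no sign is a small fraction of the
    main term. *)
Lemma exists_barrier : exists kappa C : R, [/\ 0 < kappa, 0 < C & forall T, 1 <= T ->
  exists L, (forall x, (forall l, `|pos x 0 l| <= T) ->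
      kappa * mass mu T^-1 <= cov K [:: (1, x)] L) /\
    cov K L L <= C * mass mu T^-1].
Proof.
have [m cm] := exists_exponent.
pose B : R := 2^-1 * (4^-1 ^+ d) ^+ m.
have B0 : 0 < B by rewrite mulr_gt0// !exprn_gt0.
have B1 : B <= 1 by rewrite mulr_ile1 ?exprn_ge0// ?exprn_ile1 ?exprn_ge0//; lra.
pose G1 : R := 256 * d%:R ^+ 3.
have G10 : 0 <= G1 by apply: mulr_ge0; [exact: ler0n|exact: exprn_ge0].
pose G : R := G1 ^+ m; have G0 : 0 <= G by exact: exprn_ge0.
(* A window 2^p times longer loses c^p in mass between the scales 1/T and 1/N but gains 4^(- m p) in
   the tail of the multiplier; since c / 4^m <= 1/2, the balance is at most 2^-p, and p is chosen to
   bring it below B / 4. *)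
pose p := (d + (Num.truncn (G * (2 * c * c) * 4 / B)).+1)%N.
have pG : G * (2 * c * c) / 2 ^+ p <= B / 4.
  have h : G * (2 * c * c) * 4 / B <= 2 ^+ p.
    apply: le_trans (le_nat_exp2 p); apply: ltW; apply: (lt_le_trans (truncnS_gt _)).
    by rewrite ler_nat leq_addl.
  by rewrite ler_pdivrMr ?exprn_gt0//; move: h; rewrite ler_pdivrMr//; lra.
have pd : d%:R <= 2 ^+ p :> R by apply: le_trans (le_nat_exp2 p); rewrite ler_nat leq_addr.
have cp0 n : 0 < c ^+ n by rewrite exprn_gt0.
exists (B / 2 / c ^+ (p + 4)), ((1 + 2 * c) * c ^+ d.+1 + 1); split.
- by rewrite !divr_gt0.
- by rewrite ltr_wpDl// mulr_ge0// ?exprn_ge0 ?ltW// addr_gt0// mulr_gt0.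
move=> T T1; have T0 : 0 < T by exact: lt_le_trans T1.
pose t := (Num.truncn T).+1.
have tT : T <= t%:R by rewrite ltW// truncnS_gt.
have tT2 : t%:R <= 2 * T.
  have /truncn_itv/andP[h _] : 0 <= T by exact: ltW.
  by rewrite /t -natr1; lra.
have t0 : 0 < t%:R :> R by rewrite ltr0n.
pose N := (2 ^ p * t)%N.
have NE : N%:R = 2 ^+ p * t%:R :> R by rewrite natrM natrX.
have N0 : (0 < N)%N by rewrite muln_gt0 expn_gt0.
have NR : 0 < N%:R :> R by rewrite ltr0n.
have p0 : 0 < 2 ^+ p :> R by rewrite exprn_gt0.
have p1 : 1 <= 2 ^+ p :> R by rewrite exprn_ege1// ler1n.
pose M' := mass mu (8 * N%:R)^-1.
have N8 : 0 < (8 * N%:R)^-1 :> R by rewrite invr_gt0 mulr_gt0.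
have M0 : 0 < M' by exact: mass_gt0.
have eps0 : 0 < B / 4 * M' by rewrite mulr_gt0// divr_gt0.
have [n [q [L [[n0 q0] nq HL aq HE]]]] := exists_averaging m N _ cm N0 eps0.
exists L; split.
  move=> x xT.
  have -> : cov K [:: (1, x)] L =
      (\int[mu]_l (multiplier n q l ^+ m * cos (2 * pi * dot l (pos x))))%R.
    rewrite spectral_covE; apply: eq_Rintegral => l _; have [_ _ _ LW] := HL.
    by rewrite /cos_symbol lin_cons lin_nil /= -/(cos_symbol pos L l) (LW l).1 (LW l).2; ring.
  (* For |lambda| <= r and x in the box of size T, the scalar product is at most 1/8, so the phase
     is at most 2 pi / 8 <= 1. *)
  pose r : R := (8 * d%:R * T)^-1.
  have d0 : 0 < d%:R :> R by exact: lt_le_trans dR.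
  have dT0 : 0 < 8 * d%:R * T by rewrite !mulr_gt0.
  have r0 : 0 < r by rewrite invr_gt0.
  have Nr : 2 ^+ p / (8 * d%:R) <= N%:R * r.
    have rE : r * (8 * d%:R) = T^-1 by rewrite /r; field; rewrite !gt_eqF.
    by rewrite ler_pdivrMr ?mulr_gt0// -mulrA rE ler_pdivlMr// NE ler_wpM2l// ltW.
  have := multiplier_pairing mu c c1 doubling n q m n0 q0 cm r (pos x) r0 _ _.
  rewrite nq => /(_ _ _)/wrap[||H].
  - have : 1 <= 2 ^+ p / d%:R :> R by rewrite ler_pdivlMr// mul1r.
    have -> : 2 ^+ p / d%:R = 8 * (2 ^+ p / (8 * d%:R)) :> R by field; rewrite gt_eqF.
    by rewrite -mulrA; lra.
  - move=> l lr; have pi4 : pi <= 4 :> R by have /andP[_ h] := @pihalf_02 R; lra.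
    have pi0 := pi_gt0 R.
    have dl : `|dot l (pos x)| <= d%:R * (r * T).
      apply: (le_trans (ler_norm_sum _ _ _)).
      rewrite -[X in X%:R * _](card_ord d) mulr_natl -sumr_const; apply: ler_sum => i _.
      by rewrite normrM ler_pM// (le_trans (coord_le_enorm l i)).
    have dr : d%:R * (r * T) = 8^-1 by rewrite /r; field; rewrite !gt_eqF.
    rewrite !normrM ger0_norm// (ger0_norm (ltW pi0)).
    by move: dl; rewrite dr; have := normr_ge0 (dot l (pos x)); nra.
  apply: le_trans H; rewrite -/B -/M'.
  have h1 : mass mu T^-1 <= c ^+ (p + 4) * M' :> R.
    apply: mass_scale => //; rewrite ler_pdivlMr ?mulr_gt0//.
    rewrite NE mulrC ler_pdivrMr// exprD; have -> : 2 ^+ 4 = 16 :> R by ring.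
    nra.
  have h2 : mass mu r <= c ^+ p.+1 * M' :> R.
    apply: mass_scale => //; rewrite ler_pdivlMr ?mulr_gt0//.
    rewrite NE mulrC ler_pdivrMr// exprS.
    have : t%:R <= 2 * (d%:R * T) :> R by apply: (le_trans tT2); rewrite ler_wpM2l// ler_peMl// ltW.
    nra.
  have h3 : (4 * d%:R / (N%:R * r) ^+ 2) ^+ m <= G / (4 ^+ m) ^+ p :> R.
    have p4 : 0 < 4 ^+ p :> R by rewrite exprn_gt0.
    have Nr0 : 0 < N%:R * r by exact: mulr_gt0.
    have d8 : 0 < 8 * d%:R :> R by exact: mulr_gt0.
    rewrite /G exprAC -expr_div_n; apply: lerXn2r; rewrite ?nnegrE.
    - by apply: divr_ge0; [exact: mulr_ge0|exact: sqr_ge0].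
    - by apply: divr_ge0 => //; exact: ltW.
    rewrite ler_pdivrMr ?exprn_gt0//.
    apply: le_trans (_ : G1 / 4 ^+ p * (2 ^+ p / (8 * d%:R)) ^+ 2 <= _).
      have -> : 4 ^+ p = (2 ^+ p) ^+ 2 :> R by rewrite -exprM mulnC exprM; congr (_ ^+ p); ring.
      rewrite /G1 le_eqVlt; apply/orP; left; apply/eqP.
      by field; rewrite !gt_eqF.
    apply: ler_wpM2l; first by apply: divr_ge0 => //; exact: ltW.
    by apply: lerXn2r; rewrite ?nnegrE ?(ltW Nr0)//; apply: ltW; exact: divr_gt0.
  have h4 : G / (4 ^+ m) ^+ p * (2 * c * (c ^+ p.+1 * M')) <= B / 4 * M'.
    have -> : G / (4 ^+ m) ^+ p * (2 * c * (c ^+ p.+1 * M')) =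
        G * (2 * c * c) * (c / 4 ^+ m) ^+ p * M'.
      by rewrite expr_div_n exprS; ring.
    rewrite ler_wpM2r ?(ltW M0)//; apply: le_trans pG.
    have h : (c / 4 ^+ m) ^+ p <= 2^-1 ^+ p :> R.
      apply: lerXn2r; rewrite ?nnegrE ?divr_ge0 ?exprn_ge0 ?(ltW c0)//.
      by rewrite ler_pdivrMr ?exprn_gt0//; lra.
    by rewrite -[(2 ^+ p)^-1]exprVn ler_wpM2l// !mulr_ge0 ?(ltW c0).
  have h5 : (4 * d%:R / (N%:R * r) ^+ 2) ^+ m * (2 * c * mass mu r) <= B / 4 * M'.
    apply: le_trans h4; apply: ler_pM => //.
    - by rewrite exprn_ge0// divr_ge0 ?sqr_ge0// mulr_ge0.
    - by rewrite !mulr_ge0 ?mass_ge0 ?(ltW c0).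
    - by rewrite ler_wpM2l// mulr_ge0 ?(ltW c0).
  have h6 : B / 2 / c ^+ (p + 4) * mass mu T^-1 <= B / 2 * M'.
    have b0 : 0 <= B / 2 by rewrite divr_ge0 ?(ltW B0).
    rewrite mulrAC ler_pdivrMr// -[leRHS]mulrA [M' * _]mulrC.
    exact: ler_wpM2l.
  by lra.
have [_ _ _ LW] := HL.
rewrite spectral_covE.
have -> : (\int[mu]_l (cos_symbol pos L l * cos_symbol pos L l + sin_symbol pos L l * sin_symbol pos L l))%R =
    (\int[mu]_l (multiplier n q l ^+ m) ^+ 2)%R.
  by apply: eq_Rintegral => l _; rewrite (LW l).1 (LW l).2; ring.
apply: (le_trans HE); rewrite [leRHS]mulrDl mul1r -[X in _ <= X + _]mulrA lerD//.
  rewrite ler_wpM2l//; first by rewrite addr_ge0// mulr_ge0// ltW.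
  apply: mass_scale; first by rewrite invr_gt0.
  rewrite ler_pdivrMr// mulrAC ler_pdivlMr// exprS -!mulrA ler_wpM2l//.
  apply: ler_pM; rewrite ?(ltW T0)//.
  by rewrite NE (le_trans tT)// ler_peMl// ltW.
have : M' <= mass mu T^-1.
  apply: mass_le; rewrite lef_pV2 ?posrE ?mulr_gt0// NE (le_trans tT)//.
  by rewrite mulrA ler_peMl ?(ltW t0)//; lra.
have : B / 4 * M' <= M' by rewrite ler_piMl ?(ltW M0)//; lra.
lra.
Qed.

End Kernels.

(** * Lower bound on the persistence probability *)

Section RealProbability.
Context {disp : measure_display} {Omega : measurableType disp} {R : realType}.
Variable P : probability Omega R.
Implicit Types A B : set Omega.

Definition prob A : R := fine (P A).

Lemma probE A : measurable A -> P A = (prob A)%:E.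
Proof. by move=> mA; rewrite /prob fineK// fin_num_measure. Qed.

Lemma prob_ge0 A : 0 <= prob A.
Proof. exact: fine_ge0. Qed.

Lemma le_prob A B : measurable A -> measurable B -> A `<=` B -> prob A <= prob B.
Proof. by move=> mA mB AB; rewrite -lee_fin -!probE//; apply: le_measure; rewrite ?inE. Qed.

Lemma prob_setC A : measurable A -> prob (~` A) = 1 - prob A.
Proof.
move=> mA; apply: EFin_inj; rewrite EFinB -!probE//; last exact: measurableC.
exact: probability_setC.
Qed.

Lemma prob_setU_le A B : measurable A -> measurable B -> prob (A `|` B) <= prob A + prob B.
Proof.
move=> mA mB; rewrite -lee_fin EFinD -!probE//; last exact: measurableU.
exact: measureU2.
Qed.

Lemma prob_setI_ge A B : measurable A -> measurable B -> prob A + prob B - 1 <= prob (A `&` B).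
Proof.
move=> mA mB; have := prob_setU_le (~` A) (~` B) (measurableC mA) (measurableC mB).
rewrite -setCI prob_setC; last exact: measurableI.
by rewrite !prob_setC//; lra.
Qed.

Lemma prob_forall_ge (J : finType) (B : J -> set Omega) (eps : R) :
  (forall j, measurable (B j)) -> (forall j, 1 - eps <= prob (B j)) ->
  1 - #|J|%:R * eps <= prob [set w | forall j, B j w].
Proof.
move=> mB Be; pose A (s : seq J) := [set w | forall j : seq_sub s, B (val j) w].
have mA s : measurable (A s) by exact: (measurable_forall (fun j : seq_sub s => B (val j))).
have H s : 1 - (size s)%:R * eps <= prob (A s).
  elim: s => [|j s IH].
    rewrite mul0r subr0 (_ : A [::] = setT) /prob ?probability_setT//.
    by apply/seteqP; split => // w _ [].
  have -> : A (j :: s) = B j `&` A s.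
    apply/seteqP; split => w /=.
      move=> h; split => [|[i si]]; first exact: (h (SeqSub (mem_head j s))).
      by have is' : i \in j :: s by [rewrite inE si orbT]; exact: (h (SeqSub is')).
    move=> [hj hs] [i si] /=; have := si; rewrite inE => /predU1P[->|si'].
      exact: hj.
    exact: (hs (SeqSub si')).
  apply: le_trans (prob_setI_ge _ _ (mB j) (mA s)).
  by have := Be j; rewrite /= -natr1 mulrDl mul1r; lra.
have := H (enum J); rewrite -cardE => /le_trans; apply.
apply: le_prob => //; first exact: measurable_forall.
by move=> w h j; have ej : j \in enum J by [rewrite mem_enum]; exact: (h (SeqSub ej)).
Qed.

Lemma prob_forall_nat_ge (B : nat -> set Omega) (r : R) : (forall n, measurable (B n)) ->
  (forall m, r <= prob [set w | forall i : 'I_m, B i w]) ->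
  r <= prob [set w | forall n, B n w].
Proof.
move=> mB H; pose F m := [set w | forall i : 'I_m, B i w].
have mF m : measurable (F m) by exact: (measurable_forall (fun i : 'I_m => B i)).
have FE : [set w | forall n, B n w] = \bigcap_m F m.
  apply/seteqP; split => w /=; first by move=> h m _ i; exact: h.
  by move=> h n; exact: (h n.+1 Logic.I (Ordinal (ltnSn n))).
have c : P (F m) @[m --> \oo] --> P (\bigcap_m F m).
  apply: nonincreasing_cvg_mu => //.
  - by rewrite -ge0_fin_numE// fin_num_measure.
  - by apply: bigcap_measurable.
  - by move=> m n mn; apply/subsetPset => w h i; exact: (h (widen_ord mn i)).
rewrite -lee_fin -probE; last exact: measurable_forall.
rewrite FE -(cvg_lim _ c)//; apply: lime_ge; first by apply/cvg_ex; eexists; exact: c.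
by apply: nearW => m; rewrite (probE _ (mF m)) lee_fin; exact: H.
Qed.

End RealProbability.

Section Barrier.
Context {disp : measure_display} {Omega : measurableType disp} {R : realType}.
Variable P : probability Omega R.
Context {I : eqType}.
Variables (f : I -> Omega -> R) (C : I -> I -> R).
Hypothesis gf : gaussian_field P f C.
Implicit Types L : seq (R * I).

Let C_sym := gf.1.

Lemma gaussian_field_lin_measurable L : measurable_fun setT (fun w => lin L (f^~ w)).
Proof. exact: (gf.2 L).1. Qed.

Lemma cov_cauchy L A : cov C L A ^+ 2 <= cov C L L * cov C A A.
Proof.
have [L0|LN0] := eqVneq (cov C L L) 0.
  by rewrite (cov_cauchy_eq0 P f C gf L A L0) expr0n L0 mul0r.
have Lp : 0 < cov C L L by rewrite lt0r LN0 (gaussian_field_var_ge0 P f C gf).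
have := gaussian_field_var_ge0 P f C gf (scale_form (cov C L L) A ++ scale_form (- cov C L A) L).
rewrite !(cov_cat, cov_catr C C_sym, cov_scale, cov_scaler C C_sym) (covC C C_sym A L).
set V := cov C L L in Lp *; set h := cov C L A; set K := cov C A A => H.
have : 0 <= V * (V * K - h ^+ 2).
  by apply: (le_trans H); rewrite le_eqVlt; apply/orP; left; apply/eqP; ring.
by rewrite pmulr_rge0// subr_ge0.
Qed.

Section Finite.
Variables (J : finType) (y : J -> I) (L : seq (R * I)) (a u : R).
Let V := cov C L L.
Let h j := cov C [:: (1, y j)] L.
Let X w := lin L (f^~ w).
Hypotheses (V0 : 0 < V) (hu : forall j, 0 <= h j /\ V * u <= h j * a).

Let G := [set w | forall j, - u <= f (y j) w - h j / V * X w].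

Lemma measurable_residual_ge (x : I) (k : R) : measurable [set w | - u <= f x w - k * X w].
Proof.
apply: measurable_le_set; apply: measurable_funB; first exact: gaussian_field_measurable gf x.
by apply: measurable_funM => //; exact: gaussian_field_lin_measurable.
Qed.

(* The residual f - (h / V) X is independent of X. *)
Lemma barrier_finite : prob P [set w | a <= X w] * prob P G <=
  prob P [set w | forall j, 0 <= f (y j) w].
Proof.
(* [None] carries X itself and [Some j] the residual at [y j]; all these forms are orthogonal to L,
   the copy of X being added through c. *)
pose Ls (o : option J) := if o is Some j then (1, y j) :: scale_form (- (h j / V)) L else [::].
pose c (o : option J) : R := if o is None then 1 else 0.
pose t (o : option J) : R := if o is None then a else - u.
pose g o := \1_[set v : R | t o <= v] : R -> R.
have orth o : cov C L (Ls o) = 0.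
  case: o => [j|] /=; last by rewrite (covC C C_sym) cov_nil.
  rewrite -[_ :: _]/([:: (1, y j)] ++ _) (cov_catr C C_sym) (cov_scaler C C_sym) (covC C C_sym L).
  by rewrite -/(h j) -/V mulNr divfK ?subrr// gt_eqF.
have linS j w : lin (Ls (Some j)) (f^~ w) = f (y j) w - h j / V * X w.
  by rewrite /= lin_cons lin_scale /= mul1r mulNr.
have mg o : measurable_fun setT (g o).
  apply: measurable_indic; rewrite (_ : [set v | _] = `[t o, +oo[%classic) //.
  by apply/seteqP; split => v /=; rewrite in_itv /= andbT.
have g01 o x : 0 <= g o x <= 1.
  by rewrite /g indicE; case: (_ \in _) => /=; rewrite ?lexx ?ler01.
have := gaussian_field_indep P f C gf _ L Ls c orth g mg g01.
have mX : measurable [set w | a <= X w].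
  exact/measurable_le_set/gaussian_field_lin_measurable.
have mG : measurable G.
  by apply: (measurable_forall (fun j => [set w | - u <= f (y j) w - h j / V * X w])) => j; exact: measurable_residual_ge.
have E1 w : \prod_o g o (lin (Ls o) (f^~ w) + c o * lin L (f^~ w)) =
    \1_([set w | a <= X w] `&` G) w.
  pose B o := [set w | t o <= lin (Ls o) (f^~ w) + c o * lin L (f^~ w)].
  have -> : [set w | a <= X w] `&` G = [set w | forall o, B o w].
    apply/seteqP; split => w' /=.
      move=> [h1 h2] [j|]; rewrite /B /=; last by rewrite /= lin_nil add0r mul1r.
      by have := h2 j; rewrite mul0r addr0 -linS.
    move=> H; split; first by have := H None; rewrite /B /= lin_nil add0r mul1r.
    by move=> j; have := H (Some j); rewrite /B /= mul0r addr0 -linS.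
  rewrite -prod_indic_forall; apply: eq_bigr => o _.
  by rewrite /g !indicE; congr (_%:R); apply/idP/idP; rewrite !inE.
have E2 z : \prod_o g o (lin (Ls o) (f^~ z.1) + c o * lin L (f^~ z.2)) =
    \1_(G `*` [set w | a <= X w]) z.
  pose B o := [set z : Omega * Omega | t o <= lin (Ls o) (f^~ z.1) + c o * lin L (f^~ z.2)].
  have -> : G `*` [set w | a <= X w] = [set z | forall o, B o z].
    apply/seteqP; split => z' /=.
      move=> [h1 h2] [j|]; rewrite /B /=; last by rewrite /= lin_nil add0r mul1r.
      by have := h1 j; rewrite mul0r addr0 -linS.
    move=> H; split; last by have := H None; rewrite /B /= lin_nil add0r mul1r.
    by move=> j; have := H (Some j); rewrite /B /= mul0r addr0 -linS.
  rewrite -prod_indic_forall; apply: eq_bigr => o _.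
  by rewrite /g !indicE; congr (_%:R); apply/idP/idP; rewrite !inE.
under eq_integral do rewrite E1.
under [X in _ = X -> _]eq_integral do rewrite E2.
rewrite !integral_indic ?setIT//; [|exact: measurableX|exact: measurableI].
move=> H.
have PE : (P \x P)%E (G `*` [set w | a <= X w]) = (prob P G * prob P [set w | a <= X w])%:E.
  pose A := [set w | a <= X w].
  transitivity (P G * P A)%E; first exact: product_measure1E.
  by rewrite (probE P G mG) (probE P A mX).
rewrite mulrC -lee_fin -PE -H -probE; last first.
  apply: (measurable_forall (fun j => [set w | 0 <= f (y j) w])) => j.
  by apply: measurable_le_set; exact: gaussian_field_measurable gf _.
apply: le_measure; rewrite ?inE; first exact: measurableI.
  apply: (measurable_forall (fun j => [set w | 0 <= f (y j) w])) => j.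
  by apply: measurable_le_set; exact: gaussian_field_measurable gf _.
move=> w [/= aX Gw] j; have := Gw j; have [h0 hV] := hu j.
have : u <= h j / V * X w.
  apply: (@le_trans _ _ (h j / V * a)).
    by rewrite mulrAC ler_pdivlMr// mulrC.
  by rewrite ler_wpM2l// divr_ge0// ltW.
lra.
Qed.

End Finite.

Lemma barrier_countable (y : nat -> I) L (a u : R) (V := cov C L L)
    (h := fun n => cov C [:: (1, y n)] L) :
  0 < V -> (forall n, 0 <= h n /\ V * u <= h n * a) ->
  prob P [set w | a <= lin L (f^~ w)] *
    prob P [set w | forall n, - u <= f (y n) w - h n / V * lin L (f^~ w)] <=
  prob P [set w | forall n, 0 <= f (y n) w].
Proof.
move=> V0 hu; apply: prob_forall_nat_ge => [n|m].
  by apply: measurable_le_set; exact: gaussian_field_measurable gf _.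
have H := barrier_finite 'I_m (fun i => y i) L a u V0 (fun i => hu i).
apply: le_trans H.
rewrite ler_wpM2l ?prob_ge0//; apply: le_prob.
- by apply: (measurable_forall (fun n => [set w | - u <= f (y n) w - h n / V * lin L (f^~ w)])) => n; exact: measurable_residual_ge.
- by apply: (measurable_forall (fun n : 'I_m => [set w | - u <= f (y n) w - h n / V * lin L (f^~ w)])) => n; exact: measurable_residual_ge.
- by move=> w H i; exact: H.
Qed.

End Barrier.

Section Scales.
Context {R : realType}.

Lemma expR_half_le2 : expR (2^-1) <= 2 :> R.
Proof.
have h : 2^-1 <= expR (- 2^-1) :> R by apply: le_trans (expR_ge1Dx _); lra.
by move: h; rewrite expRN lef_pV2 ?posrE ?expR_gt0.
Qed.

Lemma ln_ge_half (N : nat) : (2 <= N)%N -> 2^-1 <= ln N%:R :> R.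
Proof.
move=> N2; have N0 : 0 < N%:R :> R by rewrite ltr0n (leq_trans _ N2).
rewrite -ler_expR lnK ?posrE//; apply: (le_trans expR_half_le2).
by rewrite ler_nat.
Qed.

Lemma exists_dyadic_scale (x : R) : 1 <= x -> exists k : nat, x <= 2 ^+ k <= 2 * x.
Proof.
move=> x1; have ex : exists k, x <= 2 ^+ k.
  exists (Num.truncn x).+1; apply: ltW; apply: (lt_le_trans (truncnS_gt _)).
  by rewrite -natrX ler_nat ltnW// ltn_expl.
have := ex_minnP ex => -[[|k] xk kmin]; first by exists 0%N; rewrite xk expr0; lra.
exists k.+1; rewrite xk exprS ler_pM2l//= ltW// ltNge; apply/negP => /kmin.
by rewrite ltnn.
Qed.

(** Budget of the union bound: with 2^k of order log N, the failure probability 9^-(2^k) of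
    Fernique's estimate, times the number of unit cells, is at most 1/8. It uses 2 N + 1 <= N^3 and
    8 <= N^3. *)
Lemma cells_bound (N k d : nat) : (0 < d)%N -> (2 <= N)%N -> (3 * d + 3)%:R * ln N%:R <= 2 ^+ k :> R ->
  8 * (N.*2.+1 ^ d)%:R <= 9 ^+ (2 ^ k) :> R.
Proof.
move=> d0 N2 xk; have N0 : 0 < N%:R :> R by rewrite ltr0n (leq_trans _ N2).
have e9 : expR 1 <= 9 :> R.
  have -> : 1 = 2^-1 + 2^-1 :> R by field.
  rewrite expRD; have := expR_half_le2; have := expR_gt0 (2^-1 : R); nra.
apply: (@le_trans _ _ (expR 1 ^+ (2 ^ k))); last first.
  by rewrite lerXn2r ?nnegrE ?expR_ge0.
rewrite -expRM_natl mulr1 natrX; apply: (@le_trans _ _ (expR ((3 * d + 3)%:R * ln N%:R))); last first.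
  by rewrite ler_expR natrX.
rewrite expRM_natl lnK ?posrE// -!natrX -natrM ler_nat.
rewrite expnD expnM mulnC leq_mul//; last by rewrite (@leq_exp2r 2 N 3).
rewrite leq_exp2r// -addnn; nia.
Qed.

End Scales.

Section UnitCells.
Context {disp : measure_display} {Omega : measurableType disp} {R : realType}.
Context {d : nat} {I : zmodType}.
Variables (f : I -> Omega -> R) (io : 'rV[int]_d -> I) (cell : nat -> I).
Hypothesis mf : forall x, measurable_fun setT (f x).

Definition cells_persist (N : nat) : set Omega :=
  [set w | forall z : 'rV[int]_d, (forall l, `|z 0 l| <= N%:Z) ->
     forall n, 0 <= f (io z + cell n) w].

Section Boxes.
Variable N : nat.

Let box := {ffun 'I_d -> 'I_(N.*2.+1)}.
Let zi (b : box) : 'rV[int]_d := \row_l ((b l)%:Z - N%:Z).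
Let b0 : box := [ffun=> ord0].
Let idx (m : nat) : box * nat := odflt (b0, 0%N) (unpickle m).
Definition cell_site (m : nat) : I := io (zi (idx m).1) + cell (idx m).2.

Let y := cell_site.

Lemma cells_persistE : cells_persist N = [set w | forall m, 0 <= f (y m) w].
Proof.
apply/seteqP; split => w /= H.
  move=> m; apply: H => l; rewrite !mxE; have := ltn_ord ((idx m).1 l).
  by lia.
move=> z zN n.
have bl l : (absz (z 0 l + N%:Z)%R < N.*2.+1)%N by have := zN l; lia.
pose b : box := [ffun l => Ordinal (bl l)].
have := H (pickle (b, n)); rewrite /y /cell_site /idx pickleK /=; congr (_ <= f (io _ + _) _).
by apply/rowP => l; rewrite !mxE ffunE /=; have := zN l; lia.
Qed.

Lemma measurable_cells_persist : measurable (cells_persist N).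
Proof.
rewrite cells_persistE; apply: (measurable_forall (fun m => [set w | 0 <= f (y m) w])) => m.
exact: measurable_le_set.
Qed.

Variable pos : I -> 'rV[R]_d.
Hypothesis posD : forall x y, pos (x + y) = pos x + pos y.
Hypothesis pos_io : forall z, pos (io z) = map_mx intr z.
Hypothesis pos_cell : forall n l, `|pos (cell n) 0 l| <= 1.

Lemma pos_cell_site m : (0 < N)%N -> forall l, `|pos (y m) 0 l| <= 2 * N%:R.
Proof.
move=> N0 l; rewrite posD pos_io !mxE.
have h1 : `|((((idx m).1 l)%:Z - N%:Z)%:~R : R)| <= N%:R.
  rewrite intrD rmorphN /= ler_norml.
  move: (ltn_ord ((idx m).1 l)); move: (nat_of_ord ((idx m).1 l)) => v.
  rewrite ltnS -(ler_nat R) -addnn natrD -[v%:~R]/(v%:R) -[N%:~R]/(N%:R).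
  by have := ler0n R v; lra.
apply: (le_trans (ler_normD _ _)).
have := pos_cell (idx m).2 l; have : 1 <= N%:R :> R by rewrite ler1n.
by lra.
Qed.

End Boxes.

End UnitCells.

Section PersistenceLowerBound.
Context {disp : measure_display} {Omega : measurableType disp} {R : realType}.
Variable P : probability Omega R.
Context {d : nat} {I : zmodType}.
Variable pos : I -> 'rV[R]_d.
Hypothesis posD : forall x y, pos (x + y) = pos x + pos y.
Variable mu : {finite_measure set (borel R d) -> \bar R}.
Variable c : R.
Hypothesis d_gt0 : (0 < d)%N.
Hypothesis c1 : 1 <= c.
Hypothesis doubling : forall r, 0 < r -> mass mu (2 * r) <= c * mass mu r.
Hypothesis mass_gt0 : forall r, 0 < r -> 0 < mass mu r.
Hypothesis fine_grid : forall eps : R, 0 < eps -> exists (q : nat) (e : 'I_d -> I),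
  [/\ (0 < q)%N, forall l0 l, pos (e l0) 0 l = q%:R^-1 * (l == l0)%:R &
      fine (mu (aliased q)) <= eps].
Let K := spectral_cov pos mu.
Variable f : I -> Omega -> R.
Hypothesis gf : gaussian_field P f K.
Variable io : 'rV[int]_d -> I.
Hypothesis pos_io : forall z, pos (io z) = map_mx intr z.
(* Meant to be dense in the unit cell. *)
Variable cell : nat -> I.
Hypothesis pos_cell : forall n l, `|pos (cell n) 0 l| <= 1.
Variable s0 : R.
Hypothesis cell_bound : forall z,
  9 / 10 <= prob P [set w | forall n, `|f (io z + cell n) w| <= s0].

Let mf x : measurable_fun setT (f x). Proof. exact: gaussian_field_measurable gf x. Qed.

Let c0 : 0 < c. Proof. exact: lt_le_trans c1. Qed.

Let m0 := fine (mu setT).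

Let m0_gt0 : 0 < m0.
Proof. exact: lt_le_trans (mass_gt0 1 ltr01) (mass_le_total mu 1). Qed.

(** Dominates s0, and its square dominates the variance m0; it is also at least 1. *)
Let s1 := `|s0| + m0 + 1.

Section Scale.
Variables (N k : nat).
Let box := {ffun 'I_d -> 'I_(N.*2.+1)}.
Let zi (b : box) : 'rV[int]_d := \row_l ((b l)%:Z - N%:Z).
Let y := cell_site io cell N.
Variables (L : seq (R * I)) (u : R).
Let V := cov K L L.
Let h m := cov K [:: (1, y m)] L.
Let X w := lin L (f^~ w).

(** Three events, each failing with probability at most 1/8: |f| <= u / 2 on all cells, X < t and -
    X < t. By Cauchy-Schwarz |h / V| <= sqrt (m0 / V), so the last two bound the subtracted term by
    u / 2. *)
Lemma residual_bound : (2 <= N)%N -> (3 * d + 3)%:R * ln N%:R <= 2 ^+ k :> R ->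
  0 < V -> u = 10 * s1 * Num.sqrt 2 ^+ k ->
  2^-1 <= prob P [set w | forall m, - u <= f (y m) w - h m / V * X w].
Proof.
move=> N2 xk V0 uE.
have s10 : 1 <= s1 by rewrite /s1; have := normr_ge0 s0; have := ltW m0_gt0; lra.
have s1m : m0 <= s1 ^+ 2.
  have : m0 <= s1 by rewrite /s1; have := normr_ge0 s0; lra.
  by rewrite expr2; nra.
have r2 : Num.sqrt 2 ^+ 2 = 2 :> R by rewrite sqr_sqrtr.
have q0 : 0 <= Num.sqrt 2 ^+ k :> R by rewrite exprn_ge0.
have u0 : 0 <= u by rewrite uE !mulr_ge0// ltW// (lt_le_trans _ s10).
have u2 : u ^+ 2 = 100 * s1 ^+ 2 * 2 ^+ k.
  by rewrite uE !exprMn -[(_ ^+ k) ^+ 2]exprM mulnC exprM r2; ring.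
have two1 : 1 <= 2 ^+ k :> R by rewrite exprn_ege1// ler1n.
pose B (b : box) := [set w | forall n, `|f (io (zi b) + cell n) w| <= u / 2].
have mB b : measurable (B b).
  by apply: (measurable_forall (fun n => [set w | `|f (io (zi b) + cell n) w| <= u / 2])) => n; exact: measurable_norm_le.
have B_ge b : 1 - 9^-1 ^+ (2 ^ k) <= prob P (B b).
  have h9 : 9 / 10 <= prob P [set w | forall n, `|f (io (zi b) + cell n) w| <= s1].
    apply: (le_trans (cell_bound (zi b))).
    have mn (s : R) : measurable [set w | forall n, `|f (io (zi b) + cell n) w| <= s].
      by apply: (measurable_forall (fun n => [set w | `|f (io (zi b) + cell n) w| <= s])) => n; exact: measurable_norm_le.
    apply: le_prob => // w H n; apply: le_trans (H n) _.
    by apply: (le_trans (ler_norm _)); rewrite /s1; have := ltW m0_gt0; lra.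
  have := fernique_countable P f K gf (fun n => io (zi b) + cell n) s1 k.
  rewrite !probE//; last 2 first.
  - by apply: (measurable_forall (fun n => [set w | `|f (io (zi b) + cell n) w| <= 5 * s1 * Num.sqrt 2 ^+ k])) => n; exact: measurable_norm_le.
  - by apply: (measurable_forall (fun n => [set w | `|f (io (zi b) + cell n) w| <= s1])) => n; exact: measurable_norm_le.
  rewrite !lee_fin => /(_ _ h9)/wrap[|]; first exact: le_trans s10.
  by rewrite /B; have -> : u / 2 = 5 * s1 * Num.sqrt 2 ^+ k by rewrite uE; field.
pose E1 := [set w | forall b, B b w].
have mE1 : measurable E1 by exact: measurable_forall.
have PE1 : 1 - 8^-1 <= prob P E1.
  apply: le_trans (prob_forall_ge P _ B _ mB B_ge).
  rewrite lerD2l lerN2 card_ffun !card_ord exprVn ler_pdivrMr ?exprn_gt0//.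
  have := cells_bound N k d d_gt0 N2 xk; lra.
(* Chosen so that sqrt (m0 / V) t = u / 2. *)
pose t := u * Num.sqrt V / (2 * Num.sqrt m0).
have sm0 : 0 < Num.sqrt m0 by rewrite sqrtr_gt0.
have t0 : 0 <= t by rewrite divr_ge0// mulr_ge0.
have tV : t ^+ 2 / (2 * V) = u ^+ 2 / (8 * m0).
  rewrite /t expr_div_n !exprMn !sqr_sqrtr ?ltW//.
  by field; rewrite !gt_eqF.
have tail_le : expR (- (t ^+ 2 / (2 * V))) <= 8^-1.
  rewrite tV u2; have : 12 <= 100 * s1 ^+ 2 * 2 ^+ k / (8 * m0).
    rewrite ler_pdivlMr ?mulr_gt0//; have := m0_gt0; nra.
  set v := _ / _ => v12; rewrite expRN lef_pV2 ?posrE ?expR_gt0//.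
  by apply: le_trans (expR_ge1Dx _); lra.
have tail Y : gaussian_mgf P Y V -> 1 - 8^-1 <= prob P [set w | Y w < t].
  move=> gY; have mY : measurable [set w | t <= Y w] by apply: measurable_le_set; exact: gY.1.
  have -> : [set w | Y w < t] = ~` [set w | t <= Y w].
    by apply/seteqP; split => w /=; rewrite ltNge => /negP.
  rewrite prob_setC// lerD2l lerN2; apply: le_trans tail_le.
  rewrite -lee_fin -probE//; exact: (gaussian_mgf_tail P Y V gY).
pose E2 := [set w | X w < t]; pose E3 := [set w | - X w < t].
have PE2 : 1 - 8^-1 <= prob P E2 by apply: tail; exact: gf.2.
have PE3 : 1 - 8^-1 <= prob P E3 by apply: tail; apply: gaussian_mgfN; exact: gf.2.
have mX : measurable_fun setT X by exact: (gf.2 L).1.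
have mlt (Y : Omega -> R) : measurable_fun setT Y -> measurable [set w | Y w < t].
  move=> mY; have := mY measurableT `]-oo, t[%classic (measurable_itv _).
  by rewrite setTI; congr measurable; apply/seteqP; split => w /=; rewrite in_itv.
have mE2 : measurable E2 by exact: mlt.
have mE3 : measurable E3 by apply: mlt; exact: measurable_funN.
have H12 := prob_setI_ge P E1 E2 mE1 mE2.
have H123 := prob_setI_ge P (E1 `&` E2) E3 (measurableI _ _ mE1 mE2) mE3.
apply: (@le_trans _ _ (prob P (E1 `&` E2 `&` E3))); first by lra.
apply: le_prob.
- by apply: measurableI => //; exact: measurableI.
- by apply: (measurable_forall (fun m => [set w | - u <= f (y m) w - h m / V * X w])) => m; exact: (measurable_residual_ge P f K gf).
move=> w [[h1 h2] h3] m.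
have f1 : `|f (y m) w| <= u / 2 by exact: h1.
have f2 : `|h m / V * X w| <= u / 2.
  have hX : `|X w| <= t by rewrite ler_norml; move: h2 h3; rewrite /E2 /E3 /=; lra.
  have hh : `|h m| <= Num.sqrt m0 * Num.sqrt V.
    rewrite -sqrtrM ?(ltW m0_gt0)// -sqrtr_sqr; apply: ler_wsqrtr.
    have := cov_cauchy P f K gf [:: (1, y m)] L.
    by rewrite cov1 /K spectral_cov_diag.
  rewrite !normrM normfV (gtr0_norm V0).
  apply: (@le_trans _ _ (Num.sqrt m0 * Num.sqrt V / V * t)).
    by rewrite ler_pM ?divr_ge0 ?(ltW V0)// ler_wpM2r ?invr_ge0 ?(ltW V0).
  have VE : V = Num.sqrt V ^+ 2 by rewrite sqr_sqrtr ?ltW.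
  have sV : 0 < Num.sqrt V by rewrite sqrtr_gt0.
  rewrite {2}VE /t le_eqVlt; apply/orP; left; apply/eqP.
  by field; rewrite !gt_eqF.
by move: f1 f2; rewrite !ler_norml => /andP[? ?] /andP[? ?]; lra.
Qed.

End Scale.

Theorem persistence_lower_bound : exists2 D : R, 0 < D & forall N, (2 <= N)%N ->
  expR (- (D * (ln N%:R / mass mu N%:R^-1))) <= prob P (cells_persist f io cell N).
Proof.
have [kappa [C [k0 C0 hbar]]] := exists_barrier pos posD mu c d_gt0 c1 doubling mass_gt0 fine_grid.
pose q : R := (Num.sqrt (2 * pi))^-1 * expR (- 1) / 2.
have pi0 := pi_gt0 R.
have q0 : 0 < q by rewrite divr_gt0// mulr_gt0 ?expR_gt0// invr_gt0 sqrtr_gt0 mulr_gt0.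
have s10 : 1 <= s1 by rewrite /s1; have := normr_ge0 s0; have := ltW m0_gt0; lra.
pose D1 : R := 200 * s1 ^+ 2 * (3 * d + 3)%:R * C * c / kappa ^+ 2.
have D10 : 0 < D1.
  apply: divr_gt0; last exact: exprn_gt0.
  do 4 (apply: mulr_gt0 => [|//]); first by rewrite ltr0n.
  by rewrite exprn_gt0// (lt_le_trans _ s10).
exists (D1 + 2 * m0 * `|ln q|).
  by rewrite ltr_wpDr// !mulr_ge0// ltW.
move=> N N2; have N0 : (0 < N)%N by exact: ltn_trans N2.
have NR : 0 < N%:R :> R by rewrite ltr0n.
have lnN := @ln_ge_half R N N2.
have [k /andP[xk kx]] : exists k : nat, (3 * d + 3)%:R * ln (N%:R : R) <= 2 ^+ k <= 2 * ((3 * d + 3)%:R * ln (N%:R : R)).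
  apply: exists_dyadic_scale.
  have : 3 <= (3 * d + 3)%:R :> R by rewrite ler_nat leq_addl.
  by nra.
(* The barrier is built at scale 2 N, because a cell based in the box of size N may have coordinates
   up to 2 N in [pos_cell_site]. *)
have T1 : 1 <= 2 * N%:R :> R.
  have : 1 <= N%:R :> R by rewrite ler1n.
  lra.
have [L [hL VL]] := hbar _ T1.
pose M := mass mu (2 * N%:R)^-1; rewrite -/M in hL VL.
have M0 : 0 < M by apply: mass_gt0; rewrite invr_gt0 mulr_gt0.
pose y := cell_site io cell N.
have hy m : kappa * M <= cov K [:: (1, y m)] L.
  by apply: hL; exact: (pos_cell_site io cell N pos posD pos_io pos_cell).
pose V := cov K L L.
have V0 : 0 < V.
  rewrite lt0r (gaussian_field_var_ge0 P f K gf L) andbT.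
  apply/eqP => V0; have := hy 0%N.
  rewrite (covC K gf.1) (cov_cauchy_eq0 P f K gf L [:: (1, y 0%N)] V0).
  by rewrite leNgt mulr_gt0.
pose u : R := 10 * s1 * Num.sqrt 2 ^+ k.
have u0 : 0 <= u by rewrite !mulr_ge0 ?exprn_ge0// (le_trans _ s10).
(* The level of X at which the predicted mean, at least kappa M a / V, compensates the residual -
   u. *)
pose a : R := u * V / (kappa * M).
have kM : 0 < kappa * M by rewrite mulr_gt0.
have a0 : 0 <= a by exact: divr_ge0 (mulr_ge0 u0 (ltW V0)) (ltW kM).
have ha m : 0 <= cov K [:: (1, y m)] L /\ V * u <= cov K [:: (1, y m)] L * a.
  split; first exact: le_trans (ltW kM) (hy m).
  apply: (@le_trans _ _ (kappa * M * a)); last by rewrite ler_wpM2r.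
  by rewrite /a [leRHS]mulrC divfK ?gt_eqF// mulrC.
have := barrier_countable P f K gf y L a u V0 ha.
rewrite -(cells_persistE f io cell N); apply: le_trans.
have s1u : u ^+ 2 = 100 * s1 ^+ 2 * 2 ^+ k.
  by rewrite /u !exprMn -[(_ ^+ k) ^+ 2]exprM mulnC exprM sqr_sqrtr//; ring.
have hG := residual_bound N k L u N2 xk V0 erefl.
have gX : gaussian_mgf P (fun w => lin L (f^~ w)) V by exact: gf.2.
have hX : 2 * q * expR (- (a ^+ 2 / V)) <= prob P [set w | a <= lin L (f^~ w)].
  rewrite -lee_fin -probE; last by apply: measurable_le_set; exact: gX.1.
  apply: le_trans (gaussian_mgf_tail_ge P _ V gX a V0 a0).
  by rewrite lee_fin /q [2 * _]mulrC divfK.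
apply: (@le_trans _ _ (2 * q * expR (- (a ^+ 2 / V)) * 2^-1)); last first.
  by apply: ler_pM => //; rewrite ?mulr_ge0 ?expR_ge0 ?(ltW q0)// invr_ge0.
have -> : 2 * q * expR (- (a ^+ 2 / V)) * 2^-1 = q * expR (- (a ^+ 2 / V)) by field.
rewrite -{2}(lnK q0) -expRD ler_expR.
pose m1 := mass mu N%:R^-1.
have m10 : 0 < m1 by apply: mass_gt0; rewrite invr_gt0.
have m1M : m1 <= c * M.
  have := doubling (2 * N%:R)^-1 _; rewrite invr_gt0 mulr_gt0// => /(_ isT).
  by rewrite /m1 /M; congr (mass _ _ <= _); field; rewrite gt_eqF.
have e1 : a ^+ 2 / V <= D1 * (ln N%:R / m1).
  have -> : a ^+ 2 / V = u ^+ 2 * (V / M) / (kappa ^+ 2 * M).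
    by rewrite /a; field; rewrite !gt_eqF.
  apply: (@le_trans _ _ (100 * s1 ^+ 2 * (2 * ((3 * d + 3)%:R * ln N%:R)) * C / (kappa ^+ 2 * M))).
    have kM2 : 0 < (kappa ^+ 2 * M)^-1 by rewrite invr_gt0 mulr_gt0// exprn_gt0.
    rewrite ler_wpM2r ?(ltW kM2)//.
    apply: ler_pM; rewrite ?sqr_ge0 ?divr_ge0 ?(ltW V0) ?(ltW M0)//.
      by rewrite s1u ler_wpM2l// mulr_ge0 ?sqr_ge0.
    by rewrite ler_pdivrMr.
  have -> : D1 * (ln N%:R / m1) =
      100 * s1 ^+ 2 * (2 * ((3 * d + 3)%:R * ln N%:R)) * C / kappa ^+ 2 * (c / m1).
    by rewrite /D1; field; rewrite !gt_eqF.
  set Z := 100 * _ * _ * C; have Z0 : 0 <= Z.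
    by rewrite !mulr_ge0 ?sqr_ge0 ?(ltW C0)//; lra.
  have -> : Z / (kappa ^+ 2 * M) = Z / kappa ^+ 2 * M^-1 by field; rewrite !gt_eqF.
  rewrite ler_wpM2l ?divr_ge0 ?sqr_ge0//.
  by rewrite -[leLHS]mul1r ler_pdivrMr// mulrAC ler_pdivlMr// mul1r.
(* The ratio ln N / m1 is at least 1 / (2 m0), so the constant prefactor q is absorbed into the
   exponent. *)
have e2 : `|ln q| <= 2 * m0 * `|ln q| * (ln N%:R / m1).
  have h : 1 <= 2 * m0 * (ln N%:R / m1).
    rewrite mulrA ler_pdivlMr// mul1r.
    have : m1 <= m0 by exact: mass_le_total.
    by have := m0_gt0; nra.
  by rewrite mulrAC ler_peMl.
have := ler_norm (- ln q); rewrite normrN -/m1 mulrDl; lra.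
Qed.

End PersistenceLowerBound.

(** * Upper bound on the persistence probability *)

Section AveragedPersistence.
Context {disp : measure_display} {Omega : measurableType disp} {R : realType}.
Variable P : probability Omega R.
Context {I : zmodType}.
Variables (f : I -> Omega -> R).
Hypothesis mf : forall x, measurable_fun setT (f x).

(* Markov's inequality for the weights L: if the weighted mean of nonnegative
   averages is below b / 2, then at least half of them are below b. *)
Lemma averaged_persistence (L : seq (R * I)) (s : seq I) (A : set Omega) (b rho : R) :
  (forall p, p \in L -> 0 <= p.1) -> \sum_(p <- L) p.1 = 1 -> s != [::] -> 0 < b ->
  measurable A ->
  (forall w p x, A w -> p \in L -> x \in s -> 0 <= f (p.2 + x) w) ->
  (forall p, p \in L -> prob P (low_average f [seq p.2 + x | x <- s] b) <= rho) ->
  prob P A <= prob P [set w | b / 2 <= lin (conv_form L (average_form s)) (f^~ w)] + 2 * rho.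
Proof.
move=> L0 L1 s0 b0 mA A0 Erho.
pose X w := lin (conv_form L (average_form s)) (f^~ w).
change (prob P A <= prob P [set w | b / 2 <= X w] + 2 * rho).
have mX : measurable_fun setT X.
  by apply: (@measurable_sum _ _ _ _ _ _ (fun p w => p.1 * f p.2 w)) => p; exact: measurable_funM.
have mXb : measurable [set w | b / 2 <= X w] by exact: measurable_le_set.
pose E (p : R * I) := low_average f [seq p.2 + x | x <- s] b.
have bi (B : set Omega) : measurable B -> bounded_measurable (\1_B : Omega -> R).
  exact: bounded_measurable_indic.
have bE p : bounded_measurable (fun w => p.1 * \1_(E p) w : R).
  by apply: bounded_measurableZ; apply: bi; exact: measurable_low_average.
have ss : 0 < (size s)%:R :> R by rewrite ltr0n lt0n size_eq0.
have pointwise w : \1_A w <= \1_[set w | b / 2 <= X w] w + 2 * \sum_(p <- L) p.1 * \1_(E p) w.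
  have S0 : 0 <= \sum_(p <- L) p.1 * \1_(E p) w.
    by rewrite big_seq; apply: sumr_ge0 => p pL; rewrite mulr_ge0 ?L0// indicE.
  rewrite [leLHS]indicE; have [/set_mem Aw|_] := boolP (w \in A); last first.
    by rewrite addr_ge0 ?indicE// mulr_ge0.
  rewrite [X in _ <= X + _]indicE; have [_|/negP] := boolP (w \in _); first by rewrite lerDl mulr_ge0.
  rewrite inE /= => /negP; rewrite -ltNge => Xb; rewrite add0r.
  have lower : b * (1 - \sum_(p <- L) p.1 * \1_(E p) w) <= X w.
    rewrite -L1 -sumrB mulr_sumr /X lin_conv /lin big_seq [leRHS]big_seq.
    apply: ler_sum => p pL; rewrite big_map /= -[X in X - _]mulr1 -mulrBr mulrCA.
    rewrite ler_wpM2l ?L0// -mulr_sumr.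
    have sum0 : 0 <= \sum_(x <- s) f (p.2 + x) w.
      by rewrite big_seq; apply: sumr_ge0 => x xs; exact: A0.
    rewrite indicE; have [_|/negP] := boolP (w \in _).
      by rewrite subrr mulr0 mulr_ge0 ?invr_ge0.
    rewrite subr0 mulr1 inE => nE; rewrite mulrC ler_pdivlMr// leNgt; apply/negP => H.
    apply: nE; split.
      by move=> _ /mapP[x xs ->]; exact: A0.
    by rewrite big_map size_map mulrC ltW.
  have : b * (1 - \sum_(p <- L) p.1 * \1_(E p) w) < b * 2^-1 by exact: le_lt_trans Xb.
  by rewrite ltr_pM2l//; lra.
have RP (B : set Omega) : measurable B -> (\int[P]_w (\1_B w))%R = prob P B.
  exact: Rintegral_indicT.
rewrite -(RP _ mA) -(RP _ mXb).
apply: (@le_trans _ _ ((\int[P]_w (\1_[set w | b / 2 <= X w] w))%R +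
    2 * \sum_(p <- L) p.1 * prob P (E p))).
  have -> : \sum_(p <- L) p.1 * prob P (E p) = (\int[P]_w (\sum_(p <- L) p.1 * \1_(E p) w))%R.
    rewrite bounded_Rintegral_sum//; apply: eq_bigr => p _.
    rewrite bounded_RintegralZ; last by apply: bi; exact: measurable_low_average.
    by rewrite RP//; exact: measurable_low_average.
  rewrite -bounded_RintegralZ; last exact: bounded_measurable_sum.
  rewrite -bounded_RintegralD; [|exact: bi|by apply: bounded_measurableZ; exact: bounded_measurable_sum].
  apply: le_bounded_Rintegral => //; first exact: bi.
  by apply: bounded_measurableD; [exact: bi|apply: bounded_measurableZ; exact: bounded_measurable_sum].
rewrite lerD2l ler_wpM2l// -[leRHS]mul1r -L1 mulr_suml big_seq [leRHS]big_seq.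
by apply: ler_sum => p pL; rewrite ler_wpM2l ?L0 ?Erho.
Qed.

End AveragedPersistence.

(** * Unpredictable sites in a box *)

Section PivotSites.
Context {R : realType} {d : nat} {I : zmodType}.
Variable pos : I -> 'rV[R]_d.
Hypothesis posD : forall x y, pos (x + y) = pos x + pos y.
Variable io : 'rV[int]_d -> I.
Hypothesis pos_io : forall z, pos (io z) = map_mx intr z.
Variable mu : {finite_measure set (borel R d) -> \bar R}.
Variables (E : set (borel R d)) (cB : R).
Hypotheses (mE : measurable E) (cB0 : 0 < cB) (muE : (0 < mu E)%E).
Hypothesis bessel : forall n (a : {ffun 'I_d -> 'I_n} -> R),
  (\int[mu]_(x in E) (box_poly n a x)%:E <= (cB * \sum_i a i ^+ 2)%:E)%E.
Variable n : nat.
Let box := {ffun 'I_d -> 'I_n}.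

Definition box_site (t : I) (k : box) : I := t + io (\row_l (k l)%:Z).

Lemma pos_box_site t k : pos (box_site t k) = pos t + box_point n k.
Proof. by rewrite posD pos_io; congr (_ + _); apply/rowP => l; rewrite !mxE. Qed.

Lemma box_site_inj t : injective (box_site t).
Proof.
move=> k k' /(congr1 pos); rewrite !pos_box_site => /addrI/rowP kk.
by apply/ffunP => l; have := kk l; rewrite !mxE => /eqP; rewrite eqr_nat => /eqP/val_inj.
Qed.

(** The Gram matrix of the exponentials in L^2 (E), that is, the covariance of the field whose
    spectral measure is mu restricted to E. *)
Definition restricted_cov (i j : box) : R :=
  (\int[mu]_x (\1_E x * cos (2 * pi * dot x (box_point n i - box_point n j))))%R.

Let bcos (v : 'rV[R]_d) : bounded_measurable (fun x : borel R d => \1_E x * cos (2 * pi * dot (x : 'rV[R]_d) v)).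
Proof.
apply: bounded_measurableM; last exact: bounded_measurable_cos.
exact: bounded_measurable_indic.
Qed.

Let bpoly (a : box -> R) : bounded_measurable (box_poly n a : borel R d -> R).
Proof.
apply: (@bounded_measurable_sum _ _ _ _ _ (fun i (x : borel R d) =>
  \sum_j a i * a j * cos (2 * pi * dot (x : 'rV[R]_d) (box_point n i - box_point n j)))) => i.
apply: (@bounded_measurable_sum _ _ _ _ _ (fun j (x : borel R d) =>
  a i * a j * cos (2 * pi * dot (x : 'rV[R]_d) (box_point n i - box_point n j)))) => j.
by apply: bounded_measurableZ; exact: bounded_measurable_cos.
Qed.

Lemma qform_restricted a : qform restricted_cov a = (\int[mu]_x (\1_E x * box_poly n a x))%R.
Proof.
rewrite /qform.
transitivity (\sum_i (\int[mu]_x (\sum_j a i * a j *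
    (\1_E x * cos (2 * pi * dot x (box_point n i - box_point n j)))))%R).
  apply: eq_bigr => i _; rewrite bounded_Rintegral_sum; last first.
    by move=> j; apply: bounded_measurableZ; exact: bcos.
  by apply: eq_bigr => j _; rewrite bounded_RintegralZ//; exact: bcos.
rewrite -bounded_Rintegral_sum; last first.
  by move=> i; apply: bounded_measurable_sum => j; apply: bounded_measurableZ; exact: bcos.
apply: eq_Rintegral => x _; rewrite /box_poly /qform mulr_sumr; apply: eq_bigr => i _.
by rewrite mulr_sumr; apply: eq_bigr => j _; rewrite mulrCA.
Qed.

(** Restricting mu to E can only lower conditional variances. There the Gram matrix is bounded by cB
    and its diagonal is mu E, so [greedy_pivots] keeps a positive fraction of the n^d sites. A
    translation by t multiplies all exponentials by a common phase, hence one list S serves every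
    t. *)
Lemma exists_unpredictable_sites (m : nat) :
  cB * m%:R <= (n ^ d)%:R * (fine (mu E) / 2) ->
  exists S : seq box, size S = m /\ forall t,
    unpredictable (spectral_cov pos mu) (fine (mu E) / 2) [seq box_site t k | k <- S].
Proof.
move=> hm; pose kappa := fine (mu E).
have k0 : 0 < kappa.
  by rewrite fine_gt0// muE ltey_eq fin_num_measure.
have sym i j : restricted_cov i j = restricted_cov j i.
  apply: eq_Rintegral => x _; congr (_ * _).
  by rewrite -cosN -mulrN -dotNr opprB.
have q01 a : 0 <= qform restricted_cov a <= cB * \sum_i a i ^+ 2.
  rewrite qform_restricted; apply/andP; split.
    by apply: Rintegral_ge0 => x _; rewrite mulr_ge0 ?box_poly_ge0// indicE.
  rewrite -lee_fin; apply: le_trans (bessel n a).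
  rewrite /Rintegral fineK; last first.
    have := bounded_measurable_integrable mu _ (bounded_measurableM _ _ (bounded_measurable_indic E mE) (bpoly a)).
    exact: integrable_fin_num.
  rewrite [leRHS]integral_mkcond le_eqVlt; apply/orP; left; apply/eqP.
  apply: eq_integral => x _; rewrite patchE indicE.
  by case: (x \in E); rewrite ?mul1r ?mul0r.
have diag i : kappa <= restricted_cov i i.
  rewrite /restricted_cov /kappa -Rintegral_indicT// le_eqVlt; apply/orP; left; apply/eqP.
  apply: eq_Rintegral => x _; rewrite subrr /dot big1 ?mulr0 ?cos0 ?mulr1// => l _.
  by rewrite mxE mulr0.
have [S Sm [uS pS]] : exists2 s, size s = m & uniq s /\ independent_pivots restricted_cov (kappa / 2) s.
  apply: (greedy_pivots restricted_cov cB kappa (kappa / 2) m) => //.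
  - by rewrite divr_gt0.
  - rewrite card_ffun !card_ord; apply: (le_trans hm); rewrite ler_wpM2l//.
    by rewrite -/kappa; lra.
exists S; split => // t; elim: S {Sm} uS pS => [//|k S IH] /= /andP[kS uS] [hk pS].
split; last exact: IH.
move=> L sL.
(* Collects the coefficients of L site by site, since a site may be repeated in L. *)
pose b i : R := (i == k)%:R + \sum_(p <- L | p.2 == box_site t i) p.1.
have linb (g : I -> R) : lin ((1, box_site t k) :: L) g = \sum_i b i * g (box_site t i).
  rewrite lin_cons mul1r /b.
  under eq_bigr do rewrite mulrDl.
  rewrite big_split /=; congr (_ + _).
    rewrite (bigD1 k)//= eqxx mul1r big1 ?addr0// => i /negbTE ik.
    by rewrite ik mul0r.
  rewrite /lin; under [RHS]eq_bigr do rewrite mulr_suml.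
  rewrite (exchange_big_dep xpredT)//= big_seq [RHS]big_seq; apply: eq_bigr => p pL.
  have /mapP[i iS pi] := allP sL p pL.
  rewrite (big_pred1 i); first by rewrite pi.
  by move=> j; rewrite pi (inj_eq (box_site_inj t)) eq_sym.
have bE i : i \notin S -> b i = (i == k)%:R.
  move=> iS; rewrite /b big_seq_cond big1 ?addr0// => p /andP[pL /eqP pi].
  have /mapP[j jS] := allP sL p pL; rewrite pi => /box_site_inj ij.
  by rewrite ij jS in iS.
apply: (le_trans (hk b bE)); rewrite qform_restricted spectral_covE.
have symb x : cos_symbol pos ((1, box_site t k) :: L) x ^+ 2 + sin_symbol pos ((1, box_site t k) :: L) x ^+ 2 =
    box_poly n b x.
  rewrite /cos_symbol /sin_symbol !linb -sum_cosB /box_poly /qform.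
  apply: eq_bigr => i _; apply: eq_bigr => j _; rewrite !pos_box_site -mulrBr -dotBr.
  by congr (_ * cos (_ * dot _ _)); rewrite opprD addrACA subrr add0r.
apply: le_bounded_Rintegral.
- by apply: bounded_measurableM; [exact: bounded_measurable_indic|exact: bpoly].
- by apply: bounded_measurableD; apply: bounded_measurableM;
    (exact: bounded_measurable_cos_symbol || exact: bounded_measurable_sin_symbol).
move=> x; rewrite -!expr2 symb ler_piMl ?box_poly_ge0// indicE.
Qed.

End PivotSites.

Lemma below_threshold {R : realType} (a b c t : R) : 0 < a -> 0 < b -> 0 < c ->
  1 + a + b + c <= t -> [/\ 0 < t, a <= t, b <= t & c <= t].
Proof. by move=> a0 b0 c0 h; split; lra. Qed.

Lemma ge_of_lt_succ {R : realType} (z x m : R) : 1 <= z -> 2 * z <= x -> x < m + 1 -> z <= m.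
Proof. lra. Qed.

Lemma sqr_half_le_expR {R : realType} (x : R) : 0 <= x -> (x / 2) ^+ 2 <= expR x.
Proof.
move=> x0; have -> : expR x = expR (x / 2) ^+ 2 by rewrite expr2 -expRD; congr expR; field.
rewrite lerXn2r ?nnegrE ?expR_ge0 ?divr_ge0//.
by apply: le_trans (expR_ge1Dx _); lra.
Qed.

Lemma enorm_le {R : realType} {d : nat} (x : 'rV[R]_d) (r : R) : (0 < d)%N ->
  (forall l, `|x 0 l| <= r) -> enorm x <= d%:R * r.
Proof.
move=> d0 xr; have r0 : 0 <= r by apply: le_trans (xr (Ordinal d0)).
rewrite -ler_sqr ?nnegrE ?enorm_ge0 ?mulr_ge0// -dot_self exprMn.
apply: (@le_trans _ _ (d%:R * r ^+ 2)).
  rewrite -[X in _ <= X%:R * _](card_ord d) mulr_natl -sumr_const; apply: ler_sum => l _.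
  by rewrite -expr2 -[leLHS]real_normK ?num_real// lerXn2r ?nnegrE.
by rewrite ler_wpM2r ?sqr_ge0// expr2 ler_peMl// ler1n.
Qed.

Section PersistenceUpperBound.
Context {disp : measure_display} {Omega : measurableType disp} {R : realType}.
Variable P : probability Omega R.
Context {d : nat} {I : zmodType}.
Variable pos : I -> 'rV[R]_d.
Hypothesis posD : forall x y, pos (x + y) = pos x + pos y.
Variable mu : {finite_measure set (borel R d) -> \bar R}.
Variable c : R.
Hypothesis d_gt0 : (0 < d)%N.
Hypothesis c1 : 1 <= c.
Hypothesis doubling : forall r, 0 < r -> mass mu (2 * r) <= c * mass mu r.
Hypothesis mass_gt0 : forall r, 0 < r -> 0 < mass mu r.
Hypothesis fine_grid : forall eps : R, 0 < eps -> exists (q : nat) (e : 'I_d -> I),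
  [/\ (0 < q)%N, forall l0 l, pos (e l0) 0 l = q%:R^-1 * (l == l0)%:R &
      fine (mu (aliased q)) <= eps].
Let K := spectral_cov pos mu.
Variable f : I -> Omega -> R.
Hypothesis gf : gaussian_field P f K.
Variable io : 'rV[int]_d -> I.
Hypothesis pos_io : forall z, pos (io z) = map_mx intr z.
Variables (E : set (borel R d)) (cB : R).
Hypotheses (mE : measurable E) (cB0 : 0 < cB) (muE : (0 < mu E)%E).
Hypothesis bessel : forall n (a : {ffun 'I_d -> 'I_n} -> R),
  (\int[mu]_(x in E) (box_poly n a x)%:E <= (cB * \sum_i a i ^+ 2)%:E)%E.
Variables alpha T1 : R.
Hypothesis alpha_lt : alpha < d%:R.
Hypothesis mass_ge : forall T, T1 <= T -> expR (- (alpha * ln T)) <= mass mu T^-1.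

Let m0 := fine (mu setT).

Let m0_gt0 : 0 < m0.
Proof. exact: lt_le_trans (mass_gt0 1 ltr01) (mass_le_total mu 1). Qed.

Let mf x : measurable_fun setT (f x). Proof. exact: gaussian_field_measurable gf x. Qed.

Theorem persistence_upper_bound : exists2 D : R, 0 < D & exists T0 : R, forall T, T0 <= T ->
  forall A : set Omega, measurable A ->
  (forall w x, A w -> enorm (pos x) <= T -> 0 <= f x w) ->
  prob P A <= expR (- (D * (ln T / mass mu T^-1))).
Proof.
have [C C0 [Ta hW]] := exists_small_average pos posD mu c d_gt0 c1 doubling mass_gt0 fine_grid.
pose kappa := fine (mu E).
have k0 : 0 < kappa by rewrite fine_gt0// muE ltey_eq fin_num_measure.
pose delta : R := kappa / 2; have delta0 : 0 < delta by rewrite divr_gt0.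
(* Half of the gap, so that d - eta = alpha + eta still exceeds alpha. *)
pose eta : R := (d%:R - alpha) / 2; have eta0 : 0 < eta by rewrite divr_gt0 ?subr_gt0.
pose q : R := (Num.sqrt (2 * pi))^-1 * expR (- 1).
have p2 : 2 <= pi :> R by exact: pi_ge2.
have q0 : 0 < q.
  by rewrite mulr_gt0 ?expR_gt0// invr_gt0 sqrtr_gt0 mulr_gt0//; lra.
have q2 : q <= 2^-1.
  apply: (@le_trans _ _ (1 * expR (- 1))).
    rewrite ler_wpM2r ?expR_ge0// invf_le1 ?sqrtr_gt0; last by lra.
    by rewrite -[leLHS]sqrtr1 ler_wsqrtr//; lra.
  rewrite mul1r expRN lef_pV2 ?posrE ?expR_gt0//.
  by have := expR_ge1Dx (1 : R); lra.
have dR : 1 <= d%:R :> R by rewrite ler1n.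
have d2 : 0 < 2 * d%:R :> R by rewrite mulr_gt0//; lra.
have c0 : 0 < c by exact: lt_le_trans c1.
pose c3 : R := kappa / (4 * cB) / (2 * d%:R) ^+ d.
have c30 : 0 < c3 by rewrite !divr_gt0 ?exprn_gt0// mulr_gt0.
pose c5 : R := 3 / 10 * q * c3; have c50 : 0 < c5.
  by apply: mulr_gt0 => //; apply: mulr_gt0 => //; rewrite divr_gt0.
pose C' : R := C * c ^+ (2 * d); have C'0 : 0 < C' by rewrite mulr_gt0// exprn_gt0.
(* 288 = 9 * 16 * 2, from b^2 = eta delta t / 9, the level b / 4, and the factor 2 of the Gaussian
   tail. *)
pose D1 : R := eta * delta / (288 * C').
have ed0 : 0 < eta * delta by exact: mulr_gt0.
have D10 : 0 < D1 by apply: (divr_gt0 ed0); apply: mulr_gt0; [rewrite ltr0n|exact: C'0].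
exists (D1 / 2); first by rewrite divr_gt0.
(* Thresholds for t = ln T: [t1] gives b^2 / (2 m0) >= 9, [t2] gives D1 t <= c5 exp (eta t), and
   [t3] lets half of the exponent absorb the final factor 3. *)
pose t1 : R := 162 * m0 / (eta * delta).
pose t2 : R := 4 * D1 / (c5 * eta ^+ 2).
pose t3 : R := 4 * m0 / D1.
have t10 : 0 < t1 by apply: divr_gt0 ed0; apply: mulr_gt0; [rewrite ltr0n|exact: m0_gt0].
have t20 : 0 < t2 by apply: divr_gt0; apply: mulr_gt0 => //; rewrite exprn_gt0.
have t30 : 0 < t3 by apply: divr_gt0 => //; exact: mulr_gt0.
pose Tb : R := 2 * d%:R * (`|Ta| + 1 + 4 * cB / kappa).
have Tb0 : 0 <= Tb by rewrite !mulr_ge0 ?(ltW d2)// !addr_ge0// divr_ge0 ?mulr_ge0 ?(ltW cB0) ?(ltW k0).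
exists (Tb + `|T1| + expR (1 + t1 + t2 + t3)) => T HT A mA AT.
have TTb : Tb <= T by apply: le_trans HT; rewrite -addrA lerDl addr_ge0// expR_ge0.
have TT1 : T1 <= T.
  apply: le_trans HT; apply: (le_trans (ler_norm T1)); rewrite addrAC lerDr addr_ge0// expR_ge0.
have Texp : expR (1 + t1 + t2 + t3) <= T by apply: le_trans HT; rewrite lerDr addr_ge0.
have T0 : 0 < T by apply: lt_le_trans Texp; rewrite expR_gt0.
pose t := ln T.
have tt : 1 + t1 + t2 + t3 <= t by rewrite -ler_expR lnK.
have [t0 t1t t2t t3t] := below_threshold _ _ _ _ t10 t20 t30 tt.
pose M := mass mu T^-1.
have M0 : 0 < M by apply: mass_gt0; rewrite invr_gt0.
(* The sites of the weight and those of the box each have coordinates at most T', so their sums have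
   Euclidean norm at most 2 d T' = T. *)
pose T' : R := T / (2 * d%:R).
have T'b : `|Ta| + 1 + 4 * cB / kappa <= T' by rewrite ler_pdivlMr// mulrC.
have cBk : 0 < 4 * cB / kappa by apply: divr_gt0 => //; exact: mulr_gt0.
have T'a : Ta <= T' by have := ler_norm Ta; lra.
have T'1 : 1 <= T' by have := normr_ge0 Ta; lra.
have T'k : 4 * cB / kappa <= T' by have := normr_ge0 Ta; lra.
have [[W L] /= [[L0 L1 Lr LW] HV]] := hW T' T'a.
pose n := (Num.truncn T').+1.
have nT : T' <= n%:R by rewrite ltW// truncnS_gt.
pose m := Num.truncn ((n ^ d)%:R * delta / cB).
have nd : T' ^+ d <= (n ^ d)%:R by rewrite natrX lerXn2r ?nnegrE// (le_trans _ T'1).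
have mle : cB * m%:R <= (n ^ d)%:R * delta.
  rewrite mulrC -ler_pdivlMr//.
  have : 0 <= (n ^ d)%:R * delta / cB.
    by apply: divr_ge0; [apply: mulr_ge0; [exact: ler0n|exact: ltW]|exact: ltW].
  by move=> /truncn_itv/andP[].
have T'd : T' <= T' ^+ d.
  by case: (d) d_gt0 => // d' _; rewrite exprS ler_peMr ?exprn_ege1// (le_trans _ T'1).
(* The untruncated value is at least 2, because T' >= 4 cB / kappa; truncation then costs at most a
   factor 2. *)
have mge : c3 * expR (d%:R * t) <= m%:R.
  have e1 : c3 * expR (d%:R * t) = kappa / (4 * cB) * T' ^+ d.
    by rewrite expRM_natl lnK ?posrE// /T' /c3 expr_div_n; ring.
  have x1 : 1 <= kappa / (4 * cB) * T' ^+ d.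
    rewrite -ler_pdivrMl ?divr_gt0 ?mulr_gt0// mulr1 invf_div.
    exact: le_trans T'd.
  have x2 : 2 * (kappa / (4 * cB) * T' ^+ d) <= (n ^ d)%:R * delta / cB.
    have -> : (n ^ d)%:R * delta / cB = 2 * (kappa / (4 * cB) * (n ^ d)%:R).
      by rewrite /delta; field; rewrite gt_eqF.
    by rewrite ler_wpM2l// ler_wpM2l// divr_ge0 ?mulr_ge0 ?(ltW k0) ?(ltW cB0).
  rewrite e1; apply: ge_of_lt_succ x1 x2 _.
  by rewrite natr1 truncnS_gt.
have [S [Sm uS]] := exists_unpredictable_sites pos posD io pos_io mu E cB mE cB0 muE bessel n m mle.
pose s := [seq box_site io n 0 k | k <- S].
have sm : size s = m by rewrite size_map.
have m00 : 0 < m%:R :> R by apply: lt_le_trans mge; rewrite mulr_gt0// expR_gt0.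
have s0 : s != [::] by rewrite -size_eq0 sm; rewrite ltr0n lt0n in m00.
have seqE u : [seq u + x | x <- s] = [seq box_site io n u k | k <- S].
  by rewrite -map_comp; apply: eq_map => k /=; rewrite /box_site addrA addr0.
(* Makes (3 b)^2 / delta = eta t, so that tau = q T^-eta is admissible in
   [unpredictable_persistence]. *)
pose b : R := Num.sqrt (eta * delta * t) / 3.
have edt : 0 < eta * delta * t by exact: mulr_gt0.
have b0 : 0 < b by rewrite divr_gt0 ?sqrtr_gt0.
have b2 : b ^+ 2 = eta * delta * t / 9 by rewrite expr_div_n sqr_sqrtr ?(ltW edt)//; congr (_ / _); ring.
pose tau : R := q * expR (- (eta * t)).
have tau0 : 0 <= tau by rewrite mulr_ge0 ?expR_ge0 ?(ltW q0).
have low u : (forall l, `|pos u 0 l| <= T') ->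
    prob P (low_average f [seq u + x | x <- s] (b / 2)) <= expR (- (3 / 10 * tau * m%:R)).
  move=> uT; rewrite -lee_fin -probE; last exact: measurable_low_average.
  have := unpredictable_persistence P f K gf delta m0 b tau [seq u + x | x <- s] delta0 b0.
  have -> : m%:R = (size [seq u + x | x <- s])%:R :> R by rewrite size_map sm.
  apply.
  - rewrite tau0 /=; apply: (@le_trans _ _ q); last by rewrite div1r.
    by rewrite ler_piMr ?(ltW q0)// -expR0 ler_expR oppr_le0 mulr_ge0 ?(ltW eta0) ?(ltW t0).
  - rewrite -/q /tau exprMn b2 ler_wpM2l ?(ltW q0)// ler_expR le_eqVlt; apply/orP; left; apply/eqP.
    by field; rewrite gt_eqF.
  - have h : 9 <= b ^+ 2 / (2 * m0).
      rewrite b2 ler_pdivlMr ?mulr_gt0//.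
      have h := t1t; rewrite /t1 (ler_pdivrMr _ _ ed0) [t * _]mulrC in h.
      by rewrite ler_pdivlMr//; have -> : 9 * (2 * m0) * 9 = 162 * m0 by ring.
    rewrite expRN div1r lef_pV2 ?posrE ?expR_gt0//.
    have -> : (10 : R) = 1 + 9 by ring.
    by apply: le_trans (expR_ge1Dx _); rewrite lerD2l.
  - by rewrite seqE; exact: uS.
  - by move=> x; rewrite /K spectral_cov_diag.
have A0 w p x : A w -> p \in L -> x \in s -> 0 <= f (p.2 + x) w.
  move=> Aw pL /mapP[k kS ->]; apply: AT => //.
  have -> : T = d%:R * (T' + T') by rewrite /T'; field; rewrite gt_eqF//; exact: lt_le_trans dR.
  apply: enorm_le => // l; rewrite posD mxE (le_trans (ler_normD _ _))// lerD ?Lr//.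
  rewrite /box_site add0r pos_io !mxE ger0_norm ?ler0z//.
  apply: (@le_trans _ _ (Num.truncn T')%:R).
    by rewrite -[_%:~R]/((k l)%:R) ler_nat -ltnS ltn_ord.
  by have /truncn_itv/andP[] : 0 <= T' by exact: le_trans T'1.
have := averaged_persistence P f mf L s A (b / 2) (expR (- (3 / 10 * tau * m%:R))) L0 L1 s0 _ mA A0 _.
move=> /(_ _ _)/wrap[||H].
- by rewrite divr_gt0.
- by move=> p pL; apply: low; exact: Lr.
apply: (le_trans H).
have VM : cov K (conv_form L (average_form s)) (conv_form L (average_form s)) <= C' * M.
  apply: (le_trans (HV s s0)); rewrite /C' -mulrA ler_wpM2l ?(ltW C0)//.
  apply: (mass_scale mu c c1 doubling); first by rewrite invr_gt0.
  rewrite /T' invf_div ler_wpM2r ?invr_ge0 ?(ltW T0)//.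
  by rewrite -natrX -natrM ler_nat ltnW// ltn_expl.
have C'M : 0 < C' * M by rewrite mulr_gt0.
set Q := t / M.
have Q0 : 0 < Q by rewrite divr_gt0.
have tailX : prob P [set w | b / 2 / 2 <= lin (conv_form L (average_form s)) (f^~ w)] <= expR (- (D1 * Q)).
  have gX := gf.2 (conv_form L (average_form s)).
  rewrite -lee_fin -probE; last by apply: measurable_le_set; exact: gX.1.
  have b40 : 0 <= b / 2 / 2 by rewrite !divr_ge0 ?(ltW b0).
  apply: (le_trans (gaussian_mgf_tail P _ _ gX (C' * M) (b / 2 / 2) VM C'M b40)).
  rewrite lee_fin ler_expR lerN2 le_eqVlt; apply/orP; left; apply/eqP.
  have -> : (b / 2 / 2) ^+ 2 = b ^+ 2 / 16 by field.
  rewrite b2 /D1 /Q; field.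
  by rewrite !gt_eqF.
have low2 : expR (- (3 / 10 * tau * m%:R)) <= expR (- (D1 * Q)).
  rewrite ler_expR lerN2.
  have h1 : c5 * expR ((alpha + eta) * t) <= 3 / 10 * tau * m%:R.
    apply: (@le_trans _ _ (3 / 10 * tau * (c3 * expR (d%:R * t)))); last first.
      by rewrite ler_wpM2l// mulr_ge0// divr_ge0.
    have -> : (alpha + eta) * t = - (eta * t) + d%:R * t by rewrite /eta; field.
    by rewrite expRD /c5 /tau le_eqVlt; apply/orP; left; apply/eqP; ring.
  apply: le_trans h1.
  have h2 : Q <= t * expR (alpha * t).
    rewrite /Q ler_wpM2l ?(ltW t0)//.
    rewrite -[expR _]invrK lef_pV2 ?posrE ?invr_gt0 ?expR_gt0//.
    by rewrite -expRN; exact: mass_ge.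
  have h3 : D1 * t <= c5 * expR (eta * t).
    have e2 : (eta * t / 2) ^+ 2 <= expR (eta * t).
      by apply: sqr_half_le_expR; apply: mulr_ge0; exact: ltW.
    apply: (@le_trans _ _ (c5 * (eta * t / 2) ^+ 2)); last by rewrite ler_wpM2l// ltW.
    have ce : 0 < c5 * eta ^+ 2 by apply: mulr_gt0 => //; rewrite exprn_gt0.
    have h := t2t; rewrite /t2 (ler_pdivrMr _ _ ce) in h.
    have -> : c5 * (eta * t / 2) ^+ 2 = t * (c5 * eta ^+ 2) * t / 4 by field.
    by rewrite ler_pdivlMr// mulrAC ler_wpM2r ?(ltW t0)// mulrC.
  apply: (@le_trans _ _ (D1 * t * expR (alpha * t))).
    by rewrite -mulrA ler_wpM2l ?(ltW D10).
  rewrite mulrDl expRD [leRHS]mulrCA [leRHS]mulrC.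
  by apply: ler_wpM2r => //; exact: expR_ge0.
apply: (@le_trans _ _ (3 * expR (- (D1 * Q)))).
  have -> : 3 * expR (- (D1 * Q)) = expR (- (D1 * Q)) + 2 * expR (- (D1 * Q)) by ring.
  by rewrite lerD// ler_wpM2l.
have h3 : 3 <= expR (D1 / 2 * Q).
  have : 2 <= D1 / 2 * Q.
    have QM : t / m0 <= Q.
      apply: ler_wpM2l; first exact: ltW.
      by rewrite lef_pV2 ?posrE ?m0_gt0 ?M0//; exact: mass_le_total.
    have h := t3t; rewrite /t3 (ler_pdivrMr _ _ D10) in h.
    apply: (@le_trans _ _ (D1 / 2 * (t / m0))).
      rewrite mulrA (ler_pdivlMr _ _ m0_gt0); have -> : D1 / 2 * t = t * D1 / 2 by field.
      by rewrite ler_pdivlMr//; have -> : 2 * m0 * 2 = 4 * m0 by ring.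
    by apply: ler_wpM2l => //; apply: divr_ge0 => //; exact: ltW.
  have -> : (3 : R) = 1 + 2 by ring.
  by move=> h; apply: le_trans (expR_ge1Dx _); rewrite lerD2l.
have -> : - (D1 / 2 * Q) = D1 / 2 * Q + - (D1 * Q) by field.
by rewrite [leRHS]expRD ler_wpM2r ?expR_ge0.
Qed.

End PersistenceUpperBound.

(** * Stationary Gaussian fields on the lattice and on the space *)

Section Sites.
Context {R : realType} {d : nat}.

Lemma locD (k : domain) (x y : site R d k) : loc (x + y) = loc x + loc y.
Proof. by case: k x y => //= x y; rewrite map_mxD. Qed.

Definition site_io (k : domain) : 'rV[int]_d -> site R d k :=
  match k return 'rV[int]_d -> site R d k with
  | Continuum => map_mx intr
  | Lattice => id
  end.

Lemma loc_site_io k z : loc (site_io k z) = map_mx intr z.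
Proof. by case: k. Qed.

Lemma measurable_translate_eball (p : 'rV[R]_d) (r : R) :
  measurable ([set l | eball r (l - p)] : set (borel R d)).
Proof.
have mg : measurable_fun setT (fun l : borel R d => enorm ((l : 'rV[R]_d) - p)).
  apply: (@measurableT_comp _ _ _ _ _ _ (@Num.sqrt R) _ (fun l : borel R d => dot ((l : 'rV[R]_d) - p) (l - p))).
    by apply: continuous_measurable_fun => x; exact: sqrt_continuous.
  rewrite (_ : (fun _ => _) = fun l : borel R d => \sum_i ((l : 'rV[R]_d) 0 i - p 0 i) ^+ 2); last first.
    by apply/funext => l; apply: eq_bigr => i _; rewrite !mxE expr2.
  apply: (@measurable_sum _ _ _ _ _ _ (fun i (l : borel R d) => ((l : 'rV[R]_d) 0 i - p 0 i) ^+ 2)) => i.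
  apply: (@measurable_funX _ _ _ _ (fun l : borel R d => (l : 'rV[R]_d) 0 i - p 0 i)).
  by apply: measurable_funB => //; exact: measurable_coord.
have := mg measurableT `]-oo, r]%classic (measurable_itv _).
by rewrite setTI; congr measurable.
Qed.

Lemma measurable_fundamental_domain (k : domain) :
  measurable (fundamental_domain k : set (borel R d)).
Proof.
case: k; first exact: measurableT.
apply: (measurable_forall (fun i : 'I_d => [set l : borel R d | - 2^-1 <= (l : 'rV[R]_d) 0 i < 2^-1])) => i.
have := @measurable_coord R d i measurableT `[- 2^-1, 2^-1[%classic (measurable_itv _).
by rewrite setTI; congr measurable; apply/seteqP; split => l /=; rewrite in_itv.
Qed.

Lemma measurable_periodize_eball (k : domain) (r : R) :
  measurable (periodize k (eball r) : set (borel R d)).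
Proof.
case: k.
  rewrite (_ : periodize _ _ = eball r); first exact: measurable_eball.
  by apply/seteqP; split => [l [p ->]|l lr]; [rewrite subr0|exists 0; rewrite ?subr0].
rewrite (_ : periodize _ _ = \bigcup_(z : 'rV[int]_d) [set l : borel R d | eball r ((l : 'rV[R]_d) - map_mx intr z)]).
  apply: countable_bigcupT_measurable => [|z]; first exact: countableP.
  exact: measurable_translate_eball.
apply/seteqP; split => [l [_ [z _ <-] lz]|l [z _ lz]]; first by exists z.
by exists (map_mx intr z) => //; exists z.
Qed.

(* The origin is a closest point of Z^d to each point of [-1/2, 1/2)^d. *)
Lemma periodize_eball (k : domain) (r : R) (l : 'rV[R]_d) : fundamental_domain k l ->
  periodize k (eball r) l <-> eball r l.
Proof.
case: k => /= hl; split.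
- by move=> [p -> ]; rewrite subr0.
- by move=> lr; exists 0; rewrite ?subr0.
- move=> [_ [z _ <-]]; rewrite /eball /= => /(le_trans _); apply.
  rewrite ler_wsqrtr// /dot; apply: ler_sum => i _; rewrite -!expr2 !mxE.
  rewrite -[leLHS]real_normK ?num_real// -[leRHS]real_normK ?num_real// lerXn2r ?nnegrE//.
  have /andP[l1 l2] := hl i.
  have [z0|z0] := leP (z 0 i) 0; last first.
    have : (1 : R) <= (z 0 i)%:~R by rewrite -[1]/(1%:~R) ler_int.
    move=> z1; apply: (@le_trans _ _ 2^-1); first by rewrite ler_norml l1 ltW.
    by rewrite distrC; apply: le_trans (ler_norm _); lra.
  have [->|zN] := eqVneq (z 0 i) 0; first by rewrite subr0.
  have : (z 0 i)%:~R <= -1 :> R.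
    by rewrite -[-1]/((-1)%:~R) ler_int; lia.
  move=> z1; apply: (@le_trans _ _ 2^-1); first by rewrite ler_norml l1 ltW.
  by apply: le_trans (ler_norm _); lra.
- by move=> lr; exists 0; rewrite ?subr0//; exists 0 => //; apply/rowP => i; rewrite !mxE.
Qed.

Variable mu : {finite_measure set (borel R d) -> \bar R}.

Lemma measure_carrier (k : domain) (A B : set (borel R d)) : mu (~` fundamental_domain k) = 0%E ->
  measurable A -> measurable B -> (forall l, fundamental_domain k l -> A l -> B l) ->
  (mu A <= mu B)%E.
Proof.
move=> mu0 mA mB AB; have mF := measurable_fundamental_domain k.
apply: (@le_trans _ _ (mu (B `|` ~` fundamental_domain k))).
  apply: le_measure; rewrite ?inE//; first by apply: measurableU => //; exact: measurableC.
  move=> l Al; have [Fl|nFl] := pselect (fundamental_domain k (l : 'rV[R]_d)); last by right.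
  by left; exact: AB.
by rewrite -[leRHS]adde0 -mu0; apply: measureU2 => //; exact: measurableC.
Qed.

Lemma ball_massE (k : domain) (r : R) : mu (~` fundamental_domain k) = 0%E ->
  ball_mass k mu r = (mass mu r)%:E.
Proof.
move=> mu0; rewrite /mass fineK ?fin_num_measure//; last exact: measurable_eball.
have mP := measurable_periodize_eball k r; have mE := @measurable_eball R d r.
apply/eqP; rewrite eq_le; apply/andP; split; apply: (measure_carrier k) => // l Fl.
  by move=> /(periodize_eball k r l Fl).
by move=> /(periodize_eball k r l Fl).
Qed.

(** On Z^d the mesh is 1 and the fundamental domain has no aliased frequency; on R^d the aliased
    sets decrease to the empty set as q grows. *)
Lemma exists_fine_grid (k : domain) (eps : R) : mu (~` fundamental_domain k) = 0%E -> 0 < eps ->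
  exists (q : nat) (e : 'I_d -> site R d k),
  [/\ (0 < q)%N, forall l0 l, loc (e l0) 0 l = q%:R^-1 * (l == l0)%:R &
      fine (mu (aliased q)) <= eps].
Proof.
move=> mu0 eps0; case: k mu0 => mu0; last first.
  exists 1%N, (fun l0 => \row_l (l == l0)%:Z); split => //.
    by move=> l0 l; rewrite /= !mxE invr1 mul1r; case: (l == l0).
  have m0 : (mu (aliased 1) <= mu set0)%E.
    apply: (measure_carrier Lattice) => //; first exact: measurable_aliased.
    move=> l Fl [i li]; move: li; rewrite ltNge => /negP; apply.
    by have /andP[l1 l2] := Fl i; rewrite ler_norml; lra.
  rewrite measure0 in m0; have -> : mu (aliased 1) = 0%E.
    by apply/eqP; rewrite eq_le m0 measure_ge0.
  exact: ltW.
pose A q := aliased q : set (borel R d).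
have mA q : measurable (A q) by exact: measurable_aliased.
have cap : \bigcap_q A q = set0.
  apply/seteqP; split => // l H; pose q := (2 * (Num.truncn (enorm (l : 'rV[R]_d))).+1)%N.
  have [i li] := H q Logic.I; move: li; rewrite ltNge => /negP; apply.
  apply: (le_trans (coord_le_enorm _ _)); rewrite /q natrM mulrC mulKf//.
  by rewrite ltW// truncnS_gt.
have cv : mu (A q) @[q --> \oo] --> mu (\bigcap_q A q).
  apply: nonincreasing_cvg_mu => //.
  - by rewrite ltey_eq fin_num_measure.
  - by rewrite cap; exact: measurable0.
  - move=> m n mn; apply/subsetPset => l [i h]; exists i; apply: le_lt_trans h.
    by rewrite ler_wpM2r// ler_nat.
rewrite cap measure0 in cv.
have [q qe q0] : exists2 q, (mu (A q) < eps%:E)%E & (0 < q)%N.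
  have : \forall q \near \oo, (mu (A q) < eps%:E)%E.
    apply: (cv [set y | (y < eps%:E)%E]); apply: open_nbhs_nbhs.
    by split; [exact: open_ereal_lt_ereal|rewrite /= lte_fin].
  move=> [N _ HN]; exists N.+1 => //; exact: HN (leqnSn N).
exists q, (fun l0 => \row_l (q%:R^-1 * (l == l0)%:R)); split => //.
  by move=> l0 l; rewrite /= mxE.
by rewrite -lee_fin fineK ?fin_num_measure// ltW.
Qed.

(** For small delta the logarithm of delta is negative, so an upper bound on the quotient is a power
    lower bound on the mass of the ball. *)
Lemma alpha_plus_mass (k : domain) : mu (~` fundamental_domain k) = 0%E ->
  (alpha_plus k mu < d%:R%:E)%E -> exists alpha T1 : R, alpha < d%:R /\
  forall T, T1 <= T -> expR (- (alpha * ln T)) <= mass mu T^-1.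
Proof.
move=> mu0 /ereal_inf_lt[s [A A0 <-] sd].
have [alpha ad sa] : exists2 alpha : R, alpha < d%:R &
    (ereal_sup [set lne (ball_mass k mu x) / (ln x)%:E | x in A] <= alpha%:E)%E.
  move: sd; case: (ereal_sup _) => [s'| |] sd.
  - by exists s' => //; rewrite lte_fin in sd.
  - by [].
  - by exists (d%:R - 1); [lra|exact: leNye].
have [e /= e0 Ae] := A0.
exists alpha, (1 + 1 + e^-1); split => // T HT.
have ei : 0 < e^-1 by rewrite invr_gt0.
have T1 : 1 < T by lra.
have T0 : 0 < T by lra.
have Ti : 0 < T^-1 by rewrite invr_gt0.
have Te : T^-1 < e.
  by rewrite -[ltRHS]invrK ltf_pV2 ?posrE//; lra.
have AT : A T^-1.
  by apply: Ae => //=; rewrite sub0r normrN gtr0_norm.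
have : (lne (ball_mass k mu T^-1) / (ln T^-1)%:E <= alpha%:E)%E.
  by apply: le_trans sa; apply: ereal_sup_ubound; exists T^-1.
have lnT : 0 < ln T by exact: ln_gt0.
rewrite ball_massE// lnV ?posrE//.
set M := mass mu T^-1; have M0 : 0 <= M by exact: mass_ge0.
have inv : ((- ln T)%:E^-1 = (- (ln T)^-1)%:E)%E.
  by rewrite inver oppr_eq0 gt_eqF//= invrN.
(* A ball of mass 0 would make the quotient +oo, minus infinity over a negative number, against the
   bound alpha. *)
rewrite inv; have [M00|MN0] := leP M 0.
  rewrite /lne M00 mulNyr ltr0_sg ?oppr_lt0 ?invr_gt0// mulN1e /=.
  by rewrite leNgt ltry.
rewrite lne_EFin// -EFinM lee_fin mulrN lerNl ler_pdivlMr// mulNr => h.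
by rewrite -[leRHS]lnK ?posrE// ler_expR.
Qed.

End Sites.

Section PairLaw.
Context {disp : measure_display} {Omega : measurableType disp} {R : realType}.
Variable P : probability Omega R.
Local Open Scope ereal_scope.

(** Measurable rectangles form a pi-system generating the product sigma-algebra, so they determine
    the law of a pair. *)
Lemma pair_law_integral (X Y X' Y' : Omega -> R) (h : R * R -> R) :
  measurable_fun setT X -> measurable_fun setT Y ->
  measurable_fun setT X' -> measurable_fun setT Y' ->
  (forall A B : set R, measurable A -> measurable B ->
     P [set w | A (X w) /\ B (Y w)] = P [set w | A (X' w) /\ B (Y' w)]) ->
  measurable_fun setT h -> (forall z, 0 <= h z)%R ->
  \int[P]_w (h (X w, Y w))%:E = \int[P]_w (h (X' w, Y' w))%:E.
Proof.
move=> mX mY mX' mY' H mh h0.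
have mZ (U V : Omega -> R) : measurable_fun setT U -> measurable_fun setT V ->
    measurable_fun setT (fun w => (U w, V w)) by exact: measurable_fun_pair.
pose Z : {mfun Omega >-> (R * R)%type} := HB.pack (fun w => (X w, Y w)) (isMeasurableFun.Build _ _ _ _ _ (mZ _ _ mX mY)).
pose Z' : {mfun Omega >-> (R * R)%type} := HB.pack (fun w => (X' w, Y' w)) (isMeasurableFun.Build _ _ _ _ _ (mZ _ _ mX' mY')).
have E (U : {mfun Omega >-> (R * R)%type}) : \int[pushforward P U]_z (h z)%:E = \int[P]_w (h (U w))%:E.
  rewrite ge0_integral_pushforward//.
  - exact/measurable_EFinP.
  - by move=> z _; rewrite lee_fin.
rewrite -(E Z) -(E Z'); apply: eq_measure_integral => A mA _.
apply: (measure_unique [set A `*` B | A in measurable & B in measurable] (fun=> setT)) => //.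
- by rewrite measurable_prod_measurableType.
- move=> _ _ [A1 mA1 [B1 mB1 <-]] [A2 mA2 [B2 mB2 <-]].
  exists (A1 `&` A2); first exact: measurableI.
  by exists (B1 `&` B2); [exact: measurableI|rewrite setXI].
- by move=> _; exists setT => //; exists setT => //; rewrite setXTT.
- by rewrite bigcup_const//; exists 0%N.
- by move=> _ [A1 mA1 [B1 mB1 <-]]; exact: H.
- by move=> _; change (P setT < +oo); rewrite probability_setT ltry.
Qed.

End PairLaw.

Section SquareIntegrable.
Context {disp : measure_display} {Omega : measurableType disp} {R : realType}.
Variable P : probability Omega R.
Context {I : Type}.
Variable g : I -> Omega -> R.
Hypothesis g_square : forall x, P.-integrable setT (EFin \o (fun w => g x w ^+ 2)).
Hypothesis g_meas : forall x, measurable_fun setT (g x).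

Lemma integrable_square_mul x y : P.-integrable setT (EFin \o (fun w => g x w * g y w)).
Proof.
have := integrableD measurableT (g_square x) (g_square y).
apply: le_integrable => //; first by apply/measurable_EFinP; exact: measurable_funM.
move=> w _; rewrite /= lee_fin normrM [leRHS]ger0_norm; last by rewrite addr_ge0 ?sqr_ge0.
rewrite -[X in _ <= X + _]real_normK ?num_real// -[X in _ <= _ + X]real_normK ?num_real//.
have := sqr_ge0 (`|g x w| - `|g y w|); have := normr_ge0 (g x w); have := normr_ge0 (g y w).
nra.
Qed.

Lemma integrable_square x : P.-integrable setT (EFin \o g x).
Proof.
have i1 : P.-integrable setT (EFin \o (fun=> 1 : R)) by exact: finite_measure_integrable_cst.
have := integrableD measurableT i1 (g_square x).
apply: le_integrable => //; first exact/measurable_EFinP.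
move=> w _; rewrite /= lee_fin [leRHS]ger0_norm; last by rewrite addr_ge0 ?sqr_ge0.
rewrite -[X in _ <= _ + X]real_normK ?num_real//.
by have := sqr_ge0 (`|g x w| - 1); have := normr_ge0 (g x w); nra.
Qed.

Lemma Rintegral_lin (h : Omega -> R) (L : seq (R * I)) :
  (forall x, P.-integrable setT (EFin \o (fun w => h w * g x w))) ->
  P.-integrable setT (EFin \o (fun w => h w * lin L (g^~ w))) /\
  (\int[P]_w (h w * lin L (g^~ w)))%R = lin L (fun x => (\int[P]_w (h w * g x w))%R).
Proof.
move=> ih; elim: L => [|[a x] L [iL eL]].
  under eq_fun do rewrite lin_nil mulr0.
  split; first exact: finite_measure_integrable_cst.
  by rewrite Rintegral_cst// mul0r lin_nil.
have E w : h w * lin ((a, x) :: L) (g^~ w) = a * (h w * g x w) + h w * lin L (g^~ w).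
  by rewrite lin_cons /=; ring.
have ia : P.-integrable setT (EFin \o (fun w => a * (h w * g x w))).
  by have := integrableZl measurableT a (ih x); apply: eq_integrable.
split.
  have := integrableD measurableT ia iL; apply: eq_integrable => // w _.
  by rewrite /= E.
rewrite lin_cons -eL -RintegralZl// -RintegralD//.
by apply: eq_Rintegral => w _; rewrite E.
Qed.

Lemma Rintegral_lin_sqr L : (\int[P]_w (lin L (g^~ w) ^+ 2))%R =
  cov (fun x y => (\int[P]_w (g x w * g y w))%R) L L.
Proof.
have i1 x := (Rintegral_lin (g x) L (integrable_square_mul x)).
have i2 x : P.-integrable setT (EFin \o (fun w => lin L (g^~ w) * g x w)).
  by have := (i1 x).1; apply: eq_integrable => // w _; rewrite /= mulrC.
have [_ E] := Rintegral_lin (fun w => lin L (g^~ w)) L i2.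
rewrite [RHS]/cov; transitivity (\int[P]_w (lin L (g^~ w) * lin L (g^~ w)))%R.
  by apply: eq_Rintegral => w _; rewrite expr2.
rewrite E; apply: eq_lin => x; rewrite -(i1 x).2.
by apply: eq_Rintegral => w _; rewrite mulrC.
Qed.

End SquareIntegrable.

Section StationaryField.
Context {disp : measure_display} {Omega : measurableType disp} {R : realType}.
Variable P : probability Omega R.
Context {d : nat} {k : domain}.
Variable f : site R d k -> {RV P >-> R}.
Hypothesis f_SGF : is_SGF f.
Let g (x : site R d k) (w : Omega) : R := f x w.

Let mg x : measurable_fun setT (g x).
Proof. exact: measurable_funPT. Qed.

Let g_mgf x : exists2 v, 0 <= v & gaussian_mgf P (g x) v.
Proof.
apply: is_gaussian_centered => //; last exact: sgf_centred f_SGF x.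
have := sgf_gaussian f_SGF (fun _ : 'I_1 => x) (fun=> 1).
by under eq_fun do rewrite big_ord1 mul1r.
Qed.

Let g2 x : P.-integrable setT (EFin \o (fun w => g x w ^+ 2)).
Proof. by have [v _ gv] := g_mgf x; have [] := gaussian_mgf_moment2 P _ v gv. Qed.

Let moment x y : R := (\int[P]_w (g x w * g y w))%R.

(** Integrals are transferred for nonnegative functions, hence the square of a sum instead of a
    product; the covariance is recovered by polarisation in [moment_shift]. *)
Let square_shift x y t : (\int[P]_w ((g x w + g y w) ^+ 2))%R =
  (\int[P]_w ((g (x + t) w + g (y + t) w) ^+ 2))%R.
Proof.
congr fine.
apply: (pair_law_integral P (g x) (g y) (g (x + t)) (g (y + t)) (fun z => (z.1 + z.2) ^+ 2)) => //.
- move=> A B mA mB.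
  pose xs (i : 'I_2) := if i == ord0 then x else y.
  pose As (i : 'I_2) := if i == ord0 then A else B.
  have mAs i : measurable (As i) by rewrite /As; case: ifP.
  have := sgf_stationary f_SGF t xs mAs.
  have E (u : site R d k) : [set w | forall i, As i (f (xs i + u) w)] = [set w | A (g (x + u) w) /\ B (g (y + u) w)].
    apply/seteqP; split => w /=.
      by move=> H; split; [exact: (H ord0)|exact: (H ord_max)].
    by move=> [h1 h2] i; rewrite /As /xs; case: ifP.
  have := E 0; under eq_set do under eq_forall do rewrite addr0.
  by rewrite !addr0 E => -> ->.
- by apply: measurable_funX; apply: measurable_funD.
- by move=> z; exact: sqr_ge0.
Qed.

Let momentD x y : (\int[P]_w ((g x w + g y w) ^+ 2))%R = moment x x + 2 * moment x y + moment y y.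
Proof.
have i := integrable_square_mul P g g2 mg.
have i2 : P.-integrable setT (EFin \o (fun w => 2 * (g x w * g y w))).
  by have := integrableZl measurableT 2 (i x y); apply: eq_integrable.
have i3 : P.-integrable setT (EFin \o (fun w => g x w * g x w + 2 * (g x w * g y w))).
  by have := integrableD measurableT (i x x) i2; apply: eq_integrable.
rewrite /moment -RintegralZl// -RintegralD// -RintegralD//.
by apply: eq_Rintegral => w _; ring.
Qed.

Let moment_shift x y t : moment x y = moment (x + t) (y + t).
Proof.
have diag z : moment z z = moment (z + t) (z + t).
  by have := square_shift z z t; rewrite !momentD; lra.
by have := square_shift x y t; rewrite !momentD (diag x) (diag y); lra.
Qed.

Let momentE x y : moment x y = covariance_kernel f (y - x).
Proof.
rewrite (moment_shift x y (- x)) subrr /moment /covariance_kernel /Rintegral.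
by rewrite unlock.
Qed.

Variable mu : {finite_measure set (borel R d) -> \bar R}.
Hypothesis mu_spectral : is_spectral_measure (covariance_kernel f) mu.

Lemma covariance_kernelE x y : moment x y = spectral_cov loc mu x y.
Proof.
rewrite momentE.
have := congr1 (@complex.Re R) (spectral_fourier mu_spectral (y - x)).
rewrite /= => ->; apply: eq_Rintegral => l _; congr cos.
have locN : loc (y - x) = loc y - loc x.
  by apply: (addIr (loc x)); rewrite -locD !subrK.
by rewrite locN -mulrN -dotNr opprB.
Qed.

Theorem SGF_gaussian_field : gaussian_field P g (spectral_cov loc mu).
Proof.
split; first exact: spectral_covC.
move=> L.
have mL : measurable_fun setT (fun w => lin L (g^~ w)).
  by apply: (@measurable_sum _ _ _ _ _ _ (fun p w => p.1 * g p.2 w)) => p; exact: measurable_funM.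
have [v v0 gv] : exists2 v, 0 <= v & gaussian_mgf P (fun w => lin L (g^~ w)) v.
  apply: is_gaussian_centered => //.
    have := sgf_gaussian f_SGF (fun i : 'I_(size L) => (tnth (in_tuple L) i).2) (fun i => (tnth (in_tuple L) i).1).
    congr is_gaussian; apply/funext => w; rewrite /lin.
    by rewrite (big_tnth _ _ L).
  have i1 x : P.-integrable setT (EFin \o (fun w => 1 * g x w)).
    by have := integrable_square P g g2 mg x; apply: eq_integrable => // w _; rewrite /= mul1r.
  have [iL EL] := Rintegral_lin P g (fun=> 1) L i1.
  rewrite unlock; have iL' : P.-integrable setT (EFin \o (fun w => lin L (g^~ w))).
    by apply: eq_integrable iL => // w _; rewrite /= mul1r.
  rewrite -[LHS]fineK; last exact: integrable_fin_num.
  congr EFin; transitivity (\int[P]_w (1 * lin L (g^~ w)))%R.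
    by apply: eq_Rintegral => w _; rewrite mul1r.
  rewrite EL /lin big1// => p _.
  have := sgf_centred f_SGF p.2; rewrite unlock => E0.
  have -> : (\int[P]_w (1 * g p.2 w))%R = 0.
    rewrite /Rintegral (eq_integral (fun w => (g p.2 w)%:E)) ?E0// => w _.
    by rewrite mul1r.
  by rewrite mulr0.
(* The parameter v of the one-dimensional law is identified by computing the second moment in two
   ways. *)
suff -> : cov (spectral_cov loc mu) L L = v by [].
have [_ E2] := gaussian_mgf_moment2 P _ v gv.
have := Rintegral_lin_sqr P g g2 mg L; rewrite /Rintegral E2 /= => ->.
rewrite /cov; apply: eq_lin => x; apply: eq_lin => y.
by rewrite -covariance_kernelE.
Qed.

End StationaryField.

(** * Sample paths and countable families of sites *)

Section ContinuousReal.
Context {R : realType} {T : topologicalType}.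
Implicit Types f g : T -> R.

Lemma continuous_addR f g : continuous f -> continuous g -> continuous (fun x => f x + g x).
Proof. by move=> cf cg x; apply: cvgD; [exact: cf|exact: cg]. Qed.

Lemma continuous_mulR f g : continuous f -> continuous g -> continuous (fun x => f x * g x).
Proof. by move=> cf cg x; apply: cvgM; [exact: cf|exact: cg]. Qed.

Lemma continuous_invR f : (forall x, f x != 0) -> continuous f -> continuous (fun x => (f x)^-1).
Proof. by move=> f0 cf x; apply: cvgV => //; exact: cf. Qed.

Lemma continuous_maxR f g : continuous f -> continuous g -> continuous (fun x => Num.max (f x) (g x)).
Proof. by move=> cf cg x; apply: continuous_max; [exact: cf|exact: cg]. Qed.

Lemma continuous_minR f g : continuous f -> continuous g -> continuous (fun x => Num.min (f x) (g x)).
Proof. by move=> cf cg x; apply: continuous_min; [exact: cf|exact: cg]. Qed.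

Lemma continuous_cstR (a : R) : continuous (fun _ : T => a).
Proof. exact: cst_continuous. Qed.

End ContinuousReal.

Section RationalPoints.
Context {R : realType} {d : nat}.
Implicit Types x y : 'rV[R]_d.

Lemma continuous_row (phi : 'rV[R]_d -> 'rV[R]_d) :
  (forall l, continuous (fun y => phi y 0 l)) -> continuous phi.
Proof.
move=> H x U [A hA AU]; have : \forall y \near x, forall l, A ord0 l (phi y 0 l).
  by apply: (@filter_forall _ _ _ _ (nbhs_filter x)) => l; exact: (H l x _ (hA ord0 l)).
by apply: filterS => y hy; apply: AU => i j; rewrite (ord1 i); exact: hy.
Qed.

Lemma continuous_enorm : continuous (@enorm R d).
Proof.
move=> x; apply: (@continuous_comp _ _ _ (fun y : 'rV[R]_d => dot y y) (@Num.sqrt R)).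
  have H : forall s : seq 'I_d, continuous (fun y : 'rV[R]_d => \sum_(i <- s) y 0 i * y 0 i).
    elim => [|i s IH].
      rewrite (_ : (fun y => _) = fun=> 0); first exact: cst_continuous.
      by apply/funext => y; rewrite big_nil.
    rewrite (_ : (fun y => _) = fun y : 'rV[R]_d => y 0 i * y 0 i + \sum_(i <- s) y 0 i * y 0 i).
      by apply: continuous_addR => //; apply: continuous_mulR; exact: continuous_coord.
    by apply/funext => y; rewrite big_cons.
  exact: H.
exact: sqrt_continuous.
Qed.

Definition rat_point (q : 'rV[rat]_d) : 'rV[R]_d := map_mx ratr q.

Lemma ge0_of_rat_point (h : 'rV[R]_d -> R) : continuous h ->
  (forall q, 0 <= h (rat_point q)) -> forall x, 0 <= h x.
Proof.
move=> ch hq x; rewrite leNgt; apply/negP => hx.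
have : \forall y \near x, h y < 0.
  by apply: (ch x [set v | v < 0]); apply: open_nbhs_nbhs; split => //; exact: open_lt.
move=> /nbhs_ballP[e /= e0 he].
have q_ex (l : 'I_d) : exists q : rat, `|x 0 l - ratr q| < e.
  have [q] := @rat_in_itvoo R (x 0 l - e) (x 0 l + e) ltac:(lra).
  by rewrite in_itv /= => /andP[? ?]; exists q; rewrite ltr_norml; lra.
pose q : 'rV[rat]_d := \row_l projT1 (cid (q_ex l)).
have := hq q; rewrite leNgt => /negP; apply; apply: he; split => // i l.
by rewrite (ord1 i) !mxE /ball /=; exact: (projT2 (cid (q_ex l))).
Qed.

(** A continuous retraction onto the unit cube, as [retract] is onto a ball. Images of rational
    points form a countable family on which nonnegativity can be tested, boundary points
    included. *)
Definition clamp (y : 'rV[R]_d) : 'rV[R]_d := \row_l Num.max 0 (Num.min 1 (y 0 l)).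

Lemma clamp01 y l : 0 <= clamp y 0 l <= 1.
Proof. by rewrite mxE le_max lexx ge_max ler01 ge_min lexx. Qed.

Lemma clamp_id y : (forall l, 0 <= y 0 l <= 1) -> clamp y = y.
Proof.
move=> H; apply/rowP => l; rewrite mxE; have /andP[h0 h1] := H l.
by rewrite (min_idPr h1) (max_idPr h0).
Qed.

Lemma continuous_clamp : continuous clamp.
Proof.
apply: continuous_row => l.
rewrite (_ : (fun y => _) = fun y : 'rV[R]_d => Num.max 0 (Num.min 1 (y 0 l))); last first.
  by apply/funext => y; rewrite mxE.
apply: continuous_maxR; first exact: continuous_cstR.
apply: continuous_minR; [exact: continuous_cstR|exact: continuous_coord].
Qed.

Variable T : R.
Hypothesis T0 : 0 < T.

Definition retract y : 'rV[R]_d := (T / Num.max T (enorm y)) *: y.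

Let max_gt0 y : 0 < Num.max T (enorm y).
Proof. by rewrite lt_max T0. Qed.

Lemma enorm_scale (a : R) y : 0 <= a -> enorm (a *: y) = a * enorm y.
Proof.
move=> a0; rewrite /enorm; have -> : dot (a *: y) (a *: y) = a ^+ 2 * dot y y.
  by rewrite /dot mulr_sumr; apply: eq_bigr => i _; rewrite !mxE; ring.
by rewrite sqrtrM ?sqr_ge0// sqrtr_sqr ger0_norm.
Qed.

Lemma retract_eball y : eball T (retract y).
Proof.
rewrite /eball /= enorm_scale; last by rewrite divr_ge0 ?(ltW T0) ?(ltW (max_gt0 y)).
by rewrite mulrAC ler_pdivrMr// ler_wpM2l ?(ltW T0)// le_max lexx orbT.
Qed.

Lemma retract_id y : eball T y -> retract y = y.
Proof. by rewrite /eball /= => h; rewrite /retract (max_idPl h) divff ?scale1r// gt_eqF. Qed.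

Lemma continuous_retract : continuous retract.
Proof.
apply: continuous_row => l.
rewrite (_ : (fun y => _) = fun y : 'rV[R]_d => T / Num.max T (enorm y) * y 0 l); last first.
  by apply/funext => y; rewrite mxE.
apply: continuous_mulR; last exact: continuous_coord.
apply: continuous_mulR; first exact: continuous_cstR.
apply: continuous_invR => [y|]; first by rewrite gt_eqF.
by apply: continuous_maxR; [exact: continuous_cstR|exact: continuous_enorm].
Qed.

End RationalPoints.

Section SampleRegularity.
Context {disp : measure_display} {Omega : measurableType disp} {R : realType}.
Variable P : probability Omega R.
Context {d : nat}.

(** On R^d the event is an uncountable intersection; continuity of the paths reduces it to the
    retracted rational points. *)
Lemma measurable_persistence (k : domain) (f : site R d k -> {RV P >-> R}) (T : R) :
  is_SGF f -> 0 < T ->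
  measurable [set w | forall x, eball T (loc x) -> 0 <= f x w].
Proof.
case: k f => f f_SGF T0.
  have -> : [set w | forall x : site R d Continuum, eball T (loc x) -> 0 <= f x w] =
      [set w | forall q : 'rV[rat]_d, 0 <= f (retract T (rat_point q)) w].
    apply/seteqP; split => w /= H; first by move=> q; apply: H; exact: retract_eball.
    move=> x Tx; rewrite -[x](retract_id T T0)//.
    apply: (ge0_of_rat_point (fun y => f (retract T y) w)) => //.
    move=> y; apply: (@continuous_comp _ _ _ (retract T) (fun x : 'rV[R]_d => f x w)).
      exact: continuous_retract.
    exact: (sgf_continuous f_SGF w).
  apply: (measurable_forall (fun q : 'rV[rat]_d => [set w | 0 <= f (retract T (rat_point q)) w])) => q.
  by apply: measurable_le_set; exact: measurable_funPT.
apply: (measurable_forall (fun x : 'rV[int]_d => [set w | eball T (loc (x : site R d Lattice)) -> 0 <= f x w])) => x.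
have [Tx|nTx] := pselect (eball T (loc (x : site R d Lattice))).
  rewrite (_ : [set w | _] = [set w | 0 <= f x w]).
    by apply: measurable_le_set; exact: measurable_funPT.
  by apply/seteqP; split => w /=; [exact|].
by rewrite (_ : [set w | _] = setT) //; apply/seteqP; split => // w _ /nTx.
Qed.

Definition cell (k : domain) : nat -> site R d k :=
  match k return nat -> site R d k with
  | Continuum => fun n => clamp (rat_point (odflt 0 (unpickle n)))
  | Lattice => fun=> 0
  end.

Lemma loc_cell k n l : `|loc (cell k n) 0 l| <= 1.
Proof.
case: k => /=; last by rewrite !mxE normr0.
have /andP[h0 h1] := clamp01 (@rat_point R d (odflt 0 (unpickle n))) l.
by rewrite ger0_norm.
Qed.

Lemma cells_persist_ball (k : domain) (f : site R d k -> {RV P >-> R}) (T : R) (N : nat) w :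
  is_SGF f -> T + 1 <= N%:R ->
  cells_persist (fun x w => f x w) (site_io k) (cell k) N w ->
  forall x, eball T (loc x) -> 0 <= f x w.
Proof.
move=> f_SGF TN; have floor_le (v : R) : `|v| <= T -> `|Num.floor v| <= N%:Z.
  move=> vT; have /andP[h1 h2] := floor_itv v; rewrite -(ler_int R) intr_norm.
  by rewrite intrD in h2; move: vT; rewrite !ler_norml => /andP[v1 v2]; rewrite -[N%:~R]/(N%:R); lra.
case: k f f_SGF => f f_SGF H x Tx.
  pose z : 'rV[int]_d := \row_l Num.floor ((x : 'rV[R]_d) 0 l).
  have zN l : `|z 0 l| <= N%:Z.
    by rewrite mxE; apply: floor_le; apply: le_trans (coord_le_enorm _ _) Tx.
  pose y : 'rV[R]_d := (x : 'rV[R]_d) - map_mx intr z.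
  have xE : x = (map_mx intr z : 'rV[R]_d) + clamp y.
    rewrite clamp_id => [|l]; first by rewrite addrC subrK.
    have := floor_itv ((x : 'rV[R]_d) 0 l); rewrite !mxE intrD; lra.
  rewrite xE; apply: (ge0_of_rat_point (fun y => f ((map_mx intr z : 'rV[R]_d) + clamp y) w)).
    move=> y'; apply: (@continuous_comp _ _ _ (fun y : 'rV[R]_d => (map_mx intr z : 'rV[R]_d) + clamp y) (fun x : 'rV[R]_d => f x w)).
      apply: continuous_row => l.
      rewrite (_ : (fun y => _) = fun y => (map_mx intr z : 'rV[R]_d) 0 l + clamp y 0 l); last first.
        by apply/funext => y''; rewrite mxE.
      apply: continuous_addR; first exact: continuous_cstR.
      move=> y''.
      exact: (continuous_comp (@continuous_clamp R d y'') (@continuous_coord R d l _)).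
    exact: (sgf_continuous f_SGF w).
  by move=> q; have := H z zN (pickle q); rewrite /= pickleK.
have := H x; rewrite /= addr0; apply; last exact: 0%N.
move=> l; have := le_trans (coord_le_enorm (loc (x : site R d Lattice)) l) Tx.
rewrite /= mxE -intr_norm => h; rewrite -(ler_int R) -[N%:~R]/(N%:R).
by apply: (le_trans h); lra.
Qed.

Lemma cell_sample_bounded (k : domain) (f : site R d k -> {RV P >-> R}) w : is_SGF f ->
  exists s : R, forall n, `|f (cell k n) w| <= s.
Proof.
case: k f => f f_SGF; last by exists `|f 0 w|.
have cf : continuous (fun x : 'rV[R]_d => f x w) by exact: (sgf_continuous f_SGF w).
pose Q : set 'rV[R]_d := [set v | forall l, `[0, 1]%classic (v 0 l)].
have cQ : compact Q by apply: (@rV_compact R d (fun=> `[0, 1]%classic)) => l; exact: segment_compact.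
have := compact_bounded (continuous_compact (continuous_subspaceT cf) cQ).
move=> [M [_ HM]]; exists (M + 1) => n; apply: (HM (M + 1)); first by rewrite ltrDl.
exists (clamp (rat_point (odflt 0 (unpickle n)))) => // l /=.
by rewrite in_itv /=; exact: clamp01.
Qed.

(** Each path is bounded on the unit cell, by compactness on R^d, so some level works with
    probability 9/10; stationarity carries it to every cell. This is the starting point of
    Fernique's iteration. *)
Lemma exists_cell_bound (k : domain) (f : site R d k -> {RV P >-> R}) : is_SGF f ->
  exists s : R, forall z, 9 / 10 <= prob P [set w | forall n, `|f (site_io k z + cell k n) w| <= s].
Proof.
move=> f_SGF; pose B (x : site R d k) (s : R) n := [set w | `|f (x + cell k n) w| <= s].
have mB x s n : measurable (B x s n) by apply: measurable_norm_le; exact: measurable_funPT.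
pose A (s : nat) := [set w | forall n, B 0 s%:R n w].
have mA s : measurable (A s) by exact: measurable_forall.
have AT : \bigcup_s A s = setT.
  apply/seteqP; split => // w _; have [s hs] := cell_sample_bounded k f w f_SGF.
  exists (Num.truncn s).+1 => // n; rewrite /B /= add0r; apply: (le_trans (hs n)).
  by rewrite ltW// truncnS_gt.
have cv : P (A s) @[s --> \oo] --> P (\bigcup_s A s).
  apply: nondecreasing_cvg_mu => //; first by rewrite AT.
  by move=> s s' ss; apply/subsetPset => w h n; apply: le_trans (h n) _; rewrite ler_nat.
rewrite AT probability_setT in cv.
have [s hs] : exists s, ((9 / 10)%:E < P (A s))%E.
  have : \forall s \near \oo, ((9 / 10)%:E < P (A s))%E.
    apply: (cv [set y | ((9 / 10)%:E < y)%E]); apply: open_nbhs_nbhs.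
    by split; [exact: open_ereal_gt_ereal|rewrite /= lte_fin; lra].
  by move=> [N _ HN]; exists N; exact: HN (leqnn N).
(* Stationarity concerns finitely many sites at a time, hence the passage through finite
   sections. *)
exists s%:R => z; apply: prob_forall_nat_ge => [n|m]; first exact: mB.
have <- : prob P [set w | forall i : 'I_m, B 0 s%:R i w] =
    prob P [set w | forall i : 'I_m, B (site_io k z) s%:R i w].
  congr fine.
  have mN : measurable [set v : R | `|v| <= s%:R] by exact: (measurable_norm_le id).
  have := sgf_stationary f_SGF (site_io k z) (fun i : 'I_m => 0 + cell k i) (fun=> mN).
  by rewrite /B => /esym; under [X in _ = P X]eq_set do under eq_forall do rewrite add0r addrC.
rewrite -lee_fin -probE; last exact: measurable_forall.
apply: (le_trans (ltW hs)); apply: le_measure; rewrite ?inE//; first exact: measurable_forall.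
by move=> w h i; exact: h.
Qed.

End SampleRegularity.

Theorem corollary1p5 (R : realType) (d : nat) (hd : (0 < d)%N) (k : domain)
    (disp : measure_display) (Omega : measurableType disp)
    (P : probability Omega R) (f : site R d k -> {RV P >-> R})
    (mu : {finite_measure set (borel R d) -> \bar R})
    (mu_ac : {measure set (borel R d) -> \bar R})
    (f_SGF : is_SGF f)
    (mu_spectral : is_spectral_measure (covariance_kernel f) mu)
    (mu_ac_part : is_ac_part mu mu_ac)
    (mu_ac_neq0 : mu_ac setT <> 0%E)
    (alpha_plus_lt : (alpha_plus k mu < d%:R%:E)%E)
    (mu_doubling : exists2 c : R, 0 < c & forall delta : R, 0 < delta ->
       (ball_mass k mu (2 * delta) <= c%:E * ball_mass k mu delta)%E) :
  asymp (theta f) (fun T => (ln T)%:E / ball_mass k mu T^-1)%E.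
Proof.
pose g (x : site R d k) (w : Omega) : R := f x w.
have gf : gaussian_field P g (spectral_cov loc mu) by exact: SGF_gaussian_field.
have mu0 := spectral_carrier mu_spectral.
have [alpha [T1 [ad mass_ge]]] := alpha_plus_mass mu k mu0 alpha_plus_lt.
have mass_gt0 (r : R) : 0 < r -> 0 < mass mu r.
  move=> r0; have ri : 0 < r^-1 by rewrite invr_gt0.
  have h := mass_ge (`|T1| + r^-1); apply: (@lt_le_trans _ _ (mass mu (`|T1| + r^-1)^-1)).
    apply: lt_le_trans (h _); first by rewrite expR_gt0.
    by have := ler_norm T1; lra.
  apply: mass_le; rewrite -[leRHS]invrK lef_pV2 ?posrE//; first by rewrite lerDr.
  by rewrite ltr_wpDl.
have [c c1 doubling] : exists2 c : R, 1 <= c & forall r, 0 < r -> mass mu (2 * r) <= c * mass mu r.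
  have [c c0 H] := mu_doubling; exists (Num.max c 1); first by rewrite le_max lexx orbT.
  move=> r r0; have := H r r0; rewrite !ball_massE// -EFinM lee_fin => /le_trans; apply.
  by rewrite ler_wpM2r ?mass_ge0// le_max lexx.
have [cB [E [cB0 mE muE bessel]]] := exists_bessel_set hd mu mu_ac mu_ac_part mu_ac_neq0.
have [s0 cell_bound] := exists_cell_bound P k f f_SGF.
have grid (eps : R) (e0 : 0 < eps) := exists_fine_grid mu k eps mu0 e0.
have [D1 D10 low] := persistence_lower_bound P loc (@locD R d k) mu c hd c1 doubling mass_gt0 grid
  g gf (site_io k) (@loc_site_io R d k) (cell k) (@loc_cell R d k) s0 cell_bound.
have [D2 D20 [T0 up]] := persistence_upper_bound P loc (@locD R d k) mu c hd c1 doubling mass_gt0 grid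
  g gf (site_io k) (@loc_site_io R d k) E cB mE cB0 muE bessel alpha T1 ad mass_ge.
(* The lower bound is obtained in a box of integer size N <= 2 T: one factor c for the mass at 1/N
   instead of 1/T, and a factor 2 from ln N <= 2 ln T. *)
exists D2, (D1 * (2 * c)); split => //.
have : \forall T \near +oo, `|T0| + 2 <= T by apply: nbhs_pinfty_ge; exact: num_real.
apply: filterS => T HT.
have TT0 : T0 <= T by have := ler_norm T0; lra.
have T2 : 2 <= T by have := normr_ge0 T0; lra.
have Tp : 0 < T by lra.
pose A := [set w | forall x, eball T (loc x) -> 0 <= f x w].
have mA : measurable A by exact: measurable_persistence.
pose M := mass mu T^-1; have M0 : 0 < M by apply: mass_gt0; rewrite invr_gt0.
have lnT : 0 < ln T by apply: ln_gt0; lra.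
have Q0 : 0 < ln T / M by rewrite divr_gt0.
have upA : prob P A <= expR (- (D2 * (ln T / M))).
  by apply: up => // w x Aw; exact: Aw.
(* T + 1 <= N leaves room for rounding coordinates down, and N <= T + 2 <= 2 T since T >= 2. *)
pose N := (Num.truncn T).+2.
have TN : T + 1 <= N%:R by rewrite -natr1 lerD2r ltW// truncnS_gt.
have NT : N%:R <= 2 * T.
  have /truncn_itv/andP[h _] : 0 <= T by exact: ltW.
  by rewrite /N -!natr1; lra.
have NR : 0 < N%:R :> R by rewrite ltr0n.
have lowA : expR (- (D1 * (2 * c) * (ln T / M))) <= prob P A.
  apply: (@le_trans _ _ (prob P (cells_persist g (site_io k) (cell k) N))); last first.
    apply: le_prob => //; first exact: (measurable_cells_persist g (site_io k) (cell k) (fun x => measurable_funPT (f x))).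
    by move=> w; exact: (cells_persist_ball P k f T N w f_SGF TN).
  apply: le_trans (low N _) => //; rewrite ler_expR lerN2 -mulrA ler_wpM2l ?(ltW D10)//.
  have MN : M <= c * mass mu N%:R^-1.
    apply: le_trans (doubling N%:R^-1 _); last by rewrite invr_gt0.
    by apply: mass_le; rewrite ler_pdivlMr// mulrC ler_pdivrMr.
  have lnN : ln N%:R <= 2 * ln T.
    rewrite mulrDl !mul1r -lnM ?posrE// ler_ln ?posrE ?mulr_gt0//.
    by apply: (le_trans NT); rewrite ler_wpM2r ?(ltW Tp).
  have mN0 : 0 < mass mu N%:R^-1 by apply: mass_gt0; rewrite invr_gt0.
  rewrite ler_pdivrMr//; apply: (le_trans lnN).
  have -> : 2 * c * (ln T / M) * mass mu N%:R^-1 = 2 * ln T * (c * mass mu N%:R^-1 / M) by ring.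
  by rewrite ler_peMr ?ler_pdivlMr ?mul1r// mulr_ge0// ltW.
have pA : 0 < prob P A by apply: lt_le_trans lowA; rewrite expR_gt0.
rewrite /theta -/A probE// lne_EFin// ball_massE// -/M.
rewrite inver gt_eqF// -EFinM inver gt_eqF// -EFinN -EFinM !lee_fin.
rewrite ler_pdivlMr// ler_pdivrMr// lerNr lerNl.
by rewrite -ler_expR lnK ?posrE// upA -ler_expR lnK ?posrE.
Qed.
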